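(* Suppose that the assumptions (A1)–(A6) on $g,h,c$ hold and that for some $\sigma>0$ we have $\|\nabla c(x_k)\|_{\mathrm{op}}\le\sigma$ for all $k\in\mathbb N$, where $(x_k)_{k\in\mathbb N}$ is generated by Algorithm 1 (all described in the context). Let $$\rho_{\max}=\begin{cases}\alpha\,\dfrac{L_c\sqrt{2L_h}}{1-\theta} & \text{if }\rho_{\min}<\dfrac{L_c\sqrt{2L_h}}{1-\theta},\\[2mm] \rho_{\min}&\text{otherwise.}\end{cases}$$ (a) Algorithm 1 finds a point $x\in\operatorname{dom} g$ satisfying $\omega(x)\le\epsilon$ within $$O\left(\frac{\sqrt{\Delta_0}}{\epsilon^2}\,(F(x_0)-F^* )\left(\rho_{\max}+\frac{L_c^2L_h}{\rho_{\min}}\right)\right)$$ iterations, and such a point is included in the sequence $(x_k)_{k\in\mathbb N}$. Furthermore, if the input parameter is set as $\rho_{\min}=\Theta(L_c\sqrt{L_h})$, this iteration bound simplifies to $$O\left(\frac{L_c\sqrt{L_h\Delta_0}}{\epsilon^2}\,(F(x_0)-F^* )\right).$$ (b) For sufficiently small $\epsilon>0$, Algorithm 1 in which every point of $S_{k,\mu}$ is computed by Algorithm 2 finds a point $x\in\operatorname{dom} g$ satisfying $\omega(x)\le\epsilon$ by calling the oracles $$O\Bigg(\frac{\sqrt{\Delta_0}}{\epsilon^2}(F(x_0)-F^* )\Big(\rho_{\max}+\frac{L_c^2L_h}{\rho_{\min}}\Big)\Big(1+\log^+\Big(\frac{L_c\sqrt{L_h}}{\rho_{\min}}\Big)\Big)\Big(1+\sqrt{1+\frac{L_h\sigma^2}{\rho_{\min}\sqrt{\Delta_0}}}\,\log\Big(1+\frac{L_h\sigma^2}{\rho_{\min}\sqrt{\Delta_0}}\Big)\Big)\Bigg)$$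 times, where $\log^+ z=\max\{\log z,0\}$, and such a point is included in the sequences $(\bar x_t)_{t\in\mathbb N}$ generated by Algorithm 2. Furthermore, if $\rho_{\min}=\Theta(L_c\sqrt{L_h})$, this oracle bound simplifies to $$O\left(\frac{L_c\sqrt{L_h\Delta_0}}{\epsilon^2}(F(x_0)-F^* )\,(1+\sqrt{\kappa}\log\kappa)\right),\qquad \kappa=1+\frac{\sqrt{L_h}\,\sigma^2}{L_c\sqrt{\Delta_0}}.$$
   Context: Problem. Minimize $F(x)=g(x)+h(c(x))$ over $x\in\mathbb R^d$, with $g:\mathbb R^d\to\mathbb R\cup\{+\infty\}$, $h:\mathbb R^n\to\mathbb R$ differentiable and $c:\mathbb R^d\to\mathbb R^n$ continuously differentiable with Jacobian $\nabla c(x)\in\mathbb R^{n\times d}$. $\|\cdot\|$ is the Euclidean norm, $\|\cdot\|_{\mathrm{op}}$ the spectral norm, $\operatorname{dom} g=\{x: g(x)<+\infty\}$. Assumptions: (A1) $g$ is proper closed convex; (A2) $h$ is convex; (A3) $\inf g>-\infty$; (A4) $\inf h>-\infty$; (A5) there is $L_h>0$ with $\|\nabla h(y)-\nabla h(x)\|\le L_h\|y-x\|$ for all $x,y\in\mathbb R^n$; (A6) there is $L_c>0$ with $\|\nabla c(y)-\nabla c(x)\|_{\mathrm{op}}\le L_c\|y-x\|$ for all $x,y\in\operatorname{dom} g$. Fixed numbers $g^*,h^*\in\mathbb R$ satisfy $g^*\le\inf g$, $h^*\le\inf h$. Notation. $H(x)=h(c(x))$, $F^*=\inf_x F(x)$,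 $\Delta_k=F(x_k)-(g^*+h^* )\ge0$. For $x_k\in\operatorname{dom} g$ and $\mu>0$: $\bar H_{k,\mu}(x)=h(c(x_k)+\nabla c(x_k)(x-x_k))+\frac{\mu}{2}\|x-x_k\|^2$ and $\bar F_{k,\mu}=g+\bar H_{k,\mu}$. With $\partial g$ the convex subdifferential, $\omega(x)=\min_{p\in\partial g(x)}\|p+\nabla H(x)\|$ and $\bar\omega_{k,\mu}(x)=\min_{p\in\partial g(x)}\|p+\nabla\bar H_{k,\mu}(x)\|$ (value $+\infty$ if $\partial g(x)=\emptyset$). $S_{k,\mu}=\{x\in\operatorname{dom} g:\bar\omega_{k,\mu}(x)\le\theta\mu\|x-x_k\|\}$. Algorithm 1. Input: $x_0\in\operatorname{dom} g$, $0<\theta<1$, $\rho_{\min}>0$, $\alpha>1$, $g^*,h^*$. Set $\rho\leftarrow\rho_{\min}$. For $k=0,1,\dots$: (i) set $\mu\leftarrow\rho\sqrt{F(x_k)-(g^*+h^* )}$; (ii) find some $x\in S_{k,\mu}$; (iii) if $F(x)\le F(x_k)-\frac{1-\theta}{2}\mu\|x-x_k\|^2$ does not hold, set $\rho\leftarrow\alpha\rho$ and go back to (i); (iv) set $(x_{k+1},\mu_k)\leftarrow(x,\mu)$. Convention: if $\Delta_k=0$, then $x_k$ is a global minimizer and the algorithm stops; the sequences are continued by $x_j=x_k$, $\mu_j=0$ for $j\ge k$. In (b), $\Delta_0>0$ is understood. Algorithm 2 (accelerated proximal gradient). Input: $k$, $\mu>0$, $0<\theta<1$, $0<\bar\beta<1<\bar\alpha$.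 Set $\bar x_0=z_0=x_k$, $\eta\leftarrow\bar\alpha\mu$, $b_0=0$. For $t=0,1,\dots$: 1. $b_{t+1}=\frac{1+2\eta b_t+\sqrt{1+4\eta b_t(1+\mu b_t)}}{2(\eta-\mu)}$, $\tau=\frac{(b_{t+1}-b_t)(1+\mu b_t)}{b_{t+1}(1+\mu b_t)+\mu b_t(b_{t+1}-b_t)}$; 2. $y_t=\bar x_t+\tau(z_t-\bar x_t)$; 3. $\bar x_{t+1}=\operatorname{prox}_{\eta^{-1}g}\big(y_t-\frac1\eta\nabla\bar H_{k,\mu}(y_t)\big)$; 4. if $\bar H_{k,\mu}(\bar x_{t+1})\le\bar H_{k,\mu}(y_t)+\langle\nabla\bar H_{k,\mu}(y_t),\bar x_{t+1}-y_t\rangle+\frac\eta2\|\bar x_{t+1}-y_t\|^2$ fails, set $\eta\leftarrow\bar\alpha\eta$ and return to step 1 (same $t$); 5. if $\|\nabla\bar H_{k,\mu}(\bar x_{t+1})-\nabla\bar H_{k,\mu}(y_t)-\eta(\bar x_{t+1}-y_t)\|\le\theta\mu\|\bar x_{t+1}-\bar x_0\|$, return $\bar x_{t+1}$; 6. $\phi=\frac{b_{t+1}-b_t}{1+\mu b_{t+1}}$, $z_{t+1}=(1-\mu\phi)z_t+\mu\phi y_t+\eta\phi(\bar x_{t+1}-y_t)$, $\eta\leftarrow\bar\beta\eta$. Here $\operatorname{prox}_{sg}(x)=\operatorname{argmin}_z\{g(z)+\frac1{2s}\|z-x\|^2\}$. Oracles: each evaluation of $c(x)$, $\nabla c(x)u$,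 $\nabla c(x)^\top v$, $h(y)$, $\nabla h(y)$ or $\operatorname{prox}_{sg}(x)$ (for given $x,u\in\mathbb R^d$, $y,v\in\mathbb R^n$, $s>0$) is one oracle call. $O$-notation is for $\epsilon\to0$ with the problem and parameters fixed; hidden constants depend only on the algorithmic constants $\theta,\alpha$ (and $\bar\alpha,\bar\beta$ in (b)), and on the constants in $\Theta(\cdot)$ where that is used. That is, there is such a constant $C$ so that for each instance the number in question is at most $C$ times the displayed expression for all sufficiently small $\epsilon>0$.
   Formalization: In (b) the bound counts calls until some value computed for x̄_{t+1} at step 3, possibly rejected at step 4, has ω≤ε; that the final sequences (x̄_t) contain such a point is proved without a count, since the counted claim for them fails when Δ_k is tiny; division by η−μ=0 is read as 0. *)

(* Defs.v *)
From HB Require Import structures.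
From mathcomp Require Import all_boot all_order all_algebra.
From mathcomp Require Import all_classical all_reals all_analysis.
Import Order.TTheory GRing.Theory Num.Theory.
Import numFieldNormedType.Exports.

Set Implicit Arguments.
Unset Strict Implicit.
Unset Printing Implicit Defensive.

Local Open Scope classical_set_scope.
Local Open Scope ring_scope.

(* Vectors are row vectors, so the library Jacobian ['J c x : 'M_(d, n)] is the
   transpose of the usual n x d Jacobian matrix:
   [u *m 'J c x] is the Jacobian applied to u, and [v *m ('J c x)^T] is its
   transpose applied to v.  The library norm [`|_|] on matrices is the sup
   norm (same topology), hence the separate Euclidean norm below. *)

Section Euclidean.
Context {R : realType}.

Definition dotp (n : nat) (u v : 'rV[R]_n) : R := \sum_i u 0 i * v 0 i.

Definition enorm (n : nat) (u : 'rV[R]_n) : R := Num.sqrt (dotp u u).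

(* A and its transpose have the same spectral norm. *)
Definition opnorm (d n : nat) (A : 'M[R]_(d, n)) : R :=
  sup [set enorm (u *m A) | u in [set u : 'rV[R]_d | enorm u <= 1]].

Definition grad (n : nat) (f : 'rV[R]_n -> R) (x : 'rV[R]_n) : 'rV[R]_n :=
  \row_i 'd f x (delta_mx 0 i).

End Euclidean.

Section ConvexAnalysis.
Context {R : realType} {d : nat}.
Implicit Types (g : 'rV[R]_d -> \bar R) (x y p : 'rV[R]_d).

Definition dom g : set 'rV[R]_d := [set x | (g x < +oo)%E].

Definition proper g : Prop := (forall x, g x != -oo%E) /\ dom g !=set0.

(* The library's [convex_function] is for real-valued functions only. *)
Definition econvex g : Prop := forall x y (t : R), 0 < t < 1 ->
  (g (t *: x + (1 - t) *: y)%R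
     <= t%:E * g x + (1 - t)%:E * g y)%E.

Definition subdiff g x : set 'rV[R]_d :=
  [set p | forall y, (g x + (dotp p (y - x))%:E <= g y)%E].

(* If [g] is proper, closed and convex and [0 < s], the argmin is a singleton,
   so the default value [x] of [xget] is not used. *)
Definition prox (s : R) g x : 'rV[R]_d :=
  xget x [set z | forall w, (g z + (enorm (z - x) ^+ 2 / (2 * s))%:E
                              <= g w + (enorm (w - x) ^+ 2 / (2 * s))%:E)%E].

(* [min_(p in subdiff g x) |p + v|].  The subdifferential is closed, so the
   infimum is attained when it is nonempty; [ereal_inf set0 = +oo]. *)
Definition residual g x v : \bar R :=
  ereal_inf [set (enorm (p + v))%:E | p in subdiff g x].

End ConvexAnalysis.

Record problem (R : realType) (d n : nat) := Problem {
  pg : 'rV[R]_d -> \bar R;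
  ph : 'rV[R]_n -> R;
  pc : 'rV[R]_d -> 'rV[R]_n;
  Lh : R;
  Lc : R;
  gstar : R;
  hstar : R }.

Record assumptions (R : realType) (d n : nat) (P : problem R d n) : Prop :=
  Assumptions {
  h_differentiable : forall y, differentiable (ph P) y;
  c_differentiable : forall x, differentiable (pc P) x;
  c_C1 : continuous (fun x => 'J (pc P) x);
  g_proper : proper (pg P);
  g_closed : lower_semicontinuous (pg P);
  g_convex : econvex (pg P);
  h_convex : convex_function setT (ph P);
  g_inf : (-oo < ereal_inf (range (pg P)))%E;
  h_inf : (-oo < ereal_inf (range (fun y => (ph P y)%:E)))%E;
  Lh_gt0 : 0 < Lh P;
  h_smooth : forall x y,
    enorm (grad (ph P) y - grad (ph P) x) <= Lh P * enorm (y - x);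
  Lc_gt0 : 0 < Lc P;
  c_smooth : forall x y, dom (pg P) x -> dom (pg P) y ->
    opnorm ('J (pc P) y - 'J (pc P) x) <= Lc P * enorm (y - x);
  gstar_le : ((gstar P)%:E <= ereal_inf (range (pg P)))%E;
  hstar_le : ((hstar P)%:E <= ereal_inf (range (fun y => (ph P y)%:E)))%E }.

Section Objective.
Context {R : realType} {d n : nat} (P : problem R d n).
Local Notation g := (pg P).
Local Notation h := (ph P).
Local Notation c := (pc P).
Implicit Types x xk : 'rV[R]_d.

Definition H x : R := h (c x).

Definition F x : \bar R := (g x + (H x)%:E)%E.

Definition Fstar : R := fine (ereal_inf (range F)).

(* The real number [F x - (gstar + hstar)], for [x] in [dom g]. *)
Definition Delta x : R := fine (F x) - (gstar P + hstar P).

Definition Hbar xk (mu : R) x : R :=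
  h (c xk + (x - xk) *m 'J c xk) + mu / 2 * enorm (x - xk) ^+ 2.

Definition omega x : \bar R := residual g x (grad H x).

Definition omegabar xk mu x : \bar R := residual g x (grad (Hbar xk mu) x).

Definition Sset (theta : R) xk mu : set 'rV[R]_d :=
  [set x | dom g x /\ (omegabar xk mu x <= (theta * mu * enorm (x - xk))%:E)%E].

(* The test of step (iii). *)
Definition decrease (theta : R) xk mu x : bool :=
  (F x <= F xk - ((1 - theta) / 2 * mu * enorm (x - xk) ^+ 2)%:E)%E.

End Objective.

(* A run is indexed by the passes through (i)-(iii), accepted or rejected: its
   j-th state holds the current iterate x_k and the current rho after j passes.
   The sequence of the [iterate (s j)], without the repetitions due to
   rejections, is (x_k).  There is no assumption that some pass is eventually
   accepted. *)
Record state1 (R : realType) (d : nat) := State1 {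
  iterate : 'rV[R]_d;
  rho : R }.

Section Algorithm1.
Context {R : realType} {d n : nat} (P : problem R d n).
Variables theta alpha : R.

Inductive pass (s : state1 R d) : state1 R d -> Prop :=
| pass_stopped : Delta P (iterate s) = 0 -> pass s s
| pass_accepted (mu : R) (x : 'rV[R]_d) :
    Delta P (iterate s) != 0 ->
    mu = rho s * Num.sqrt (Delta P (iterate s)) ->
    Sset P theta (iterate s) mu x ->
    decrease P theta (iterate s) mu x ->
    pass s (State1 x (rho s))
| pass_rejected (mu : R) (x : 'rV[R]_d) :
    Delta P (iterate s) != 0 ->
    mu = rho s * Num.sqrt (Delta P (iterate s)) ->
    Sset P theta (iterate s) mu x ->
    ~~ decrease P theta (iterate s) mu x ->
    pass s (State1 (iterate s) (alpha * rho s)).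

Definition run1 (rho_min : R) (x0 : 'rV[R]_d) (s : nat -> state1 R d) : Prop :=
  s 0%N = State1 x0 rho_min /\ forall j, pass (s j) (s j.+1).

End Algorithm1.

(* A computation that calls oracles: its result and its number of calls. *)
Definition counted (T : Type) : Type := (T * nat)%type.
Definition ret (T : Type) (x : T) : counted T := (x, 0%N).
Definition call (T : Type) (x : T) : counted T := (x, 1%N).
Definition bind (T U : Type) (m : counted T) (f : T -> counted U) : counted U :=
  ((f m.1).1, (m.2 + (f m.1).2)%N).
Notation "'let*' x ':=' m 'in' e" := (bind m (fun x => e))
  (at level 200, x name, m at level 200, e at level 200,
   format "'[v' 'let*'  x  ':='  m  'in' '//' e ']'").

(* Loop variables of Algorithm 2: eta, b_t, xbar_t and z_t. *)
Record state2 (R : realType) (d : nat) := State2 {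
  eta : R;
  bb : R;
  xbar : 'rV[R]_d;
  zz : 'rV[R]_d }.

(* State of Algorithm 1 with Algorithm 2 as subroutine.
   [sub = None]: Algorithm 1 is about to do step (i);
   [sub = Some (mu, s)]: Algorithm 2 with parameter mu is about to do step 1.
   [last_xbar] is the last value given to a variable xbar_t: either
   xbar_0 = x_k or a value computed at step 3, whether or not step 4 then asks
   for a larger eta.  (Counting rejected values makes an oracle bound possible in which
   Delta x_k does not appear: the first search for eta takes about
   log (1 / Delta x_k) trials.) *)
Record state12 (R : realType) (d : nat) := State12 {
  outer : state1 R d;
  sub : option (R * state2 R d);
  last_xbar : 'rV[R]_d }.

(* The value of xbar_t for the current t, i.e. the last element of the sequence
   (xbar_t) that has passed step 4. *)
Definition current_xbar (R : realType) (d : nat) (s : state12 R d) : 'rV[R]_d :=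
  if sub s is Some (_, s2) then xbar s2 else iterate (outer s).

Section Algorithm12.
Context {R : realType} {d n : nat} (P : problem R d n).
Variables theta alpha abar bbar : R.
Implicit Types (x xk u : 'rV[R]_d) (y v : 'rV[R]_n) (mu : R).

Definition oracle_c x := call (pc P x).
Definition oracle_J x u := call (u *m 'J (pc P) x).
Definition oracle_Jt x v := call (v *m ('J (pc P) x)^T).
Definition oracle_h y := call (ph P y).
Definition oracle_gradh y := call (grad (ph P) y).
Definition oracle_prox (s : R) x := call (prox s (pg P) x).

Definition eval_F x : counted (\bar R) :=
  let* cx := oracle_c x in
  let* hcx := oracle_h cx in
  ret (pg P x + hcx%:E)%E.

Definition eval_lin xk x : counted 'rV[R]_n :=
  let* cxk := oracle_c xk in
  let* v := oracle_J xk (x - xk) in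
  ret (cxk + v).

Definition eval_Hbar xk mu x : counted R :=
  let* y := eval_lin xk x in
  let* hy := oracle_h y in
  ret (hy + mu / 2 * enorm (x - xk) ^+ 2).

(* By the chain rule; see [eval_grad_HbarE]. *)
Definition eval_grad_Hbar xk mu x : counted 'rV[R]_d :=
  let* y := eval_lin xk x in
  let* v := oracle_gradh y in
  let* w := oracle_Jt xk v in
  ret (w + mu *: (x - xk)).

(* Step (i), then the initialization of Algorithm 2. *)
Definition start (s : state1 R d) : counted (state12 R d) :=
  let xk := iterate s in
  let* Fxk := eval_F xk in
  let D := fine Fxk - (gstar P + hstar P) in
  let mu := rho s * Num.sqrt D in
  ret (if D == 0 then State12 s None xk
       else State12 s (Some (mu, State2 (abar * mu) 0 xk xk)) xk).

(* Steps (iii) and (iv), for the point [x] returned by Algorithm 2. *)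
Definition finish (s : state1 R d) mu x : counted (state12 R d) :=
  let xk := iterate s in
  let* Fxk := eval_F xk in
  let* Fx := eval_F x in
  ret (if (Fx <= Fxk - ((1 - theta) / 2 * mu * enorm (x - xk) ^+ 2)%:E)%E
       then State12 (State1 x (rho s)) None x
       else State12 (State1 xk (alpha * rho s)) None x).

(* One pass through steps 1-6 of Algorithm 2.  Nothing prevents [eta <= mu]
   after step 6; then b' and tau are meaningless, but harmless: either step 4
   fails, or step 5 succeeds and [x] is the minimizer of the subproblem. *)
Definition inner (s : state1 R d) mu (s2 : state2 R d) : counted (state12 R d) :=
  let xk := iterate s in
  let: State2 eta b xb z := s2 in
  let b' := (1 + 2 * eta * b + Num.sqrt (1 + 4 * eta * b * (1 + mu * b)))
            / (2 * (eta - mu)) in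
  let tau := (b' - b) * (1 + mu * b)
             / (b' * (1 + mu * b) + mu * b * (b' - b)) in
  let y := xb + tau *: (z - xb) in
  let* Gy := eval_grad_Hbar xk mu y in
  let* x := oracle_prox eta^-1 (y - eta^-1 *: Gy) in
  let* Hx := eval_Hbar xk mu x in
  let* Hy := eval_Hbar xk mu y in
  if Hx <= Hy + dotp Gy (x - y) + eta / 2 * enorm (x - y) ^+ 2 then
    let* Gx := eval_grad_Hbar xk mu x in
    if enorm (Gx - Gy - eta *: (x - y)) <= theta * mu * enorm (x - xk) then
      finish s mu x
    else
      let phi := (b' - b) / (1 + mu * b') in
      let z' := (1 - mu * phi) *: z + (mu * phi) *: y
                + (eta * phi) *: (x - y) in
      ret (State12 s (Some (mu, State2 (bbar * eta) b' x z')) x)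
  else ret (State12 s (Some (mu, State2 (abar * eta) b xb z)) x).

Definition step12 (s : state12 R d) : counted (state12 R d) :=
  if sub s is Some (mu, s2) then inner (outer s) mu s2 else start (outer s).

(* The state after [j] steps and the number of oracle calls made so far. *)
Fixpoint run12 (rho_min : R) (x0 : 'rV[R]_d) (j : nat) : counted (state12 R d) :=
  if j is j'.+1 then let* s := run12 rho_min x0 j' in step12 s
  else ret (State12 (State1 x0 rho_min) None x0).

End Algorithm12.

Section ChainRule.

Lemma enorm_sqr (R : realType) n (u : 'rV[R]_n) : enorm u ^+ 2 = dotp u u.
Proof.
rewrite sqr_sqrtr //; apply: sumr_ge0 => i _; rewrite -expr2; exact: sqr_ge0.
Qed.

Lemma differentiable_mulmxr (R : realType) d n (A : 'M[R]_(d, n)) (x : 'rV[R]_d) :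
  differentiable (fun u : 'rV[R]_d => u *m A) x.
Proof.
have -> : (fun u : 'rV[R]_d => u *m A)
   = \sum_(i < d) (fun u : 'rV[R]_d => u 0 i *: row i A).
  by apply/funext => u; rewrite mulmx_sum_row fct_sumE.
apply: differentiable_sum => i.
exact/differentiableZl/differentiable_coord.
Qed.

Lemma diff_mulmxr (R : realType) d n (A : 'M[R]_(d, n)) (x v : 'rV[R]_d) :
  'd (fun u : 'rV[R]_d => u *m A) x v = v *m A.
Proof.
rewrite (_ : (fun u => _) = mulmxr A) // diff_lin // => y.
exact/differentiable_continuous/differentiable_mulmxr.
Qed.

Lemma diff_coord (R : realType) d (i : 'I_d) (x v : 'rV[R]_d) :
  'd (fun u : 'rV[R]_d => u 0 i : R) x v = v 0 i.
Proof.
have @f : {linear 'rV[R]_d -> R}.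
  by exists (fun N : 'rV[R]_d => N 0 i); do 2![eexists]; do ?[constructor];
     rewrite ?mxE// => ? *; rewrite ?mxE//; move=> ?; rewrite !mxE.
by rewrite (_ : (fun _ => _) = f) // diff_lin //; exact: coord_continuous.
Qed.

Lemma diff_cstD (R : realType) (V W : normedModType R) (a : W) (f : V -> W) x v :
  differentiable f x -> 'd (cst a + f) x v = 'd f x v.
Proof.
move=> df; rewrite diffD // -[LHS]/('d (cst a) x v + 'd f x v) diff_cst.
by rewrite -[(0 : V -> W) v]/(0 : W) add0r.
Qed.

Lemma eval_grad_HbarE (R : realType) d n (P : problem R d n)
    (xk : 'rV[R]_d) (mu : R) (x : 'rV[R]_d) :
  (forall y, differentiable (ph P) y) ->
  (eval_grad_Hbar P xk mu x).1 = grad (Hbar P xk mu) x.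
Proof.
move=> dh; rewrite /eval_grad_Hbar /eval_lin /=.
set A := 'J (pc P) xk; set y := (_ + _ *m A).
pose L (u : 'rV[R]_d) := (pc P xk - xk *m A) + u *m A.
have Ly : L x = y by rewrite /L /y mulmxBl addrA addrAC.
have dA u := differentiable_mulmxr A u.
have EL : L = cst (pc P xk - xk *m A) + (fun u => u *m A) by [].
have dL : differentiable L x by rewrite EL; apply: differentiableD.
have vL v : 'd L x v = v *m A.
  by rewrite EL diff_cstD // diff_mulmxr.
have dc j : differentiable (fun u : 'rV[R]_d => u 0 j : R) x.
  exact: differentiable_coord.
pose q j (u : 'rV[R]_d) : R := u 0 j - xk 0 j.
have Eq j : q j = cst (- xk 0 j) + (fun u : 'rV[R]_d => u 0 j : R).
  by apply/funext => u; rewrite /q addrC.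
have dq j : differentiable (q j) x by rewrite Eq; apply: differentiableD.
have vq j v : 'd (q j) x v = v 0 j.
  by rewrite Eq diff_cstD // diff_coord.
have dq2 j : differentiable (q j ^+ 2) x by apply: differentiableX.
have vq2 j v : 'd (q j ^+ 2) x v = 2 * q j x * v 0 j.
  by rewrite diffX //= vq expr1.
have dQ (r : seq 'I_d) : differentiable (\sum_(j <- r) q j ^+ 2) x /\
    forall v, 'd (\sum_(j <- r) q j ^+ 2) x v = \sum_(j <- r) 2 * q j x * v 0 j.
  elim: r => [|j r [IH1 IH2]].
    rewrite big_nil; split=> [|v]; first exact: differentiable_cst.
    by rewrite (_ : 0 = cst 0) // diff_cst big_nil.
  rewrite big_cons; split=> [|v]; first exact: differentiableD.
  by rewrite big_cons diffD //= vq2 IH2.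
have [dS vS] := dQ (index_enum 'I_d).
have -> : Hbar P xk mu = (ph P \o L) + (mu / 2) *: \sum_j (q j) ^+ 2.
  apply/funext => u; rewrite /Hbar enorm_sqr.
  rewrite -[RHS]/(ph P (L u) + mu / 2 * (\sum_j q j ^+ 2) u) /L mulmxBl.
  congr (ph P _ + mu / 2 * _); first by rewrite addrCA addrC -addrA [- _ + _]addrC addrA.
  rewrite fct_sumE; apply: eq_bigr => j _.
  by rewrite exprfctE /q !mxE expr2.
have dhL : differentiable (ph P \o L) x by apply: differentiable_comp.
have dZ : differentiable ((mu / 2) *: \sum_j (q j) ^+ 2) x by apply: differentiableZ.
apply/rowP => i; rewrite !mxE diffD //= diff_comp //= diffZ //= vS vL Ly.
congr (_ + _).
  rewrite -rowE [in RHS](row_sum_delta (row i A)) linear_sum /=.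
  by apply: eq_bigr => k _; rewrite !mxE linearZ /= mulrC.
rewrite (bigD1 i) //= big1 => [|j ji]; first by
  rewrite !mxE !eqxx /= addr0 mulr1 /q -[RHS]/(mu / 2 * (2 * (x 0 i - xk 0 i))) mulrA divfK.
by rewrite mxE (negbTE ji) andbF mulr0.
Qed.

End ChainRule.

Section Bounds.
Context {R : realType} {d n : nat} (P : problem R d n).
Variables (theta alpha : R).
Implicit Types (x : 'rV[R]_d) (rho_min sigma eps : R).

Definition gap x0 : R := fine (F P x0) - Fstar P.

Definition rho_max rho_min : R :=
  let r := Lc P * Num.sqrt (2 * Lh P) / (1 - theta) in
  if rho_min < r then alpha * r else rho_min.

Definition logp (z : R) : R := Num.max (ln z) 0.

Definition iteration_bound rho_min x0 eps : R :=
  Num.sqrt (Delta P x0) / eps ^+ 2 * gap x0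
  * (rho_max rho_min + Lc P ^+ 2 * Lh P / rho_min).

Definition simple_iteration_bound x0 eps : R :=
  Lc P * Num.sqrt (Lh P * Delta P x0) / eps ^+ 2 * gap x0.

Definition oracle_bound rho_min sigma x0 eps : R :=
  let q := Lh P * sigma ^+ 2 / (rho_min * Num.sqrt (Delta P x0)) in
  iteration_bound rho_min x0 eps
  * (1 + logp (Lc P * Num.sqrt (Lh P) / rho_min))
  * (1 + Num.sqrt (1 + q) * ln (1 + q)).

Definition simple_oracle_bound sigma x0 eps : R :=
  let kappa := 1 + Num.sqrt (Lh P) * sigma ^+ 2
                   / (Lc P * Num.sqrt (Delta P x0)) in
  simple_iteration_bound x0 eps * (1 + Num.sqrt kappa * ln kappa).

End Bounds.

(* Main.v *)
From HB Require Import structures.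
Require Import Defs.
From mathcomp Require Import all_boot all_order all_algebra.
From mathcomp Require Import all_classical all_reals all_analysis.
From mathcomp Require Import ring lra.
Import Order.TTheory GRing.Theory Num.Theory.
Import numFieldNormedType.Exports.

Local Open Scope classical_set_scope.
Local Open Scope ring_scope.
Set Implicit Arguments.
Unset Strict Implicit.
Unset Printing Implicit Defensive.

(** Why the theorem holds.

    Outer method.  Near-stationarity of [x] for the strongly convex model gives
    the decrease [(1 - theta) mu |x - xk|^2] of the linearized objective
    ([Sset_model_decrease]).  Since [|grad h|^2 <= 2 Lh (h - hstar)], the error of
    the linearization is controlled by [sqrt Delta], so that the choice
    [mu = rho sqrt Delta] makes the decrease test succeed as soon as [rho] exceeds
    [Lc sqrt (2 Lh) / (1 - theta)] ([large_rho_decrease]).  Hence [rho] stays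
    below [rho_max], and there are boundedly many rejections.  The residual at an
    accepted point is at most a term linear in [|x - xk|] plus a quadratic one.
    While it exceeds [eps], each accepted step therefore either decreases the
    objective by an amount of order [eps^2 / (sqrt Delta K)], with
    [K = rho_max + Lc^2 Lh / rho_min], or decreases [sqrt Delta] by an amount of
    order [eps] ([accepted_dichotomy]).  Steps of the second kind number
    [O(1 / eps)], which is negligible against [1 / eps^2].  The lemma
    [run1_budget] sums this up with a cost attached to each step; unit costs give
    part (a) ([outer_complexity]).

    Inner method.  The weights [b] satisfy [eta (b' - b)^2 = b' (1 + mu b')], for
    which the potential [b (F x - F u) + (1 + mu b) / 2 |z - u|^2] of the
    accelerated method does not increase ([potential_decrease]); [F] is the model
    and [u] its minimizer.  As [b] grows by the factor [1 + sqrt (mu / M)], where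
    [M] bounds [eta], all points come close to [u] and the stopping test succeeds
    ([stopping_test]).  A balance of [ln eta] compares rejected values of [eta]
    with accepted ones.  With [q = Lh sigma^2 / mu], a pass thus takes a number of
    steps of order [subproblem_cost q = 1 + sqrt (1 + q) ln (1 + q)]
    ([pass_terminates]), and each step makes at most 19 calls.

    Combination.  The product of [sqrt Delta] with the cost of a subproblem does
    not increase along the iterates, up to a constant ([pass_cost_balance]), so
    the budget with these costs gives the main term, with [Delta x0] in it.  The
    passes that are not paid for in this way, namely the rejected ones, the
    [O(1 / eps)] ones of the second kind and the last one, must contribute
    [o(1 / eps^2)].  The cost of a subproblem is at most [5 (1 + q)^(3/4)], which
    suffices as long as [sqrt Delta] is at least of order [eps^2].  If it is
    smaller, there is no need to solve the subproblem: one of the first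
    [O(1 / eps)] trial points has a residual of at most [eps]
    ([small_Delta_pass]). *)


(** * Euclidean geometry *)

Section EuclideanGeometry.
Context {R : realType}.

Section Dotp.
Context {n : nat}.
Implicit Types (u v w : 'rV[R]_n) (a : R).

Lemma dotpC u v : dotp u v = dotp v u.
Proof. by apply: eq_bigr => i _; rewrite mulrC. Qed.

Lemma dotpDl u v w : dotp (u + v) w = dotp u w + dotp v w.
Proof. by rewrite -big_split; apply: eq_bigr => i _; rewrite mxE mulrDl. Qed.

Lemma dotpZl a u v : dotp (a *: u) v = a * dotp u v.
Proof. by rewrite mulr_sumr; apply: eq_bigr => i _; rewrite mxE mulrA. Qed.

Lemma dotpNl u v : dotp (- u) v = - dotp u v.
Proof. by rewrite -scaleN1r dotpZl mulN1r. Qed.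

Lemma dotpDr u v w : dotp u (v + w) = dotp u v + dotp u w.
Proof. by rewrite !(dotpC u) dotpDl. Qed.

Lemma dotpZr a u v : dotp u (a *: v) = a * dotp u v.
Proof. by rewrite !(dotpC u) dotpZl. Qed.

Lemma dotpNr u v : dotp u (- v) = - dotp u v.
Proof. by rewrite !(dotpC u) dotpNl. Qed.

Definition dotpE := (dotpDl, dotpDr, dotpZl, dotpZr, dotpNl, dotpNr).

Lemma dotp_ge0 u : 0 <= dotp u u.
Proof. by rewrite -enorm_sqr sqr_ge0. Qed.

Lemma enorm_ge0 u : 0 <= enorm u.
Proof. exact: sqrtr_ge0. Qed.

Lemma dotp_eq0 u : dotp u u = 0 -> u = 0.
Proof.
move=> u0; apply/rowP => i; rewrite mxE.
have sq0 j : true -> 0 <= u 0 j * u 0 j by rewrite -expr2 sqr_ge0.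
by have /eqP := psumr_eq0P sq0 u0 (i := i) isT; rewrite mulf_eq0 orbb => /eqP.
Qed.

Lemma enorm_eq0 u : enorm u = 0 -> u = 0.
Proof. by move=> u0; apply: dotp_eq0; rewrite -enorm_sqr u0 expr0n. Qed.

Lemma dotp0l u : dotp 0 u = 0.
Proof. by rewrite -(scale0r (0 : 'rV_n)) dotpZl mul0r. Qed.

Lemma enorm0 : enorm (0 : 'rV[R]_n) = 0.
Proof. by rewrite /enorm dotp0l sqrtr0. Qed.

(** The Cauchy--Schwarz inequality, from the sign of
    [|a v - b u|^2] with [a = |u|] and [b = |v|]. *)
Lemma dotp_le u v : dotp u v <= enorm u * enorm v.
Proof.
have u0 := enorm_ge0 u; have v0 := enorm_ge0 v.
have [/enorm_eq0->|un] := eqVneq (enorm u) 0.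
  by rewrite dotp0l enorm0 mul0r.
have [/enorm_eq0->|vn] := eqVneq (enorm v) 0.
  by rewrite dotpC dotp0l enorm0 mulr0.
have uv : 0 < 2 * (enorm u * enorm v) by rewrite !mulr_gt0 // lt_def ?un ?vn.
rewrite -(ler_pM2l uv) -subr_ge0.
have := dotp_ge0 (enorm u *: v - enorm v *: u).
by rewrite !dotpE -!enorm_sqr (dotpC v u); congr (0 <= _); ring.
Qed.

Lemma enormN u : enorm (- u) = enorm u.
Proof. by rewrite /enorm dotpNl dotpNr opprK. Qed.

Lemma enormB u v : enorm (u - v) = enorm (v - u).
Proof. by rewrite -enormN opprB. Qed.

Lemma normr_dotp_le u v : `|dotp u v| <= enorm u * enorm v.
Proof. by rewrite ler_norml lerNl -dotpNl -(enormN u) !dotp_le enormN dotp_le. Qed.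

Lemma enormZ a u : enorm (a *: u) = `|a| * enorm u.
Proof.
by rewrite /enorm dotpZl dotpZr mulrA -expr2 sqrtrM ?sqr_ge0 // sqrtr_sqr.
Qed.

Lemma ler_enormD u v : enorm (u + v) <= enorm u + enorm v.
Proof.
rewrite -(@ler_pXn2r _ 2) ?nnegrE ?addr_ge0 ?enorm_ge0 //.
rewrite sqrrD !enorm_sqr !dotpE (dotpC v u).
have := dotp_le u v; lra.
Qed.

Lemma ler_enormB u v : enorm (u - v) <= enorm u + enorm v.
Proof. by rewrite -(enormN v) ler_enormD. Qed.

Lemma ler_distD_enorm w u v : enorm (u - v) <= enorm (u - w) + enorm (w - v).
Proof. by rewrite -{1}(subrK w u) -addrA ler_enormD. Qed.

Lemma normr_coord_le_enorm u i : `|u 0 i| <= enorm u.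
Proof.
rewrite -(@ler_pXn2r _ 2) ?nnegrE ?enorm_ge0 //.
rewrite real_normK ?num_real // enorm_sqr /dotp (bigD1 i) //= expr2 lerDl.
by apply: sumr_ge0 => j _; rewrite -expr2 sqr_ge0.
Qed.

(** Turns Euclidean bounds into bounds for the sup norm, which defines the
    topology on matrices. *)
Lemma normr_le_enorm u : `|u| <= enorm u.
Proof.
rewrite [leLHS]/Num.norm /= mx_normrE; apply/bigmax_leP; split=> [|[i j] _] /=.
  exact: enorm_ge0.
by rewrite (ord1 i) normr_coord_le_enorm.
Qed.

End Dotp.

Section Opnorm.
Context {d n : nat}.
Implicit Types (A B : 'M[R]_(d, n)) (u : 'rV[R]_d) (v : 'rV[R]_n).

(** The set in the definition of [opnorm] is bounded: each coordinate of
    [u *m A] is the inner product of [u] with a column of [A]. *)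
Lemma has_sup_opnorm A :
  has_sup [set enorm (u *m A) | u in [set u : 'rV[R]_d | enorm u <= 1]].
Proof.
split; first by exists (enorm (0 *m A)); exists 0 => //=; rewrite enorm0.
exists (Num.sqrt (\sum_j enorm (col j A)^T ^+ 2)) => _ /= [u u1 <-].
rewrite ler_wsqrtr // /dotp; apply: ler_sum => j _.
have -> : (u *m A) 0 j = dotp u (col j A)^T.
  by rewrite mxE; apply: eq_bigr => i _; rewrite !mxE.
rewrite -expr2 -real_normK ?num_real // ler_pXn2r ?nnegrE ?enorm_ge0 //.
by apply: (le_trans (normr_dotp_le _ _)); rewrite ler_piMl ?enorm_ge0.
Qed.

Lemma opnorm_ge0 A : 0 <= opnorm A.
Proof.
have /ubP := sup_upper_bound (has_sup_opnorm A).
by apply; exists 0; rewrite /= ?enorm0 ?mul0mx ?enorm0.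
Qed.

Lemma enorm_mulmx_le A u : enorm (u *m A) <= opnorm A * enorm u.
Proof.
have [/enorm_eq0->|un] := eqVneq (enorm u) 0.
  by rewrite mul0mx !enorm0 mulr0.
have u0 : 0 < enorm u by rewrite lt_def un enorm_ge0.
rewrite -ler_pdivrMr // mulrC -[(enorm u)^-1]ger0_norm ?invr_ge0 ?enorm_ge0 //.
rewrite -enormZ scalemxAl; apply: sup_upper_bound; first exact: has_sup_opnorm.
exists ((enorm u)^-1 *: u) => //=.
by rewrite enormZ ger0_norm ?invr_ge0 ?enorm_ge0 // mulVf.
Qed.

Lemma dotp_mulmx A u v : dotp (u *m A) v = dotp u (v *m A^T).
Proof.
rewrite /dotp; under eq_bigr do rewrite mxE mulr_suml.
rewrite exchange_big; apply: eq_bigr => i _; rewrite mxE mulr_sumr.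
by apply: eq_bigr => j _; rewrite mxE; ring.
Qed.

Lemma enorm_mulmx_tr_le A v : enorm (v *m A^T) <= opnorm A * enorm v.
Proof.
set w := v *m A^T; have [w0|wn] := eqVneq (enorm w) 0.
  by rewrite w0 mulr_ge0 ?opnorm_ge0 ?enorm_ge0.
have w0 : 0 < enorm w by rewrite lt_def wn enorm_ge0.
rewrite -(ler_pM2l w0) -expr2 enorm_sqr {2}/w -dotp_mulmx.
apply: (le_trans (dotp_le _ _)).
by rewrite mulrA ler_wpM2r ?enorm_ge0 // mulrC enorm_mulmx_le.
Qed.

End Opnorm.

End EuclideanGeometry.


(** * Differential calculus along segments *)

Section Segments.
Context {R : realType}.

Lemma is_derive_line (V W : normedModType R) (f : V -> W) (x v : V) (t : R) :
  differentiable f (x + t *: v) ->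
  is_derive t 1 (fun s : R => f (x + s *: v)) ('d f (x + t *: v) v).
Proof.
move=> df; have := derivableP (@diff_derivable _ _ _ f _ v df).
rewrite deriveE // => -[dfv Efv].
have E : (fun h : R => h^-1 *: ((fun s : R => f (x + s *: v)) (h *: 1 + t)
                       - f (x + t *: v))) =
         (fun h : R => h^-1 *: (f (h *: v + (x + t *: v)) - f (x + t *: v))).
  apply/funext => h; congr (_ *: (f _ - _)).
  by rewrite [h *: 1]mulr1 scalerDl addrCA.
by split; [rewrite /derivable E | rewrite /derive E -Efv].
Qed.

Lemma is_derive_le_slope (phi : R -> R) (a M : R) :
  is_derive (0 : R) 1 phi a ->
  (forall t, 0 < t < 1 -> phi t - phi 0 <= t * M) -> a <= M.
Proof.
move=> [dphi <-] slope.
have cphi : (fun h : R => h^-1 *: (phi (h *: 1 + 0) - phi 0)) @ 0^'+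
    --> 'D_1 phi 0 by exact: cvg_dnbhs_at_right dphi.
apply: (cvgr_to_le cphi); near=> h.
have h0 : 0 < h by near: h; exact: nbhs_right_gt.
rewrite /= -[_ *: _]/(_ * _) addr0 [h *: 1]mulr1 ler_pdivrMl //.
apply: slope; rewrite h0 /=; near: h; exact: nbhs_right_lt.
Unshelve. all: by end_near. Qed.

(** The scalar form of the descent lemma: it is applied to the restrictions
    of functions to segments. *)
Lemma quadratic_upper_bound (phi dphi : R -> R) (L : R) :
  (forall t : R, is_derive t 1 phi (dphi t)) ->
  (forall t, 0 <= t <= 1 -> dphi t - dphi 0 <= L * t) ->
  phi 1 - phi 0 - dphi 0 <= L / 2.
Proof.
move=> dP dL.
pose psi (t : R) : R := phi t - dphi 0 * t - L / 2 * t ^+ 2.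
have dpsi (t : R) : is_derive t 1 psi (dphi t - dphi 0 - L * t).
  by apply: is_derive_eq; rewrite /GRing.scale /=; field.
have [|c] := MVT_segment ler01 (fun t _ => dpsi t).
  apply: continuous_subspaceT => t.
  by apply/differentiable_continuous/derivable1_diffP; case: (dpsi t).
rewrite in_itv /= => /dL cL; rewrite /psi subr0 mulr1; lra.
Qed.

End Segments.

Section Gradient.
Context {R : realType} {n : nat}.
Implicit Types (f : 'rV[R]_n -> R) (x y v : 'rV[R]_n).

Lemma dotp_grad f x v : dotp (grad f x) v = 'd f x v.
Proof.
rewrite [in RHS](row_sum_delta v) linear_sum.
by apply: eq_bigr => i _; rewrite mxE linearZ mulrC.
Qed.

Lemma convex_functionW f x y (t : R) : convex_function setT f ->
  0 <= t <= 1 -> f (t *: x + (1 - t) *: y) <= t * f x + (1 - t) * f y.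
Proof.
move=> cf /andP[t0 t1]; have := cf (Itv01 t0 t1) x y.
by rewrite !inE => /(_ I I); rewrite convRE.
Qed.

Lemma convex_grad_le f x y : convex_function setT f -> differentiable f x ->
  f x + dotp (grad f x) (y - x) <= f y.
Proof.
move=> cf df; rewrite -lerBrDl dotp_grad.
have := @is_derive_line _ _ _ f x (y - x) 0; rewrite scale0r addr0 => /(_ df).
move/is_derive_le_slope; apply => t /andP[t0 t1]; rewrite scale0r addr0.
have -> : x + t *: (y - x) = t *: y + (1 - t) *: x.
  by rewrite scalerBr scalerBl scale1r addrCA addrA.
have t01 : 0 <= t <= 1 by rewrite !ltW.
have := convex_functionW y x cf t01; lra.
Qed.

Section Smooth.
Variables (f : 'rV[R]_n -> R) (L : R).
Hypothesis df : forall x, differentiable f x.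
Hypothesis L0 : 0 < L.
Let Li0 : 0 <= L^-1. Proof. by rewrite invr_ge0 ltW. Qed.

Hypothesis lipf : forall x y, enorm (grad f y - grad f x) <= L * enorm (y - x).

Lemma descent x y :
  f y <= f x + dotp (grad f x) (y - x) + L / 2 * enorm (y - x) ^+ 2.
Proof.
set v := y - x; pose z (t : R) := x + t *: v.
have z0 : z 0 = x by rewrite /z scale0r addr0.
have z1 : z 1 = y by rewrite /z scale1r addrC subrK.
have dz (t : R) : is_derive t 1 (fun t => f (z t)) (dotp (grad f (z t)) v).
  by rewrite dotp_grad; exact: is_derive_line.
have := @quadratic_upper_bound R _ _ (L * enorm v ^+ 2) dz.
rewrite z0 z1 => H; suff : forall t : R, 0 <= t <= 1 ->
    dotp (grad f (z t)) v - dotp (grad f x) v <= L * enorm v ^+ 2 * t.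
  by move=> /H; lra.
move=> t /andP[t0 t1]; rewrite -dotpNl -dotpDl.
apply: (le_trans (dotp_le _ _)).
have := lipf x (z t); rewrite {2}/z [x + _]addrC addrK enormZ ger0_norm // => B.
apply: (le_trans (ler_wpM2r (enorm_ge0 v) B)).
by rewrite le_eqVlt; apply/orP; left; apply/eqP; ring.
Qed.

(** Compare [f y] with the lower bound of [f] at the gradient step of
    length [1 / L] from [y]. *)
Lemma grad_sqr_le m y : (forall x, m <= f x) ->
  enorm (grad f y) ^+ 2 <= 2 * L * (f y - m).
Proof.
move=> mf; have := descent y (y - L^-1 *: grad f y).
have := mf (y - L^-1 *: grad f y).
rewrite [_ - _ - y]addrAC subrr add0r enormN enormZ !dotpE -enorm_sqr.
rewrite ger0_norm // => A B.
have {}A := le_trans A B; rewrite -subr_ge0.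
rewrite -subr_ge0 in A; have /(mulr_ge0 (ltW L0)) := A.
rewrite -(@pmulr_lge0 _ 2) //; congr (0 <= _); field.
by rewrite gt_eqF.
Qed.

(** Cocoercivity: [f - <grad f x, .>] has its minimum at [x], so the previous
    argument applies to it. *)
Lemma grad_diff_sqr_le x y : convex_function setT f ->
  enorm (grad f y - grad f x) ^+ 2
    <= 2 * L * (f y - f x - dotp (grad f x) (y - x)).
Proof.
move=> cf; have [w Ew] : exists w, w = grad f y - grad f x by eexists.
rewrite -Ew.
have [z Ez] : exists z, z = y - L^-1 *: w by eexists.
have A := convex_grad_le z cf (df x).
have -> : dotp (grad f x) (y - x) = dotp (grad f x) (z - x) + L^-1 * dotp (grad f x) w.
  by rewrite -dotpZr -dotpDr Ez addrAC subrK.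
have B := descent y z.
have zy : z - y = - (L^-1 *: w) by rewrite Ez addrAC subrr add0r.
have wE : dotp (grad f y) w = enorm w ^+ 2 + dotp (grad f x) w.
  by rewrite enorm_sqr -dotpDl; congr dotp; rewrite Ew subrK.
rewrite zy enormN enormZ ger0_norm // dotpNr dotpZr wE in B.
have {A}B := le_trans A B; rewrite -subr_ge0 in B.
have L2 : 0 <= 2 * L by rewrite mulr_ge0 // ltW.
have {}B := mulr_ge0 L2 B; rewrite -subr_ge0.
apply: le_trans B _; rewrite le_eqVlt; apply/orP; left; apply/eqP; field.
by rewrite gt_eqF.
Qed.

End Smooth.

End Gradient.

Section JacobianLipschitz.
Context {R : realType} {d n : nat}.

Lemma dotp_is_linear (w : 'rV[R]_n) : linear (dotp w).
Proof. by move=> a u v; rewrite dotpDr dotpZr. Qed.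

HB.instance Definition _ (w : 'rV[R]_n) :=
  GRing.isLinear.Build R 'rV[R]_n R _ (dotp w) (dotp_is_linear w).

Lemma differentiable_dotp (w x : 'rV[R]_n) : differentiable (dotp w) x.
Proof.
have -> : dotp w = \sum_(i < n) (w 0 i *: (fun u : 'rV[R]_n => u 0 i : R)).
  by apply/funext => u; rewrite fct_sumE.
by apply: differentiable_sum => i; apply: differentiableZ; exact: differentiable_coord.
Qed.

Lemma mulmx_jacobian (c : 'rV[R]_d -> 'rV[R]_n) (x v : 'rV[R]_d) :
  v *m 'J c x = 'd c x v.
Proof. exact: mul_rV_lin1. Qed.

(** The remainder is tested against itself, which reduces the vector-valued
    Taylor formula to the scalar one. *)
Lemma jacobian_taylor (c : 'rV[R]_d -> 'rV[R]_n) (L : R) (x y : 'rV[R]_d) :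
  (forall z, differentiable c z) ->
  (forall t : R, 0 <= t <= 1 ->
     opnorm ('J c (x + t *: (y - x)) - 'J c x) <= L * (t * enorm (y - x))) ->
  enorm (c y - (c x + (y - x) *m 'J c x)) <= L / 2 * enorm (y - x) ^+ 2.
Proof.
move=> dc lipc; set w := c y - _; set v := y - x.
pose z (t : R) := x + t *: v.
have z0 : z 0 = x by rewrite /z scale0r addr0.
have z1 : z 1 = y by rewrite /z scale1r addrC subrK.
have dw u : differentiable (dotp w \o c) u.
  by apply: differentiable_comp => //; exact: differentiable_dotp.
have dz (t : R) : is_derive t 1 (fun t => dotp w (c (z t)))
    (dotp w (v *m 'J c (z t))).
  have := is_derive_line (v := v) (dw (z t)); rewrite diff_comp //=; last first.
    exact: differentiable_dotp.
  rewrite diff_lin ?mulmx_jacobian // => u.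
  exact/differentiable_continuous/differentiable_dotp.
have := @quadratic_upper_bound R _ _ (enorm w * (L * enorm v ^+ 2)) dz.
rewrite z0 z1 => H; have {H} : enorm w ^+ 2 <= enorm w * (L * enorm v ^+ 2) / 2.
  rewrite enorm_sqr {2}/w !(dotpDr, dotpNr) opprD addrA; apply: H => t t01.
  rewrite -dotpNr -dotpDr -mulmxBr; apply: (le_trans (dotp_le _ _)).
  rewrite -mulrA ler_wpM2l ?enorm_ge0 //.
  apply: (le_trans (enorm_mulmx_le _ _)); rewrite expr2 mulrA mulrAC.
  by rewrite ler_wpM2r ?enorm_ge0 // mulrAC -mulrA lipc.
have [->|wn] := eqVneq (enorm w) 0.
  have := lipc 1; rewrite ler01 lexx mul1r => /(_ isT)/(le_trans (opnorm_ge0 _)).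
  move/(mulr_ge0 (enorm_ge0 v)); rewrite -/v => ? _; lra.
have w0 : 0 < enorm w by rewrite lt_def wn enorm_ge0.
by rewrite expr2 -mulrA ler_pM2l // mulrAC.
Qed.

End JacobianLipschitz.


(** * Closed convex functions and the proximal operator *)

Section SquaredDistance.
Context {R : realType} {n : nat}.

(** The derivative of [a |. - x|^2] is given by its expansion at [z]: the
    remainder is [a |v|^2]. *)
Lemma sqdist_differentiable (a : R) (x z : 'rV[R]_n) :
  differentiable (fun z : 'rV[R]_n => a * enorm (z - x) ^+ 2) z /\
  grad (fun z : 'rV[R]_n => a * enorm (z - x) ^+ 2) z = (2 * a) *: (z - x).
Proof.
set f := fun z : 'rV[R]_n => _.
have df : differentiable f z.
  have -> : f = a *: \sum_(j < n) ((fun u : 'rV[R]_n => u 0 j : R) + cst (- x 0 j)) ^+ 2.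
    apply/funext => u; rewrite /f enorm_sqr -[RHS]/(a * _); congr (a * _).
    rewrite fct_sumE; apply: eq_bigr => j _.
    by rewrite exprfctE !mxE expr2.
  apply: differentiableZ; apply: differentiable_sum => j.
  apply: differentiableX; apply: differentiableD => //.
  exact: differentiable_coord.
split=> //; apply/rowP => i; rewrite mxE mxE.
have := @is_derive_line _ _ _ f z (delta_mx 0 i) 0; rewrite scale0r addr0 => /(_ df).
set v := delta_mx 0 i => -[_ <-].
have -> : (fun s : R => f (z + s *: v)) =
    (fun s => a * enorm (z - x) ^+ 2 + s * (2 * a * dotp (z - x) v)
       + s ^+ 2 * (a * dotp v v)).
  apply/funext => s; rewrite /f !enorm_sqr addrAC.
  move: (z - x) => u; rewrite !dotpE (dotpC v u); ring.
have -> : (z - x) 0 i = dotp (z - x) v.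
  rewrite /dotp (bigD1 i) //= big1 => [|j ji].
    by rewrite addr0 [v _ _]mxE !eqxx mulr1.
  by rewrite [v _ _]mxE (negbTE ji) andbF mulr0.
move: (dotp (z - x) v) (dotp v v) (enorm _) => B C A.
set psi := fun s : R => _.
have [_ ->] : is_derive (0 : R) 1 psi (2 * a * B).
  by apply: is_derive_eq; rewrite /GRing.scale /=; ring.
by [].
Qed.

End SquaredDistance.

Section ClosedConvex.
Context {R : realType} {d : nat} (g : 'rV[R]_d -> \bar R).
Hypothesis pg : Defs.proper g.
Implicit Types (x y z p : 'rV[R]_d).

Lemma dom_EFin x : dom g x -> g x = (fine (g x))%:E.
Proof.
move=> gx; rewrite fineK // fin_numE (proj1 pg).
by move: gx; rewrite /dom /= ltey.
Qed.

Lemma subdiff_dom x p : subdiff g x p -> dom g x.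
Proof.
move=> px; have [y gy] := proj2 pg; have := px y; rewrite (dom_EFin gy) /dom /=.
by case: (g x) => [t||] // _; rewrite ltry.
Qed.

Lemma subdiff_le x y p : subdiff g x p -> dom g y ->
  fine (g x) + dotp p (y - x) <= fine (g y).
Proof.
move=> px gy; have := px y.
by rewrite (dom_EFin gy) (dom_EFin (subdiff_dom px)) -EFinD lee_fin.
Qed.

Lemma econvex_fine x y (t : R) : econvex g -> dom g x -> dom g y -> 0 < t < 1 ->
  dom g (x + t *: (y - x)) /\
  fine (g (x + t *: (y - x))) <= fine (g x) + t * (fine (g y) - fine (g x)).
Proof.
move=> cg gx gy t01; have := cg y x t t01.
have -> : t *: y + (1 - t) *: x = x + t *: (y - x).
  by rewrite scalerBr scalerBl scale1r addrCA addrA.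
rewrite {1}(dom_EFin gx) {1}(dom_EFin gy) -!EFinM -EFinD => le.
have gz : dom g (x + t *: (y - x)) by exact: le_lt_trans le (ltry _).
by split=> //; move: le; rewrite (dom_EFin gz) lee_fin /=; lra.
Qed.

Lemma dom_segment x y (t : R) : econvex g -> dom g x -> dom g y ->
  0 <= t <= 1 -> dom g (x + t *: (y - x)).
Proof.
move=> cg gx gy /andP[t0 t1].
have [->|tn0] := eqVneq t 0; first by rewrite scale0r addr0.
have [->|tn1] := eqVneq t 1; first by rewrite scale1r addrC subrK.
by apply: (econvex_fine cg gx gy _).1; rewrite !lt_def tn0 t0 eq_sym tn1.
Qed.

(** First-order optimality.  The convexity of [g] bounds its increments along
    a segment by a linear function of the parameter; those of [phi] are
    compared with its derivative. *)
Lemma argmin_subdiff (phi : 'rV[R]_d -> R) z :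
  econvex g -> dom g z -> differentiable phi z ->
  (forall w, dom g w -> fine (g z) + phi z <= fine (g w) + phi w) ->
  subdiff g z (- grad phi z).
Proof.
move=> cg gz dphi zmin y.
have [gy|] := boolP (g y < +oo)%E; last by rewrite ltey negbK => /eqP->; rewrite leey.
rewrite (dom_EFin gy) (dom_EFin gz) -EFinD lee_fin -lerBrDl.
rewrite dotpNl lerNl dotp_grad opprB.
have := @is_derive_line _ _ _ phi z (y - z) 0; rewrite scale0r addr0 => /(_ dphi).
move=> dline; rewrite -lerN2.
have {dline} := is_deriveN dline; move/is_derive_le_slope; apply => t t01.
have [gw gwle] := econvex_fine cg gz gy t01.
rewrite -[X in X - _]/(- phi (z + t *: (y - z))).
rewrite -[X in _ - X]/(- phi (z + 0 *: (y - z))) scale0r addr0.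
by have := zmin _ gw; lra.
Qed.

Hypothesis cl : lower_semicontinuous g.

(** Weierstrass' theorem.  The sublevel sets of [g + phi] generate a filter on
    a bounded set; lower semicontinuity shows that a cluster point of it is a
    minimizer. *)
Lemma argmin_exists (phi : 'rV[R]_d -> R) x (m a s : R) :
  continuous phi -> (forall w, m%:E <= g w)%E -> 0 < s ->
  (forall w, a + s * enorm (w - x) ^+ 2 <= phi w) ->
  exists2 z, dom g z &
    forall w, dom g w -> fine (g z) + phi z <= fine (g w) + phi w.
Proof.
move=> cphi mg s0 aphi; have [v gv] := proj2 pg.
pose f w := (g w + (phi w)%:E)%E.
have fE w : dom g w -> f w = (fine (g w) + phi w)%:E.
  by move=> gw; rewrite /f {1}(dom_EFin gw).
have mfine w : dom g w -> m <= fine (g w).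
  by move=> gw; have := mg w; rewrite (dom_EFin gw) lee_fin.
pose V := [set fine (g w) + phi w | w in dom g].
have infV : has_inf V.
  split; first by exists (fine (g v) + phi v); exists v.
  exists (m + a) => _ [w gw <-]; apply: lerD; first exact: mfine.
  apply: le_trans (aphi w); rewrite lerDl.
  by apply: mulr_ge0; [exact: ltW | exact: sqr_ge0].
pose mu := inf V.
pose B (e : R) := [set w | dom g w /\ fine (g w) + phi w <= mu + e].
pose F := filter_from [set e : R | 0 < e] B.
have Bmono e1 e2 : e1 <= e2 -> B e1 `<=` B e2.
  by move=> e12 w [gw le]; split=> //; apply: (le_trans le); rewrite lerD2l.
have FF : ProperFilter F.
  apply: filter_from_proper.
    apply: filter_from_filter; first by exists 1 => /=.
    move=> i j /= i0 j0; exists (Num.min i j); first by rewrite /= lt_min i0.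
    by move=> w Bw; split; apply: Bmono Bw; rewrite ge_min lexx ?orbT.
  move=> e /= e0; have [_ [w gw <-] lt] := inf_adherent e0 infV.
  by exists w; split=> //; exact: ltW.
pose r : R := `|x| + (1 + (mu + 1 - m - a) / s).
pose A := [set w : 'rV[R]_d | `|w| <= r].
have FA : F A.
  exists 1 => //= w [gw le]; rewrite /A /= -(subrK x w) addrC.
  apply: (le_trans (ler_normD _ _)); rewrite lerD2l.
  apply: (le_trans (normr_le_enorm _)); set t := enorm _.
  have tt : t <= 1 + t ^+ 2 by have := sqr_ge0 (t - 1/2); lra.
  apply: (le_trans tt); rewrite lerD2l ler_pdivlMr // mulrC.
  have := aphi w; rewrite -/t; have := mfine _ gw; lra.
have cA : compact A.
  apply: bounded_closed_compact.
    by exists r; split; rewrite ?num_real // => M rM w /= /le_trans; apply; exact: ltW.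
  have -> : A = (fun w : 'rV[R]_d => `|w|) @^-1` [set t | t <= r] by [].
  by apply: closed_comp; [move=> w _; exact: norm_continuous | exact: closed_le].
have [z [_ zF]] := cA F FF FA.
have zle : forall e : R, 0 < e -> (f z <= (mu + e)%:E)%E.
  move=> e e0; rewrite leNgt; apply/negP => lt.
  have : ((mu + e - phi z)%:E < g z)%E by rewrite EFinB lteBlDr.
  move=> lt'.
  have [b b1 b2] : exists2 b : R, mu + e - phi z < b & (b%:E < g z)%E.
    move: lt'; case: (g z) => [t||] //; last first.
      by move=> _; exists (mu + e - phi z + 1); rewrite ?ltry // ltrDl.
    by rewrite lte_fin => /midf_lt[lb ub]; exists ((mu + e - phi z + t) / 2).
  have [N Nz Ng] := cl b2.
  have Nphi : nbhs z [set w | mu + e - b < phi w].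
    apply: (cphi z [set t : R | mu + e - b < t]).
    by apply: open_nbhs_nbhs; split; [exact: open_gt | rewrite /=; lra].
  have [w [[gw wle] [Nw /= pw]]] := zF _ _ (ex_intro2 _ _ e e0 (fun _ => id)) (filterI Nz Nphi).
  have := Ng _ Nw; rewrite (dom_EFin gw) lte_fin; lra.
have gz : dom g z.
  have := zle _ ltr01; rewrite /f /dom /=.
  by case: (g z) => [t||] // _; rewrite ltry.
exists z => // w gw; rewrite -lee_fin -!fE //.
apply/lee_addgt0Pr => e e0; apply: (le_trans (zle _ e0)).
rewrite fE // -EFinD lee_fin lerD2r; apply: inf_lbound; [exact: infV.2 | by exists w].
Qed.

(** First-order optimality for the proximal problem, whose minimizer exists by
    [argmin_exists]. *)
Lemma prox_subdiff (m s : R) x : econvex g -> (forall w, m%:E <= g w)%E -> 0 < s ->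
  subdiff g (prox s g x) (s^-1 *: (x - prox s g x)).
Proof.
move=> cg mg s0; pose phi (z : 'rV[R]_d) := enorm (z - x) ^+ 2 / (2 * s).
have s20 : 0 < (2 * s)^-1 by rewrite invr_gt0 mulr_gt0.

have phiE w : phi w = (2 * s)^-1 * enorm (w - x) ^+ 2 by rewrite mulrC.
have cphi : continuous phi.
  move=> z; rewrite (funext phiE); apply: differentiable_continuous.
  exact: (sqdist_differentiable _ _ _).1.
have [|z gz zmin] := @argmin_exists phi x m 0 (2 * s)^-1 cphi mg s20.
  by move=> w; rewrite add0r phiE.
set z' := prox s g x.
have z'min : forall w, (g z' + (phi z')%:E <= g w + (phi w)%:E)%E.
  apply: (@xgetPex _ x [set z | forall w, (g z + (phi z)%:E <= g w + (phi w)%:E)%E]).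
  exists z => w; have [gw|] := boolP (g w < +oo)%E; last first.
    by rewrite ltey negbK => /eqP->; rewrite addye // leey.
  by rewrite (dom_EFin gw) (dom_EFin gz) -!EFinD lee_fin; exact: zmin.
have gz' : dom g z'.
  have := z'min z; rewrite (dom_EFin gz) /dom /=.
  by case: (g z') => [t||] // _; rewrite ltry.
have [dphi gphi] := sqdist_differentiable (2 * s)^-1 x z'.
have := argmin_subdiff cg gz' dphi; rewrite gphi.
have -> : - (2 * (2 * s)^-1 *: (z' - x)) = s^-1 *: (x - z').
  by rewrite -scalerN opprB; congr (_ *: _); field; rewrite gt_eqF.
apply=> w gw; have := z'min w.
by rewrite (dom_EFin gw) (dom_EFin gz') -!EFinD lee_fin !phiE.
Qed.

End ClosedConvex.


(** * The objective and its convex models *)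

Section Residual.
Context {R : realType} {d : nat} (g : 'rV[R]_d -> \bar R).
Implicit Types (x p v w : 'rV[R]_d) (e : R).

Lemma residual_le x p v e : subdiff g x p -> enorm (p + v) <= e ->
  (residual g x v <= e%:E)%E.
Proof.
move=> px le; apply: ge_ereal_inf; exists (enorm (p + v))%:E; last by rewrite lee_fin.
by exists p.
Qed.

Lemma residual_approx x v e r : (residual g x v <= e%:E)%E -> 0 < r ->
  exists2 p, subdiff g x p & enorm (p + v) < e + r.
Proof.
move=> le r0; have : (residual g x v < (e + r)%:E)%E.
  by apply: (le_lt_trans le); rewrite lte_fin ltrDl.
by move=> /ereal_inf_lt[_ [p px <-]]; rewrite lte_fin; exists p.
Qed.

Lemma residual_perturb x v w e : (residual g x v <= e%:E)%E ->
  (residual g x w <= (e + enorm (w - v))%:E)%E.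
Proof.
move=> le; apply/lee_addgt0Pr => r r0; rewrite -EFinD.
have [p px ple] := residual_approx le r0.
apply: (residual_le px).
have -> : p + w = (p + v) + (w - v) by rewrite addrA addrAC addrK.
by apply: (le_trans (ler_enormD _ _)); rewrite addrAC lerD2r ltW.
Qed.

End Residual.

Section Model.
Context {R : realType} {d n : nat} (P : problem R d n).
Hypothesis AP : assumptions P.
Implicit Types (x y xk : 'rV[R]_d) (mu sigma theta : R).

Local Notation g := (pg P).
Local Notation gr x := (fine (pg P x)).
Local Notation J x := ('J (pc P) x).

Definition linearization xk x : 'rV[R]_n := pc P xk + (x - xk) *m J xk.
Local Notation lin := linearization.

Lemma gstar_fine_le x : ((gstar P)%:E <= g x)%E.
Proof.
by apply: le_trans (gstar_le AP) _; apply: ereal_inf_lbound; exists x.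
Qed.

Lemma gstar_le_fine x : dom g x -> gstar P <= gr x.
Proof.
by move=> gx; have := gstar_fine_le x; rewrite (dom_EFin (g_proper AP) gx) lee_fin.
Qed.

Lemma hstar_le_h (y : 'rV[R]_n) : hstar P <= ph P y.
Proof.
rewrite -lee_fin; apply: le_trans (hstar_le AP) _.
by apply: ereal_inf_lbound; exists y.
Qed.

Lemma F_EFin x : dom g x -> F P x = (gr x + H P x)%:E.
Proof. by move=> gx; rewrite /F {1}(dom_EFin (g_proper AP) gx). Qed.

Lemma DeltaE x : dom g x -> Delta P x = gr x + H P x - (gstar P + hstar P).
Proof. by move=> gx; rewrite /Delta F_EFin. Qed.

Lemma Delta_ge0 x : dom g x -> 0 <= Delta P x.
Proof.
move=> gx; rewrite DeltaE //.
have := gstar_le_fine gx; have := hstar_le_h (pc P x); rewrite /H; lra.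
Qed.

Lemma h_le_Delta x : dom g x -> ph P (pc P x) - hstar P <= Delta P x.
Proof. by move=> gx; rewrite DeltaE // /H; have := gstar_le_fine gx; lra. Qed.

Lemma g_le_Delta x : dom g x -> gr x - gstar P <= Delta P x.
Proof.
by move=> gx; rewrite DeltaE // /H; have := hstar_le_h (pc P x); lra.
Qed.

Lemma h_grad_sqr_le (y : 'rV[R]_n) : enorm (grad (ph P) y) ^+ 2 <= 2 * Lh P * (ph P y - hstar P).
Proof.
exact: (grad_sqr_le (h_differentiable AP) (Lh_gt0 AP) (h_smooth AP) y hstar_le_h).
Qed.

Lemma enorm_gradh_le (y : 'rV[R]_n) D : ph P y - hstar P <= D ->
  enorm (grad (ph P) y) <= Num.sqrt (2 * Lh P * D).
Proof.
move=> hD; rewrite -[leLHS]ger0_norm ?enorm_ge0 // -sqrtr_sqr ler_sqrt; last first.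
  rewrite !mulr_ge0 // ?(ltW (Lh_gt0 AP)) //; have := hstar_le_h y; lra.
apply: (le_trans (h_grad_sqr_le y)); rewrite ler_wpM2l // mulr_ge0 //.
exact: ltW (Lh_gt0 AP).
Qed.

Lemma linearization_error xk x : dom g xk -> dom g x ->
  enorm (pc P x - lin xk x) <= Lc P / 2 * enorm (x - xk) ^+ 2.
Proof.
move=> gk gx; apply: jacobian_taylor; first exact: (c_differentiable AP).
move=> t t01; apply: (le_trans (c_smooth AP gk _)).
  exact: (dom_segment (g_proper AP) (g_convex AP) gk gx t01).
by rewrite [_ + _ - _]addrAC subrr add0r enormZ ger0_norm //; case/andP: t01.
Qed.

Lemma H_differentiable x : differentiable (H P) x.
Proof.
exact: (@differentiable_comp _ _ _ _ (pc P) (ph P) x (c_differentiable AP x)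
  (h_differentiable AP _)).
Qed.

Lemma rowP_dotp (p : nat) (u v : 'rV[R]_p) : (forall w, dotp u w = dotp v w) -> u = v.
Proof.
move=> uv; apply/eqP; rewrite -subr_eq0; apply/eqP/dotp_eq0.
by rewrite dotpDl dotpNl uv subrr.
Qed.

Lemma grad_H x : grad (H P) x = grad (ph P) (pc P x) *m (J x)^T.
Proof.
apply: rowP_dotp => w; rewrite dotp_grad.
rewrite (@diff_comp _ _ _ _ (pc P) (ph P) x (c_differentiable AP x)
  (h_differentiable AP _)).
by rewrite /= -dotp_grad -mulmx_jacobian [RHS]dotpC -dotp_mulmx dotpC.
Qed.

Lemma grad_Hbar xk mu x :
  grad (Hbar P xk mu) x = grad (ph P) (lin xk x) *m (J xk)^T + mu *: (x - xk).
Proof. by rewrite -(eval_grad_HbarE _ _ _ (h_differentiable AP)). Qed.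

Lemma Hbar_differentiable xk mu x : differentiable (Hbar P xk mu) x.
Proof.
have -> : Hbar P xk mu =
    (ph P \o lin xk) + (fun z => mu / 2 * enorm (z - xk) ^+ 2) by [].
apply: differentiableD; last exact: (sqdist_differentiable _ _ _).1.
apply: differentiable_comp; last exact: (h_differentiable AP).
have -> : lin xk = cst (pc P xk - xk *m J xk) + (fun u => u *m J xk).
  apply/funext => u; rewrite /linearization mulmxBl.
  by rewrite -[RHS]/(_ + _) -addrA [- _ + _]addrC.
by apply: differentiableD => //; exact: differentiable_mulmxr.
Qed.

Lemma Hbar_center xk mu : Hbar P xk mu xk = H P xk.
Proof.
by rewrite /Hbar subrr mul0mx addr0 enorm0 expr0n /= mulr0 addr0.
Qed.

Lemma linearization_center xk : lin xk xk = pc P xk.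
Proof. by rewrite /linearization subrr mul0mx addr0. Qed.

Lemma grad_Hbar_center xk mu : grad (Hbar P xk mu) xk = grad (H P) xk.
Proof. by rewrite grad_Hbar grad_H linearization_center subrr scaler0 addr0. Qed.

Lemma linearizationB xk x y : lin xk y - lin xk x = (y - x) *m J xk.
Proof.
rewrite /linearization opprD addrACA subrr add0r -mulmxBl; congr (_ *m _).
by rewrite opprB addrA subrK.
Qed.

Lemma Hbar_excess xk mu x y :
  Hbar P xk mu y - Hbar P xk mu x - dotp (grad (Hbar P xk mu) x) (y - x) =
  ph P (lin xk y) - ph P (lin xk x)
    - dotp (grad (ph P) (lin xk x)) (lin xk y - lin xk x)
  + mu / 2 * enorm (y - x) ^+ 2.
Proof.
rewrite linearizationB /Hbar -!/(lin _ _) grad_Hbar.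
have -> : y - xk = (y - x) + (x - xk) by rewrite addrA subrK.
move: (y - x) (x - xk) => u v.
rewrite dotpDl dotpZl (dotpC (_ *m _)) -dotp_mulmx (dotpC (u *m _)).
by rewrite !enorm_sqr !dotpDl !dotpDr (dotpC v u); field.
Qed.

Lemma Hbar_strong_convex xk mu x y :
  mu / 2 * enorm (y - x) ^+ 2 <=
  Hbar P xk mu y - Hbar P xk mu x - dotp (grad (Hbar P xk mu) x) (y - x).
Proof.
rewrite Hbar_excess.
have := convex_grad_le (lin xk y) (h_convex AP) (h_differentiable AP (lin xk x)).
lra.
Qed.

Lemma Hbar_smooth xk mu sigma x y : opnorm (J xk) <= sigma ->
  Hbar P xk mu y - Hbar P xk mu x - dotp (grad (Hbar P xk mu) x) (y - x) <=
  (Lh P * sigma ^+ 2 + mu) / 2 * enorm (y - x) ^+ 2.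
Proof.
move=> Js; rewrite Hbar_excess.
have := descent (h_differentiable AP) (h_smooth AP) (lin xk x) (lin xk y).
have : enorm (lin xk y - lin xk x) ^+ 2 <= sigma ^+ 2 * enorm (y - x) ^+ 2.
  rewrite linearizationB -exprMn.
  have s0 : 0 <= sigma by apply: le_trans Js; exact: opnorm_ge0.
  rewrite ler_pXn2r ?nnegrE ?mulr_ge0 ?enorm_ge0 //.
  by apply: (le_trans (enorm_mulmx_le _ _)); rewrite ler_wpM2r ?enorm_ge0.
move=> /(ler_wpM2l (ltW (Lh_gt0 AP))); lra.
Qed.

Lemma grad_Hbar_lipschitz xk mu sigma x y : opnorm (J xk) <= sigma -> 0 <= mu ->
  enorm (grad (Hbar P xk mu) y - grad (Hbar P xk mu) x)
    <= (Lh P * sigma ^+ 2 + mu) * enorm (y - x).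
Proof.
move=> Js mu0; rewrite !grad_Hbar.
have s0 : 0 <= sigma by apply: le_trans Js; exact: opnorm_ge0.
have -> : forall a b : 'rV[R]_d, a + mu *: (y - xk) - (b + mu *: (x - xk)) =
    (a - b) + mu *: (y - x).
  move=> a b; rewrite opprD addrACA -scalerBr; congr (_ + _ *: _).
  by rewrite opprB addrA subrK.
apply: (le_trans (ler_enormD _ _)); rewrite mulrDl enormZ ger0_norm // lerD2r.
rewrite -mulmxBl; apply: (le_trans (enorm_mulmx_tr_le _ _)).
apply: (le_trans (ler_wpM2r (enorm_ge0 _) Js)).
have := h_smooth AP (lin xk x) (lin xk y); rewrite linearizationB => B.
apply: (le_trans (ler_wpM2l s0 B)).
have C := le_trans (enorm_mulmx_le (J xk) (y - x)) (ler_wpM2r (enorm_ge0 _) Js).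
apply: (le_trans (ler_wpM2l s0 (ler_wpM2l (ltW (Lh_gt0 AP)) C))).
by rewrite le_eqVlt; apply/orP; left; apply/eqP; ring.
Qed.

Lemma mulmx_trB (a b : 'rV[R]_n) (A B : 'M[R]_(d, n)) :
  a *m A^T - b *m B^T = a *m (A - B)^T + (a - b) *m B^T.
Proof.
rewrite (_ : (A - B)^T = A^T - B^T); last by rewrite linearB.
by rewrite mulmxBr mulmxBl addrA subrK.
Qed.

(** The linear term comes from the change of the Jacobian between [xk] and [x],
    the quadratic one from the error of linearizing [c] inside [grad h]. *)
Lemma grad_H_Hbar xk mu sigma x : dom g xk -> dom g x -> 0 <= mu ->
  opnorm (J xk) <= sigma ->
  enorm (grad (H P) x - grad (Hbar P xk mu) x) <=
    (mu + Lc P * Num.sqrt (2 * Lh P * Delta P x)) * enorm (x - xk)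
    + sigma * Lh P * Lc P / 2 * enorm (x - xk) ^+ 2.
Proof.
move=> gk gx mu0 Js; rewrite grad_H grad_Hbar.
have s0 : 0 <= sigma by apply: le_trans Js; exact: opnorm_ge0.
set a := grad _ (pc P x); set b := grad _ (lin xk x); set r := enorm (x - xk).
have -> : a *m (J x)^T - (b *m (J xk)^T + mu *: (x - xk)) =
   a *m (J x - J xk)^T + (a - b) *m (J xk)^T - mu *: (x - xk).
  by rewrite -mulmx_trB opprD addrA.
apply: (le_trans (ler_enormB _ _)); rewrite enormZ ger0_norm // mulrDl -/r.
have C1 : enorm (a *m (J x - J xk)^T) <= Lc P * Num.sqrt (2 * Lh P * Delta P x) * r.
  apply: (le_trans (enorm_mulmx_tr_le _ _)).
  rewrite [leRHS]mulrAC; apply: ler_pM; rewrite ?opnorm_ge0 ?enorm_ge0 //.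
    exact: (c_smooth AP gk gx).
  exact/enorm_gradh_le/h_le_Delta.
have C2 : enorm ((a - b) *m (J xk)^T) <= sigma * Lh P * Lc P / 2 * r ^+ 2.
  apply: (le_trans (enorm_mulmx_tr_le _ _)).
  apply: (le_trans (ler_wpM2r (enorm_ge0 _) Js)).
  have B := h_smooth AP (lin xk x) (pc P x).
  have B' := le_trans B (ler_wpM2l (ltW (Lh_gt0 AP)) (linearization_error gk gx)).
  apply: (le_trans (ler_wpM2l s0 B')).
  by rewrite le_eqVlt -/r; apply/orP; left; apply/eqP; ring.
have := ler_enormD (a *m (J x - J xk)^T) ((a - b) *m (J xk)^T); lra.
Qed.

(** The gradient of the objective is Lipschitz near [xk]; the gradient of [h] at
    [c x] is compared with that at [c xk], so that only [Delta xk] enters. *)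
Lemma grad_H_near xk sigma x : dom g xk -> dom g x -> opnorm (J xk) <= sigma ->
  enorm (x - xk) <= 1 ->
  enorm (grad (H P) x - grad (H P) xk) <=
    (Lc P * (Num.sqrt (2 * Lh P * Delta P xk) + Lh P * (sigma + Lc P / 2))
     + sigma * Lh P * (sigma + Lc P / 2)) * enorm (x - xk).
Proof.
move=> gk gx Js r1; rewrite !grad_H.
have s0 : 0 <= sigma by apply: le_trans Js; exact: opnorm_ge0.
have Lc0 := Lc_gt0 AP; have Lh0 := Lh_gt0 AP.
set a := grad _ (pc P x); set e := grad _ (pc P xk).
have r0 := enorm_ge0 (x - xk); set r : R := enorm (x - xk) in r0 r1 *.
have cc : enorm (pc P x - pc P xk) <= (sigma + Lc P / 2) * r.
  apply: (le_trans (ler_distD_enorm (lin xk x) _ _)).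
  have A := linearization_error gk gx; rewrite -/r in A.
  have B : enorm (lin xk x - pc P xk) <= sigma * r.
    rewrite -[pc P xk](linearization_center xk) linearizationB.
    by apply: (le_trans (enorm_mulmx_le _ _)); rewrite ler_wpM2r.
  have C : Lc P / 2 * r ^+ 2 <= Lc P / 2 * r.
    by rewrite ler_wpM2l ?divr_ge0 ?(ltW Lc0) // expr2 ler_piMl.
  by rewrite mulrDl addrC; apply: lerD B (le_trans A C).
have ae : enorm (a - e) <= Lh P * ((sigma + Lc P / 2) * r).
  by apply: (le_trans (h_smooth AP _ _)); rewrite ler_wpM2l // ltW.
have e_le : enorm e <= Num.sqrt (2 * Lh P * Delta P xk).
  exact/enorm_gradh_le/h_le_Delta.
have w0 : 0 <= (sigma + Lc P / 2) * r.
  by rewrite mulr_ge0 // addr_ge0 // divr_ge0 // ltW.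
have a_le : enorm a <= Num.sqrt (2 * Lh P * Delta P xk) + Lh P * (sigma + Lc P / 2).
  rewrite -(subrK e a) addrC; apply: (le_trans (ler_enormD _ _)); apply: lerD => //.
  apply: (le_trans ae); rewrite ler_wpM2l ?(ltW Lh0) // ler_piMr //.
  by rewrite addr_ge0 // divr_ge0 // ltW.
have -> : a *m (J x)^T - e *m (J xk)^T = a *m (J x - J xk)^T + (a - e) *m (J xk)^T.
  exact: mulmx_trB.
apply: (le_trans (ler_enormD _ _)); rewrite mulrDl; apply: lerD.
  apply: (le_trans (enorm_mulmx_tr_le _ _)).
  rewrite [leRHS]mulrAC; apply: ler_pM; rewrite ?opnorm_ge0 ?enorm_ge0 //.
  exact: (c_smooth AP gk gx).
apply: (le_trans (enorm_mulmx_tr_le _ _)).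
apply: (le_trans (ler_wpM2r (enorm_ge0 _) Js)).
by rewrite -!mulrA ler_wpM2l.
Qed.

Lemma omega_argmin x : dom g x ->
  (forall w, dom g w -> gr x + H P x <= gr w + H P w) -> (omega P x <= 0)%E.
Proof.
move=> gx xmin; apply: (@residual_le _ _ _ _ (- grad (H P) x)).
  exact: (argmin_subdiff (g_proper AP) (g_convex AP) gx (H_differentiable x) xmin).
by rewrite addNr enorm0.
Qed.

Lemma omega_Delta0 x : dom g x -> Delta P x = 0 -> (omega P x <= 0)%E.
Proof.
move=> gx Dx; apply: omega_argmin => // w gw.
by have := Delta_ge0 gw; move: Dx; rewrite !DeltaE //; lra.
Qed.

Lemma inf_F_ge : ((gstar P + hstar P)%:E <= ereal_inf (range (F P)))%E.
Proof.
apply: le_ereal_inf_tmp => _ [w _ <-]; rewrite /F EFinD leeD ?gstar_fine_le //.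
by rewrite lee_fin hstar_le_h.
Qed.

Lemma inf_F_fin x : dom g x -> ereal_inf (range (F P)) \is a fin_num.
Proof.
move=> gx; rewrite fin_numElt; apply/andP; split.
  exact: lt_le_trans (ltNyr _) inf_F_ge.
apply: (@le_lt_trans _ _ (F P x)); first by apply: ereal_inf_lbound; exists x.
by rewrite F_EFin // ltry.
Qed.

Lemma Fstar_lower x : dom g x -> Fstar P <= gr x + H P x.
Proof.
move=> gx; rewrite -lee_fin -F_EFin // /Fstar fineK; last exact: inf_F_fin gx.
by apply: ereal_inf_lbound; exists x.
Qed.

Lemma gapE x : dom g x -> gap P x = gr x + H P x - Fstar P.
Proof. by move=> gx; rewrite /gap F_EFin. Qed.

Lemma gap_le_Delta x : dom g x -> gap P x <= Delta P x.
Proof.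
move=> gx; rewrite gapE // DeltaE // lerD2l lerN2 -lee_fin /Fstar.
by rewrite (fineK (inf_F_fin gx)) inf_F_ge.
Qed.

Lemma gap_ge0 x : dom g x -> 0 <= gap P x.
Proof. by move=> gx; rewrite gapE // subr_ge0 Fstar_lower. Qed.

Lemma omega_gap0 x : dom g x -> gap P x = 0 -> (omega P x <= 0)%E.
Proof.
move=> gx; rewrite gapE // => gap0; apply: omega_argmin => // w gw.
by have := Fstar_lower gw; lra.
Qed.

End Model.


(** * One outer iteration *)

Section OuterStep.
Context {R : realType} {d n : nat} (P : problem R d n) (theta : R).
Hypothesis AP : assumptions P.
Hypothesis theta01 : 0 < theta < 1.
Implicit Types (x y xk : 'rV[R]_d) (mu sigma eps rho : R).

Local Notation g := (pg P).
Local Notation gr x := (fine (pg P x)).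
Local Notation J x := ('J (pc P) x).
Local Notation lin := (linearization P).

Lemma decreaseE xk mu x : dom g xk -> dom g x ->
  decrease P theta xk mu x =
  ((1 - theta) / 2 * mu * enorm (x - xk) ^+ 2 <= Delta P xk - Delta P x).
Proof.
move=> gk gx; rewrite /decrease !(F_EFin AP) // -EFinB lee_fin !(DeltaE AP) //.
by apply/idP/idP; lra.
Qed.

(** Strong convexity of the model turns near-stationarity into descent.  The
    minimum in [omegabar] is approached by subgradients up to an error that tends
    to zero. *)
Lemma Sset_model_decrease xk mu x : dom g xk -> 0 <= mu ->
  Sset P theta xk mu x ->
  gr x + ph P (lin xk x) <= gr xk + H P xk - (1 - theta) * mu * enorm (x - xk) ^+ 2.
Proof.
move=> gk mu0 [gx Sx]; set r := enorm (x - xk).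
have r0 : 0 <= r by exact: enorm_ge0.
apply/ler_addgt0Pr => e e0.
have e0' : 0 < e / (1 + r) by rewrite divr_gt0 // ltr_pwDl.
have [p px ple] := residual_approx Sx e0'.
have A := subdiff_le (g_proper AP) px gk.
have B := Hbar_strong_convex AP xk mu x xk.
have C := normr_dotp_le (p + grad (Hbar P xk mu) x) (xk - x).
rewrite dotpDl ler_norml in C; case/andP: C => C _.
rewrite Hbar_center -/(Hbar P xk mu x) in B.
rewrite -[enorm (xk - x)]enormB -/r in B C.
have HE : Hbar P xk mu x = ph P (lin xk x) + mu / 2 * r ^+ 2 by [].
have D : (theta * mu * r + e / (1 + r)) * r <= theta * mu * r ^+ 2 + e.
  rewrite mulrDl expr2 mulrA lerD2l mulrAC ler_pdivrMr ?ltr_pwDl //.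
  by rewrite ler_wpM2l // ?(ltW e0) // lerDr.
have := ler_wpM2r r0 (ltW ple); rewrite -/r in D *; lra.
Qed.

(** If [rho] exceeds the threshold, the model decrease
    [(1 - theta) mu r^2 >= 2 S sqrt Delta], with [S = sqrt (2 Lh) |c x - lin x|],
    dominates the error [S sqrt (h (lin x) - hstar) + S^2 / 4] committed by
    linearizing [c]. *)
Lemma large_rho_decrease xk rho x : dom g xk ->
  Lc P * Num.sqrt (2 * Lh P) / (1 - theta) <= rho -> 0 < Delta P xk ->
  Sset P theta xk (rho * Num.sqrt (Delta P xk)) x ->
  decrease P theta xk (rho * Num.sqrt (Delta P xk)) x.
Proof.
move=> gk rho_ge D0; have [t0 t1] := andP theta01.
rewrite ler_pdivrMr ?subr_gt0 // in rho_ge.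
set a := Num.sqrt (2 * Lh P) in rho_ge *; set u := Num.sqrt _.
have Lh0 := Lh_gt0 AP; have Lc0 := Lc_gt0 AP.
have u0 : 0 < u by rewrite sqrtr_gt0.
have a0 : 0 < a by rewrite sqrtr_gt0 mulr_gt0.
have rho0 : 0 <= rho by have := mulr_gt0 Lc0 a0; nra.
have mu0 : 0 <= rho * u by rewrite mulr_ge0 // ltW.
move=> Sx; have gx := Sx.1; have M := Sset_model_decrease gk mu0 Sx.
rewrite decreaseE //; set r := enorm (x - xk) in M *.
have := linearization_error AP gk gx; rewrite -/r; set dl := enorm _ => dlle.
have dl0 : 0 <= dl by exact: enorm_ge0.
set t := Num.sqrt (ph P (lin xk x) - hstar P).
have t_ge0 : 0 <= t by exact: sqrtr_ge0.
have tt : t ^+ 2 = ph P (lin xk x) - hstar P.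
  by rewrite sqr_sqrtr // subr_ge0 (hstar_le_h AP).
have uu : u ^+ 2 = Delta P xk by rewrite sqr_sqrtr // ltW.
have aa : a ^+ 2 = 2 * Lh P by rewrite sqr_sqrtr // mulr_ge0 // ltW.
set m := (1 - theta) * (rho * u) * r ^+ 2 in M.
pose S := a * dl.
have S0 : 0 <= S by rewrite mulr_ge0 // ltW.
have mS : 2 * (S * u) <= m.
  have -> : m = rho * (1 - theta) * (u * r ^+ 2) by rewrite /m; ring.
  have ur : 0 <= u * r ^+ 2 by rewrite mulr_ge0 ?sqr_ge0 // ltW.
  apply: le_trans (ler_wpM2r ur rho_ge).
  have au : 0 <= a * u by rewrite mulr_ge0 // ltW.
  have := ler_wpM2l au dlle; rewrite /S; lra.
have tm : t ^+ 2 <= u ^+ 2 - m.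
  rewrite tt uu (DeltaE AP) //; have := gstar_le_fine AP gx; lra.
have uS : 2 * S <= u.
  rewrite -(ler_pM2r u0); have := sqr_ge0 t; rewrite expr2 in tm; nra.
have tS : t <= u - S.
  rewrite -(@ler_pXn2r _ 2) ?nnegrE //; last lra.
  have := sqr_ge0 S; rewrite sqrrB; lra.
have Ht : enorm (grad (ph P) (lin xk x)) <= a * t.
  by rewrite -sqrtrM ?mulr_ge0 ?(ltW Lh0) //; exact: enorm_gradh_le.
have := descent (h_differentiable AP) (h_smooth AP) (lin xk x) (pc P x).
have Hd := le_trans (dotp_le (grad (ph P) (lin xk x)) (pc P x - lin xk x))
  (ler_wpM2r dl0 Ht).
rewrite -/dl in Hd *.
have -> : Lh P / 2 * dl ^+ 2 = S ^+ 2 / 4 by rewrite /S exprMn aa; field.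
have -> : (1 - theta) / 2 * (rho * u) * r ^+ 2 = m / 2 by rewrite /m; field.
have St : a * t * dl <= S * u - S ^+ 2.
  by have := ler_wpM2l S0 tS; rewrite /S; lra.
have := sqr_ge0 S; rewrite !(DeltaE AP) // /H in M *; lra.
Qed.

Lemma Sset_omega xk mu sigma x : dom g xk -> 0 <= mu -> Sset P theta xk mu x ->
  opnorm (J xk) <= sigma ->
  (omega P x <= (((1 + theta) * mu + Lc P * Num.sqrt (2 * Lh P * Delta P x))
       * enorm (x - xk)
     + sigma * Lh P * Lc P / 2 * enorm (x - xk) ^+ 2)%:E)%E.
Proof.
move=> gk mu0 [gx Sx] Js.
have B := grad_H_Hbar AP gk gx mu0 Js.
apply: le_trans (residual_perturb (grad (H P) x) Sx) _; rewrite lee_fin; lra.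
Qed.

(** The residual at an accepted point is at most a multiple of [r] plus a
    multiple of [r^2].  If the first part dominates, the decrease of the
    objective is at least of order [eps^2 / sqrt Delta]; otherwise [r^2] is at
    least of order [eps] and [sqrt Delta] itself decreases by an amount of order
    [eps], which can happen only [O(1 / eps)] times. *)
Lemma accepted_dichotomy xk rho rho_min sigma x eps :
  dom g xk -> 0 < rho_min -> rho_min <= rho -> 0 < Delta P xk ->
  0 < sigma -> opnorm (J xk) <= sigma -> 0 < eps ->
  Sset P theta xk (rho * Num.sqrt (Delta P xk)) x ->
  decrease P theta xk (rho * Num.sqrt (Delta P xk)) x ->
  ~ (omega P x <= eps%:E)%E ->
  eps ^+ 2 <= 64 / (1 - theta) * Num.sqrt (Delta P xk)
      * (rho + Lc P ^+ 2 * Lh P / rho) * (Delta P xk - Delta P x) \/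
  (1 - theta) * rho_min / (4 * (sigma * Lh P * Lc P)) * eps
    <= Num.sqrt (Delta P xk) - Num.sqrt (Delta P x).
Proof.
move=> gk rm0 rm D0 s0 Js e0 Sx; have [t0 t1] := andP theta01.
have rho0 : 0 < rho by exact: lt_le_trans rm.
set u := Num.sqrt _; have gx := Sx.1; rewrite decreaseE // -/u => dec.
have Lh0 := Lh_gt0 AP; have Lc0 := Lc_gt0 AP.
have u0 : 0 < u by rewrite sqrtr_gt0.
have mu0 : 0 <= rho * u by rewrite mulr_ge0 // ltW.
have O := Sset_omega gk mu0 Sx Js; move=> nO.
have {O nO} : eps < ((1 + theta) * (rho * u)
     + Lc P * Num.sqrt (2 * Lh P * Delta P x)) * enorm (x - xk)
     + sigma * Lh P * Lc P / 2 * enorm (x - xk) ^+ 2.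
  by rewrite ltNge; apply/negP => le; apply: nO; apply: (le_trans O); rewrite lee_fin.
set r := enorm (x - xk) in dec *; set a := Num.sqrt (2 * Lh P).
have r0 : 0 <= r by exact: enorm_ge0.
have a0 : 0 < a by rewrite sqrtr_gt0 mulr_gt0.
have aa : a ^+ 2 = 2 * Lh P by rewrite sqr_sqrtr // mulr_ge0 // ltW.
set dF := Delta P xk - Delta P x in dec *.
have mr : 0 <= (1 - theta) / 2 * (rho * u) * r ^+ 2.
  by rewrite !mulr_ge0 ?sqr_ge0 // ?subr_ge0 ltW.
have Dx : Num.sqrt (Delta P x) <= u.
  by rewrite ler_wsqrtr //; rewrite /dF in dec; lra.
have -> : Num.sqrt (2 * Lh P * Delta P x) = a * Num.sqrt (Delta P x).
  by rewrite sqrtrM // mulr_ge0 // ltW.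
move=> small.
have {}small : eps < (2 * rho + Lc P * a) * u * r + sigma * Lh P * Lc P / 2 * r ^+ 2.
  apply: (lt_le_trans small); rewrite lerD2r ler_wpM2r //.
  have := ler_wpM2l (ltW (mulr_gt0 Lc0 a0)) Dx.
  have := ler_wpM2r mu0 (ltW t1); lra.
have [le|lt] := leP (eps / 2) ((2 * rho + Lc P * a) * u * r).
  left; have e2 : 0 <= eps / 2 by lra.
  have := ler_pM e2 e2 le le.
  set X := 2 * rho + Lc P * a => sq.
  have X2 : X ^+ 2 <= 8 * (rho ^+ 2 + Lc P ^+ 2 * Lh P).
    have -> : Lc P ^+ 2 * Lh P = (Lc P * a) ^+ 2 / 2 by rewrite exprMn aa; field.
    have := sqr_ge0 (Lc P * a); have := sqr_ge0 (2 * rho - Lc P * a); rewrite /X; lra.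
  have ur : u * r ^+ 2 <= 2 / ((1 - theta) * rho) * dF.
    have c0 : 0 < (1 - theta) * rho by rewrite mulr_gt0 // subr_gt0.
    rewrite (_ : _ * dF = 2 * dF / ((1 - theta) * rho)); last by ring.
    rewrite ler_pdivlMr //. lra.
  have -> : 64 / (1 - theta) * u * (rho + Lc P ^+ 2 * Lh P / rho) * dF =
     4 * (8 * (rho ^+ 2 + Lc P ^+ 2 * Lh P)) * (u * (2 / ((1 - theta) * rho) * dF)).
    by field; rewrite gt_eqF //= gt_eqF // subr_gt0.
  have Y : X ^+ 2 * (u * (u * r ^+ 2)) <= 8 * (rho ^+ 2 + Lc P ^+ 2 * Lh P)
       * (u * (2 / ((1 - theta) * rho) * dF)).
    apply: ler_pM => //; rewrite ?sqr_ge0 //.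
      by rewrite !mulr_ge0 ?sqr_ge0 // ltW.
    by rewrite ler_wpM2l // ltW.
  lra.
right; set K := sigma * Lh P * Lc P in small *.
have K0 : 0 < K by rewrite !mulr_gt0.
have rr : eps <= K * r ^+ 2 by lra.
rewrite mulrAC ler_pdivrMr ?mulr_gt0 //.
set u' := Num.sqrt (Delta P x) in Dx *.
have u'0 : 0 <= u' by exact: sqrtr_ge0.
have dFE : dF = (u - u') * (u + u').
  rewrite -subr_sqr !sqr_sqrtr // ?(ltW D0) //; exact: (Delta_ge0 AP gx).
have h1 : dF <= (u - u') * (2 * u) by rewrite dFE ler_wpM2l //; lra.
have h2 : (1 - theta) * rho_min * u * r ^+ 2 <= 2 * dF.
  have := ler_wpM2r (_ : 0 <= (1 - theta) * u * r ^+ 2) rm.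
  by rewrite !mulr_ge0 ?sqr_ge0 // ?(ltW u0) ?subr_ge0 ?(ltW t1) // => /(_ isT); lra.
rewrite -(ler_pM2r u0).
have h3 := ler_wpM2l (_ : 0 <= (1 - theta) * rho_min * u) rr.
rewrite !mulr_ge0 ?(ltW u0) ?subr_ge0 ?(ltW t1) ?(ltW rm0) // in h3.
have {}h3 := h3 isT.
have h4 := ler_wpM2l (ltW K0) h2; have h5 := ler_wpM2l (ltW K0) h1.
lra.
Qed.

End OuterStep.


(** * The outer iteration *)

Lemma bernoulli_inequality (R : realDomainType) (a : R) (r : nat) :
  0 <= a -> 1 + r%:R * a <= (1 + a) ^+ r.
Proof.
move=> a0; elim: r => [|r IH]; first by rewrite mul0r addr0.
rewrite exprS -natr1; apply: (@le_trans _ _ ((1 + a) * (1 + r%:R * a))).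
  have : 0 <= a * (r%:R * a) by rewrite !mulr_ge0.
  by rewrite mulrDl !mulrDr; lra.
by rewrite ler_wpM2l // addr_ge0.
Qed.

Lemma near0_small (R : realType) (M b : R) : 0 < b ->
  \forall e \near 0^'+, 0 < e < 1 /\ M * e < b.
Proof.
move=> b0; near=> e.
have e0 : 0 < e by near: e; exact: nbhs_right_gt.
split; first by rewrite e0; near: e; exact: nbhs_right_lt.
have M1 : 0 < `|M| + 1 by rewrite ltr_wpDl.
apply: (@le_lt_trans _ _ ((`|M| + 1) * e)).
  by rewrite ler_wpM2r ?(ltW e0) // (le_trans (ler_norm M)) // lerDl.
rewrite mulrC -ltr_pdivlMr //; near: e; apply: nbhs_right_lt.
by rewrite divr_gt0.
Unshelve. all: by end_near. Qed.

Section OuterRun.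
Context {R : realType} {d n : nat} (P : problem R d n).
Variables (theta alpha rho_min sigma : R) (x0 : 'rV[R]_d).
Variable s : nat -> state1 R d.
Hypothesis AP : assumptions P.
Hypothesis theta01 : 0 < theta < 1.
Hypothesis alpha1 : 1 < alpha.
Hypothesis gx0 : dom (pg P) x0.
Hypothesis rho_min0 : 0 < rho_min.
Hypothesis sigma0 : 0 < sigma.
Hypothesis srun : run1 P theta alpha rho_min x0 s.
Hypothesis sJ : forall j, opnorm ('J (pc P) (iterate (s j))) <= sigma.

Local Notation D j := (Delta P (iterate (s j))).
Local Notation rmax := (rho_max P theta alpha rho_min).
Local Notation K := (rmax + Lc P ^+ 2 * Lh P / rho_min).
Local Notation kap := ((1 - theta) * rho_min / (4 * (sigma * Lh P * Lc P))).

Let Lh0 : 0 < Lh P := Lh_gt0 AP.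
Let Lc0 : 0 < Lc P := Lc_gt0 AP.
Let theta0 : 0 < theta. Proof. by case/andP: theta01. Qed.
Let theta1 : 0 < 1 - theta. Proof. by case/andP: theta01; rewrite subr_gt0. Qed.

Lemma rho_min_le_max : rho_min <= rmax.
Proof.
rewrite /rho_max; case: ltP => // lt; apply: ltW; apply: (lt_le_trans lt).
by rewrite ler_peMl ?(ltW alpha1) // divr_ge0 ?(ltW theta1) // mulr_ge0 ?(ltW Lc0).
Qed.

(** A rejection needs [rho] below the threshold of [large_rho_decrease]; this
    bounds [rho] by [rho_max]. *)
Lemma run1_invariant j :
  [/\ dom (pg P) (iterate (s j)), D j <= Delta P x0,
      rho_min <= rho (s j) <= rmax &
      exists r : nat, rho (s j) = alpha ^+ r * rho_min].
Proof.
elim: j => [|j [gj Dj /andP[rj1 rj2] [r rE]]].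
  rewrite srun.1 /=; split=> //; first by rewrite lexx rho_min_le_max.
  by exists 0%N; rewrite mul1r.
have rj0 : 0 < rho (s j) by exact: lt_le_trans rj1.
case: (srun.2 j) => [D0|mu x D0 muE Sx dec|mu x D0 muE Sx dec].
- by split=> //; [rewrite rj1 | exists r].
- have gx := Sx.1; split=> //=; first last.
  + by exists r.
  + by rewrite rj1.
  apply: le_trans Dj; move: dec; rewrite (decreaseE _ AP) // => dec.
  have u0 := sqrtr_ge0 (D j).
  have : 0 <= (1 - theta) / 2 * mu * enorm (x - iterate (s j)) ^+ 2.
    rewrite muE; apply: mulr_ge0; last exact: sqr_ge0.
    by rewrite !mulr_ge0 ?(ltW theta1) // ltW.
  by move/le_trans/(_ dec); rewrite subr_ge0.
have Dpos : 0 < D j by rewrite lt_def D0 (Delta_ge0 AP gj).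
have lt : rho (s j) < Lc P * Num.sqrt (2 * Lh P) / (1 - theta).
  rewrite ltNge; apply/negP => ge; move/negP: dec; apply.
  by rewrite muE in Sx *; apply: large_rho_decrease.
split=> //=; last by exists r.+1; rewrite rE exprS mulrA.
apply/andP; split.
  by apply: (le_trans rj1); rewrite ler_peMl ?(ltW rj0) ?(ltW alpha1).
rewrite /rho_max (le_lt_trans rj1 lt) ler_pM2l ?ltW //.
exact: lt_trans alpha1.
Qed.

Lemma rejections_le j r : rho (s j) = alpha ^+ r * rho_min ->
  r%:R <= rmax / (rho_min * (alpha - 1)).
Proof.
move=> rE; have [_ _ /andP[_ +] _] := run1_invariant j; rewrite rE => le.
have a1 : 0 < alpha - 1 by rewrite subr_gt0.
rewrite ler_pdivlMr ?mulr_gt0 //; apply: le_trans le.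
rewrite mulrCA [leRHS]mulrC ler_wpM2l ?(ltW rho_min0) //.
have := bernoulli_inequality r (ltW a1).
rewrite (_ : 1 + (alpha - 1) = alpha); [lra | ring].
Qed.

(** The total cost of the first [p] passes, if a pass [i] costs [N i] and no
    iterate up to the [p]-th is acceptable.  By [accepted_dichotomy] each pass is
    paid for by a rejection, by a decrease of the objective, or by a decrease of
    the square root of [Delta]. *)
Lemma run1_budget eps (N : nat -> R) (E W E2 : R) (p : nat) :
  0 < eps -> 0 <= E -> 0 <= W -> 0 <= E2 ->
  (forall i, (i <= p)%N -> ~ (omega P (iterate (s i)) <= eps%:E)%E) ->
  (forall i, (i < p)%N -> [/\ 0 <= N i <= E, N i * Num.sqrt (D i) <= W &
     (kap * eps <= Num.sqrt (D i) -> N i <= E2)]) ->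
  \sum_(i < p) N i <= rmax / (rho_min * (alpha - 1)) * E
     + 64 / (1 - theta) * K * W * gap P x0 / eps ^+ 2
     + E2 * Num.sqrt (Delta P x0) / (kap * eps).
Proof.
move=> e0 E0 W0 E20 bad cost; set c := 64 / (1 - theta).
have c0 : 0 <= c by rewrite divr_ge0 // ltW.
have kap0 : 0 < kap * eps.
  by rewrite mulr_gt0 // divr_gt0 ?mulr_gt0.
have e20 : 0 < eps ^+ 2 by rewrite exprn_gt0.
have K0 : 0 <= K.
  rewrite addr_ge0 ?divr_ge0 ?mulr_ge0 ?sqr_ge0 // ?ltW //.
  exact: lt_le_trans rho_min_le_max.
have inv q : (q <= p)%N -> exists2 r : nat, rho (s q) = alpha ^+ r * rho_min &
    \sum_(i < q) N i <= r%:R * E + c * K * W * (Delta P x0 - D q) / eps ^+ 2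
       + E2 * (Num.sqrt (Delta P x0) - Num.sqrt (D q)) / (kap * eps).
  elim: q => [_|q IH qp].
    exists 0%N; rewrite srun.1 /= ?mul1r // big_ord0 !subrr !mulr0 !mul0r; lra.
  have {IH} [r rE IH] := IH (ltnW qp).
  have [gq Dq /andP[rq1 rq2] _] := run1_invariant q.
  have [_ DS _ _] := run1_invariant q.+1.
  have [/andP[N0 NE] NW N2] := cost q qp.
  have Dn0 : D q != 0.
    apply/eqP => D0; apply: (bad q (ltnW qp)).
    by apply: le_trans (omega_Delta0 AP gq D0) _; rewrite lee_fin ltW.
  have Dpos : 0 < D q by rewrite lt_def Dn0 (Delta_ge0 AP gq).
  rewrite big_ord_recr /=.
  case: (srun.2 q) (bad q.+1 qp) => [/eqP|mu x _ muE Sx dec|mu x _ muE Sx dec] /=.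
  - by rewrite (negbTE Dn0).
  - move=> nO; exists r => //.
    have gx := Sx.1; rewrite muE in Sx dec.
    have := accepted_dichotomy AP theta01 gq rho_min0 rq1 Dpos sigma0 (sJ q) e0 Sx dec nO.
    have : 0 <= D q - Delta P x.
      move: dec; rewrite (decreaseE _ AP) //; apply: le_trans.
      rewrite mulr_ge0 ?sqr_ge0 // mulr_ge0 ?divr_ge0 ?(ltW theta1) //.
      by rewrite mulr_ge0 ?sqrtr_ge0 // ltW // (lt_le_trans rho_min0).
    set u := Num.sqrt (D q) in NW N2 IH *; set dl := D q - Delta P x => dl0.
    have u'u : Num.sqrt (Delta P x) <= u by rewrite ler_wsqrtr // -subr_ge0.
    have u'0 := sqrtr_ge0 (Delta P x).
    have -> : c * K * W * (Delta P x0 - Delta P x) / eps ^+ 2 =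
        c * K * W * (Delta P x0 - D q) / eps ^+ 2 + c * K * W * dl / eps ^+ 2.
      by rewrite /dl; ring.
    have -> : E2 * (Num.sqrt (Delta P x0) - Num.sqrt (Delta P x)) / (kap * eps) =
        E2 * (Num.sqrt (Delta P x0) - u) / (kap * eps)
        + E2 * (u - Num.sqrt (Delta P x)) / (kap * eps) by ring.
    have t1 : 0 <= c * K * W * dl / eps ^+ 2 by rewrite !mulr_ge0 // invr_ge0 ltW.
    have t2 : 0 <= E2 * (u - Num.sqrt (Delta P x)) / (kap * eps).
      by rewrite divr_ge0 ?(ltW kap0) // mulr_ge0 // subr_ge0.
    case=> [ty1|ty2].
      suff : N q <= c * K * W * dl / eps ^+ 2 by lra.
      rewrite ler_pdivlMr //.
      have rK : rho (s q) + Lc P ^+ 2 * Lh P / rho (s q) <= K.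
        apply: lerD => //; apply: ler_wpM2l.
          by apply: mulr_ge0; [exact: sqr_ge0 | exact: ltW].
        by rewrite lef_pV2 ?posrE // (lt_le_trans rho_min0).
      have h1 := ler_wpM2l N0 ty1; apply: (le_trans h1); rewrite -/c.
      have h2 : N q * u * (rho (s q) + Lc P ^+ 2 * Lh P / rho (s q)) <= W * K.
        apply: ler_pM => //; first by rewrite mulr_ge0 // sqrtr_ge0.
        have rq0 : 0 <= rho (s q) by exact: le_trans (ltW rho_min0) rq1.
        apply: addr_ge0 => //; apply: divr_ge0 => //.
        by apply: mulr_ge0; [exact: sqr_ge0 | exact: ltW].
      have := ler_wpM2l (mulr_ge0 c0 dl0) h2; lra.
    suff : N q <= E2 * (u - Num.sqrt (Delta P x)) / (kap * eps) by lra.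
    rewrite ler_pdivlMr //; apply: ler_pM => //; first exact: ltW.
    by apply: N2; lra.
  move=> _; exists r.+1; first by rewrite rE exprS mulrA.
  by rewrite -natr1 mulrDl mul1r; lra.
have [r rE le] := inv p (leqnn p); apply: (le_trans le).
have [gp _ _ _] := run1_invariant p.
have rR := ler_wpM2r E0 (rejections_le rE).
have l1 : c * K * W * (Delta P x0 - D p) / eps ^+ 2 <= c * K * W * gap P x0 / eps ^+ 2.
  rewrite ler_pM2r ?invr_gt0 //; apply: ler_wpM2l.
    by rewrite mulr_ge0 // mulr_ge0.
  by have := Fstar_lower AP gp; rewrite (gapE AP) // !(DeltaE AP) //; lra.
have l2 : E2 * (Num.sqrt (Delta P x0) - Num.sqrt (D p)) / (kap * eps) <=
   E2 * Num.sqrt (Delta P x0) / (kap * eps).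
  by rewrite ler_pM2r ?invr_gt0 // ler_wpM2l // lerBlDr lerDl sqrtr_ge0.
exact: lerD (lerD rR l1) l2.
Qed.

Lemma run1_budget1 eps (p : nat) : 0 < eps ->
  (forall i, (i <= p)%N -> ~ (omega P (iterate (s i)) <= eps%:E)%E) ->
  p%:R <= rmax / (rho_min * (alpha - 1))
     + 64 / (1 - theta) * iteration_bound P theta alpha rho_min x0 eps
     + Num.sqrt (Delta P x0) / (kap * eps).
Proof.
move=> e0 bad.
have := @run1_budget eps (fun=> 1) 1 (Num.sqrt (Delta P x0)) 1 p e0 ler01
  (sqrtr_ge0 _) ler01 bad.
rewrite sumr_const card_ord mulr1 mul1r => H.
have -> : 64 / (1 - theta) * iteration_bound P theta alpha rho_min x0 eps =
  64 / (1 - theta) * K * Num.sqrt (Delta P x0) * gap P x0 / eps ^+ 2.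
  by rewrite /iteration_bound; ring.
apply: H => i ip; have [_ Di _ _] := run1_invariant i.
by split=> //; [rewrite ler01 lexx | rewrite mul1r ler_wsqrtr].
Qed.

Lemma run1_reaches eps : 0 < eps ->
  exists2 p, (omega P (iterate (s p)) <= eps%:E)%E &
    forall i, (i < p)%N -> ~ (omega P (iterate (s i)) <= eps%:E)%E.
Proof.
move=> e0; have [ex|nex] := pselect (exists i, omega P (iterate (s i)) <= eps%:E)%E.
  case: (ex_minnP ex) => p gp pmin; exists p => // i ip /pmin.
  by rewrite leqNgt ip.
exfalso; set B := rmax / (rho_min * (alpha - 1))
     + 64 / (1 - theta) * iteration_bound P theta alpha rho_min x0 eps
     + Num.sqrt (Delta P x0) / (kap * eps).
have Ble p : p%:R <= B.
  by apply: run1_budget1 => // i _ gi; apply: nex; exists i.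
have := truncnS_gt B; rewrite ltNge => /negP; apply; exact: Ble.
Qed.

(** For small [eps] the terms of the budget of lower order in [1 / eps] are
    absorbed by doubling the main one. *)
Lemma outer_complexity :
  \forall eps \near 0^'+, exists j : nat,
    [/\ j%:R <= 128 / (1 - theta) * iteration_bound P theta alpha rho_min x0 eps,
        dom (pg P) (iterate (s j)) & (omega P (iterate (s j)) <= eps%:E)%E].
Proof.
set c := 64 / (1 - theta); have c0 : 0 < c by rewrite divr_gt0.
have c2 : 128 / (1 - theta) = 2 * c by rewrite /c mulrA -natrM.
have rm0 : 0 < rmax := lt_le_trans rho_min0 rho_min_le_max.
have K0 : 0 < K.
  rewrite ltr_wpDr // divr_ge0 ?(ltW rho_min0) //.
  by apply: mulr_ge0; [exact: sqr_ge0 | exact: ltW].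
have [gap0|gapn] := eqVneq (gap P x0) 0.
  near=> eps; have e0 : 0 < eps by near: eps; exact: nbhs_right_gt.
  exists 0%N; rewrite srun.1 /=; split=> //.
    by rewrite /iteration_bound gap0 mulr0 mul0r mulr0.
  apply: (le_trans (omega_gap0 AP gx0 gap0)); rewrite lee_fin ltW //.
have gap0 : 0 < gap P x0 by rewrite lt_def gapn (gap_ge0 AP).
have D0 : 0 < Delta P x0.
  exact: lt_le_trans gap0 (gap_le_Delta AP gx0).
have u0 : 0 < Num.sqrt (Delta P x0) by rewrite sqrtr_gt0.
pose b := Num.sqrt (Delta P x0) * gap P x0 * K.
have b0 : 0 < b by rewrite !mulr_gt0.
pose M := 1 + rmax / (rho_min * (alpha - 1)) + Num.sqrt (Delta P x0) / kap.
near=> eps.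
have [/andP[e0 e1] small] : 0 < eps < 1 /\ M * eps < c * b.
  by near: eps; apply: near0_small; rewrite mulr_gt0.
have [p gp bad] := run1_reaches e0; exists p; split=> //; last first.
  by have [] := run1_invariant p.
have IE : iteration_bound P theta alpha rho_min x0 eps = b / eps ^+ 2.
  by rewrite /iteration_bound /b; ring.
case: p gp bad => [_ _|p _ bad].
  have : 0 <= b / eps ^+ 2 by rewrite divr_ge0 ?sqr_ge0 // ltW.
  by rewrite c2 IE; apply: mulr_ge0; rewrite mulr_ge0 // ltW.
have := run1_budget1 e0 (p := p) bad; rewrite IE c2 -/c => le.
rewrite -natr1; apply: (le_trans (lerD le (lexx 1))).
have -> : 2 * c * (b / eps ^+ 2) = c * (b / eps ^+ 2) + c * b / eps ^+ 2 by ring.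
have M0 : 0 <= 1 + rmax / (rho_min * (alpha - 1)).
  by rewrite addr_ge0 // divr_ge0 ?(ltW rm0) // mulr_ge0 ?subr_ge0 // ltW.
have kap0 : 0 < kap by rewrite divr_gt0 // ?mulr_gt0.
suff : 1 + rmax / (rho_min * (alpha - 1)) + Num.sqrt (Delta P x0) / (kap * eps)
    <= c * b / eps ^+ 2 by lra.
rewrite ler_pdivlMr ?exprn_gt0 //; apply: le_trans (ltW small).
have expand (a v k e : R) : k != 0 -> e != 0 ->
    (a + v / (k * e)) * e ^+ 2 = a * e ^+ 2 + v / k * e.
  by move=> k0 e0'; field; rewrite k0 e0'.
rewrite expand ?gt_eqF // /M.
rewrite [leRHS]mulrDl lerD2r ler_wpM2l // expr2 ler_piMl ?ltW //.
Unshelve. all: by end_near. Qed.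

End OuterRun.


(** * The accelerated proximal gradient step *)

Section Weights.
Context {R : realType}.
Implicit Types (eta mu b : R).

Definition next_weight eta mu b : R :=
  (1 + 2 * eta * b + Num.sqrt (1 + 4 * eta * b * (1 + mu * b))) / (2 * (eta - mu)).

Variables (eta mu b : R).
Hypothesis mu0 : 0 < mu.
Hypothesis eta_mu : mu < eta.
Hypothesis b0 : 0 <= b.
Local Notation b' := (next_weight eta mu b).

Let eta0 : 0 < eta. Proof. exact: lt_trans eta_mu. Qed.

(** [b'] is the larger root of this quadratic equation, which is what makes the
    squared norm of the gradient mapping cancel in the potential. *)
Lemma next_weightE : eta * (b' - b) ^+ 2 = b' * (1 + mu * b').
Proof.
have em : eta - mu != 0 by rewrite gt_eqF // subr_gt0.
have disc : 0 <= 1 + 4 * eta * b * (1 + mu * b).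
  by rewrite addr_ge0 // !mulr_ge0 // ?addr_ge0 ?mulr_ge0 // ltW.
rewrite /next_weight; set r := Num.sqrt _.
have rr : r ^+ 2 = 1 + 4 * eta * b * (1 + mu * b) by rewrite sqr_sqrtr.
apply/eqP; rewrite -subr_eq0; apply/eqP.
have -> : forall B, eta * (B - b) ^+ 2 - B * (1 + mu * B) =
   (eta - mu) * B ^+ 2 - (1 + 2 * eta * b) * B + eta * b ^+ 2 by move=> B; ring.
have -> : (eta - mu) * ((1 + 2 * eta * b + r) / (2 * (eta - mu))) ^+ 2 -
   (1 + 2 * eta * b) * ((1 + 2 * eta * b + r) / (2 * (eta - mu))) + eta * b ^+ 2 =
   (r ^+ 2 - (1 + 2 * eta * b) ^+ 2 + 4 * (eta - mu) * eta * b ^+ 2) / (4 * (eta - mu)).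
  by field; rewrite em.
by rewrite rr; field; rewrite em.
Qed.

Lemma next_weight_gt : b < b'.
Proof.
have em : 0 < eta - mu by rewrite subr_gt0.
rewrite /next_weight ltr_pdivlMr ?mulr_gt0 //.
have := sqrtr_ge0 (1 + 4 * eta * b * (1 + mu * b)).
have := mulr_ge0 b0 (ltW mu0); lra.
Qed.

Lemma next_weight_gt0 : 0 < b'.
Proof. exact: le_lt_trans next_weight_gt. Qed.

Lemma next_weight_init M : b = 0 -> eta <= M -> M^-1 <= b'.
Proof.
move=> b00 eM; have M0 : 0 < M by exact: lt_le_trans eM.
move: next_weightE next_weight_gt0; move: (b') => B; rewrite b00 subr0 => E B0.
rewrite -(ler_pM2l M0) divff ?gt_eqF // -(ler_pM2r B0) mul1r.
have : eta * B ^+ 2 <= M * B ^+ 2 by rewrite ler_wpM2r // sqr_ge0.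
have := mulr_ge0 (ltW mu0) (sqr_ge0 B); lra.
Qed.

Lemma next_weight_growth M : eta <= M -> (1 + Num.sqrt (mu / M)) * b <= b'.
Proof.
move=> eM; have M0 : 0 < M by exact: lt_le_trans eM.
have b'0 := next_weight_gt0; have bb' := next_weight_gt.
set k : R := Num.sqrt _; have k0 : 0 <= k by exact: sqrtr_ge0.
have kk : k ^+ 2 * M = mu by rewrite sqr_sqrtr ?divr_ge0 ?(ltW M0) ?(ltW mu0) // divfK // gt_eqF.
move: next_weightE b'0 bb'; move: (b') => B E B0 bB.
have kB : 0 <= k * B := mulr_ge0 k0 (ltW B0).
have le : k * B <= B - b.
  rewrite -(@ler_pXn2r _ 2) ?nnegrE ?subr_ge0 ?(ltW bB) //.
  rewrite -(ler_pM2l M0) exprMn mulrA [M * _]mulrC kk.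
  apply: (@le_trans _ _ (eta * (B - b) ^+ 2)); last by rewrite ler_wpM2r // sqr_ge0.
  by rewrite E expr2; lra.
have : k * b <= k * B by rewrite ler_wpM2l // ltW.
lra.
Qed.

End Weights.

Section AcceleratedStep.
Context {R : realType} {d n : nat} (P : problem R d n).
Hypothesis AP : assumptions P.
Variables (xk : 'rV[R]_d) (mu : R).
Hypothesis mu0 : 0 < mu.
Implicit Types (x y z u : 'rV[R]_d) (eta b : R).

Local Notation g := (pg P).
Local Notation gr x := (fine (pg P x)).
Local Notation Hb := (Hbar P xk mu).
Local Notation GHb := (grad (Hbar P xk mu)).

Definition model x : R := gr x + Hb x.

Definition prox_step eta y : 'rV[R]_d := prox eta^-1 g (y - eta^-1 *: GHb y).

Definition step_weight eta b : R :=
  let b' := next_weight eta mu b in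
  (b' - b) * (1 + mu * b) / (b' * (1 + mu * b) + mu * b * (b' - b)).

Definition extrapolate eta b x z : 'rV[R]_d := x + step_weight eta b *: (z - x).

Definition mirror_step eta b z y x' : 'rV[R]_d :=
  let phi := (next_weight eta mu b - b) / (1 + mu * next_weight eta mu b) in
  (1 - mu * phi) *: z + (mu * phi) *: y + (eta * phi) *: (x' - y).

Definition majorizes eta y x' : bool :=
  Hb x' <= Hb y + dotp (GHb y) (x' - y) + eta / 2 * enorm (x' - y) ^+ 2.

Lemma prox_step_subdiff eta y : 0 < eta ->
  subdiff g (prox_step eta y) (eta *: (y - prox_step eta y) - GHb y).
Proof.
move=> eta0; have e0 : 0 < eta^-1 by rewrite invr_gt0.
have := prox_subdiff (g_proper AP) (g_closed AP) (y - eta^-1 *: GHb y)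
  (g_convex AP) (gstar_fine_le AP) e0.
rewrite -/(prox_step eta y) invrK; move: (prox_step eta y) (GHb y) => x' G.
have -> // : eta *: (y - eta^-1 *: G - x') = eta *: (y - x') - G.
by rewrite addrAC scalerBr scalerA divff ?gt_eqF // scale1r.
Qed.

Lemma prox_step_dom eta y : 0 < eta -> dom g (prox_step eta y).
Proof. by move=> /prox_step_subdiff/(subdiff_dom (g_proper AP)); exact. Qed.

Lemma prox_step_descent eta y u : 0 < eta -> dom g u ->
  majorizes eta y (prox_step eta y) ->
  model (prox_step eta y) + eta * dotp (y - prox_step eta y) (u - y)
    + eta / 2 * enorm (y - prox_step eta y) ^+ 2 + mu / 2 * enorm (u - y) ^+ 2
  <= model u.
Proof.
move=> eta0 gu; rewrite /majorizes.
have := subdiff_le (g_proper AP) (prox_step_subdiff y eta0) gu.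
have := Hbar_strong_convex AP xk mu y u.
rewrite /model; move: (prox_step eta y) (GHb y) => x' G.
have -> : u - x' = (u - y) + (y - x') by rewrite addrA subrK.
have -> : x' - y = - (y - x') by rewrite opprB.
move: (u - y) (y - x') => v w.
rewrite enormN (enorm_sqr w) !dotpE; lra.
Qed.

Lemma model_strong_min x : dom g x ->
  (forall w, dom g w -> model x <= model w) ->
  forall w, dom g w -> mu / 2 * enorm (w - x) ^+ 2 <= model w - model x.
Proof.
move=> gx xmin w gw.
have sx := argmin_subdiff (g_proper AP) (g_convex AP) gx
  (Hbar_differentiable AP xk mu x) xmin.
have := subdiff_le (g_proper AP) sx gw.
have := Hbar_strong_convex AP xk mu x w.
rewrite /model dotpNl; lra.
Qed.

Lemma model_argmin_exists : exists2 x, dom g x &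
  forall w, dom g w -> model x <= model w.
Proof.
have m2 : 0 < mu / 2 by rewrite divr_gt0.
apply: (@argmin_exists _ _ g (g_proper AP) (g_closed AP) Hb xk (gstar P) (hstar P) _ _
  (gstar_fine_le AP) m2).
  by move=> x; apply/differentiable_continuous/(Hbar_differentiable AP).
by move=> w; rewrite /Hbar lerD2r; exact: (hstar_le_h AP).
Qed.

(** The case [eta <= mu].  Strong convexity then makes the test of [majorizes] an
    equality, and cocoercivity of [grad h] makes the gradient of the model exact
    along the step. *)
Lemma majorizes_small_eta eta y x' : eta <= mu -> majorizes eta y x' ->
  GHb x' - GHb y - eta *: (x' - y) = 0.
Proof.
move=> em; rewrite /majorizes => maj.
have ex := Hbar_excess AP xk mu y x'.
have co := grad_diff_sqr_le (h_differentiable AP) (Lh_gt0 AP) (h_smooth AP)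
   (linearization P xk y) (linearization P xk x') (h_convex AP).
rewrite !(grad_Hbar AP).
set a := grad _ (linearization P xk x') in co *.
set e := grad _ (linearization P xk y) in co ex *.
have sq := sqr_ge0 (enorm (x' - y)).
have exc : ph P (linearization P xk x') - ph P (linearization P xk y)
    - dotp e (linearization P xk x' - linearization P xk y)
    <= (eta - mu) / 2 * enorm (x' - y) ^+ 2 by lra.
have neg : (eta - mu) / 2 * enorm (x' - y) ^+ 2 <= 0.
  by rewrite mulr_le0_ge0 // ler_pdivrMr // mul0r subr_le0.
have ae : a = e.
  apply/eqP; rewrite -subr_eq0; apply/eqP/enorm_eq0/eqP; rewrite -sqrf_eq0.
  rewrite eq_le sqr_ge0 andbT; apply: (le_trans co).
  rewrite mulr_ge0_le0 //; last by apply: le_trans exc neg.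
  by rewrite mulr_ge0 // (ltW (Lh_gt0 AP)).
have zero : (mu - eta) *: (x' - y) = 0.
  have [->|me] := eqVneq eta mu; first by rewrite subrr scale0r.
  have me0 : 0 < mu - eta by rewrite subr_gt0 lt_def eq_sym me.
  suff /enorm_eq0-> : enorm (x' - y) = 0 by rewrite scaler0.
  apply/eqP; rewrite -sqrf_eq0 eq_le sq andbT.
  have : 0 <= (eta - mu) / 2 * enorm (x' - y) ^+ 2.
    apply: le_trans exc; have := convex_grad_le (linearization P xk x') (h_convex AP)
      (h_differentiable AP (linearization P xk y)); rewrite -/e; lra.
  by move=> pos; rewrite -(ler_pM2l me0) mulr0; lra.
rewrite ae -[RHS]zero scalerBl; move: (e *m _) => f.
rewrite opprD addrACA subrr add0r -scalerBr; congr (_ *: _ - _).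
by rewrite opprB addrA subrK.
Qed.

End AcceleratedStep.


Section Potential.
Context {R : realType}.

(** The potential inequality in coordinates.  [v], [w] and [q] are the vectors
    [z - x], [y - x'] and [u - y], and [vv], [vw], ... their inner products;
    [X], [X'] and [U] are the values of the model at [x], [x'] and [u].  The two
    hypotheses are combined with the weights [b] and [b' - b]. *)
Lemma potential_scalar (eta mu b b' T vv ww qq vw vq wq X X' U alpha beta : R) :
  0 < mu -> 0 < eta -> 0 <= b -> b < b' -> 0 <= vv ->
  eta * (b' - b) ^+ 2 = b' * (1 + mu * b') ->
  T = (b' - b) * (1 + mu * b) / (b' * (1 + mu * b) + mu * b * (b' - b)) ->
  X' - eta * T * vw + eta / 2 * ww + mu / 2 * T ^+ 2 * vv <= X ->
  X' + eta * wq + eta / 2 * ww + mu / 2 * qq <= U ->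
  alpha = (1 - mu * ((b' - b) / (1 + mu * b'))) * (1 - T) ->
  beta = eta * ((b' - b) / (1 + mu * b')) ->
  b' * (X' - U) + (1 + mu * b') / 2 * (alpha ^+ 2 * vv + beta ^+ 2 * ww + qq
     - 2 * alpha * beta * vw - 2 * alpha * vq + 2 * beta * wq) <=
  b * (X - U) + (1 + mu * b) / 2 * ((1 - T) ^+ 2 * vv - 2 * (1 - T) * vq + qq).
Proof.
move=> mu0 eta0 b0 bb' vv0 quad TE I1 I2 alphaE betaE.
have b'0 : 0 < b' by exact: le_lt_trans bb'.
have a0 : 0 < b' - b by rewrite subr_gt0.
have B0 : 0 < 1 + mu * b by apply: ltr_pwDl => //; apply: mulr_ge0; rewrite // ltW.
have B'0 : 0 < 1 + mu * b' by apply: ltr_pwDl => //; apply: mulr_ge0; rewrite // ltW.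
have den0 : 0 < b' * (1 + mu * b) + mu * b * (b' - b).
  by apply: ltr_pwDl; rewrite ?mulr_gt0 // !mulr_ge0 // ?(ltW a0) ?(ltW mu0).
have c0 : 0 <= 1 - T.
  rewrite subr_ge0 TE ler_pdivrMr // mul1r.
  have : (b' - b) * (1 + mu * b) <= b' * (1 + mu * b).
    by rewrite ler_wpM2r ?(ltW B0) // lerBlDr lerDl.
  have : 0 <= mu * b * (b' - b) by rewrite !mulr_ge0 // ltW.
  lra.
have hA : (1 + mu * b') * alpha = (1 + mu * b) * (1 - T).
  by rewrite alphaE; field; rewrite gt_eqF.
have hB : (1 + mu * b') * beta = eta * (b' - b).
  by rewrite betaE; field; rewrite gt_eqF.
have hB2 : (1 + mu * b') * beta ^+ 2 = eta * b'.
  rewrite expr2 mulrA hB betaE.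
  have -> : eta * (b' - b) * (eta * ((b' - b) / (1 + mu * b'))) =
    eta * (eta * (b' - b) ^+ 2) / (1 + mu * b') by ring.
  by rewrite quad; field; rewrite gt_eqF.
have hT : b * T * (1 + mu * b') = (b' - b) * (1 + mu * b) * (1 - T).
  by rewrite TE; field; rewrite gt_eqF.
have hAB : (1 + mu * b') * alpha * beta = eta * b * T.
  rewrite hA betaE; apply: (mulIf (lt0r_neq0 B'0)).
  have -> : eta * b * T * (1 + mu * b') = eta * (b * T * (1 + mu * b')) by ring.
  by rewrite hT; field; rewrite gt_eqF.
have alpha_le : alpha <= 1 - T.
  rewrite -(ler_pM2l B'0) hA ler_wpM2r // lerD2l.
  by apply: ler_wpM2l; exact: ltW.
have alpha0 : 0 <= alpha.
  by rewrite -(pmulr_rge0 _ B'0) hA mulr_ge0 // ltW.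
have hvv : (1 + mu * b') * alpha ^+ 2 * vv <= (1 + mu * b) * (1 - T) ^+ 2 * vv.
  rewrite ler_wpM2r // !expr2 !mulrA hA ler_wpM2l // mulr_ge0 //; exact: ltW.
have hT2 : 0 <= b * (mu / 2 * T ^+ 2 * vv).
  apply: mulr_ge0 => //; apply: mulr_ge0 => //; apply: mulr_ge0; last exact: sqr_ge0.
  by rewrite divr_ge0 // ltW.
have J1 := ler_wpM2l b0 I1; have J2 := ler_wpM2l (ltW a0) I2.
have E1 : (1 + mu * b') * beta ^+ 2 * ww = eta * b' * ww by rewrite hB2.
have E2 : (1 + mu * b') * alpha * beta * vw = eta * b * T * vw by rewrite hAB.
have E3 : (1 + mu * b') * alpha * vq = (1 + mu * b) * (1 - T) * vq by rewrite hA.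
have E4 : (1 + mu * b') * beta * wq = eta * (b' - b) * wq by rewrite hB.
by move: J1 J2 hvv hT2 E1 E2 E3 E4; clear; lra.
Qed.

Lemma step_weight_itv (mu eta b : R) : 0 < mu -> mu < eta -> 0 <= b ->
  0 <= step_weight mu eta b <= 1.
Proof.
move=> mu0 em b0; rewrite /step_weight; have := next_weight_gt mu0 em b0.
move: (next_weight _ _ _) => b' bb'.
have b'0 : 0 < b' by exact: le_lt_trans bb'.
have a0 : 0 < b' - b by rewrite subr_gt0.
have B0 : 0 < 1 + mu * b by apply: ltr_pwDl => //; apply: mulr_ge0; rewrite // ltW.
have den0 : 0 < b' * (1 + mu * b) + mu * b * (b' - b).
  by apply: ltr_pwDl; rewrite ?mulr_gt0 // !mulr_ge0 // ?(ltW a0) ?(ltW mu0).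
apply/andP; split.
  by apply: divr_ge0; [apply: mulr_ge0|]; exact: ltW.
rewrite ler_pdivrMr // mul1r.
have : (b' - b) * (1 + mu * b) <= b' * (1 + mu * b).
  by rewrite ler_wpM2r ?(ltW B0) // lerBlDr lerDl.
have : 0 <= mu * b * (b' - b) by rewrite !mulr_ge0 // ltW.
lra.
Qed.

End Potential.

Section AcceleratedConvergence.
Context {R : realType} {d n : nat} (P : problem R d n).
Hypothesis AP : assumptions P.
Variables (xk : 'rV[R]_d) (mu : R).
Hypothesis mu0 : 0 < mu.
Implicit Types (x y z u : 'rV[R]_d) (eta b : R).

Local Notation g := (pg P).
Local Notation F_ := (model P xk mu).
Local Notation GHb := (grad (Hbar P xk mu)).

Definition potential u b x z : R :=
  b * (F_ x - F_ u) + (1 + mu * b) / 2 * enorm (z - u) ^+ 2.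

Lemma potential_decrease eta b x z u : mu < eta -> 0 <= b -> dom g x -> dom g u ->
  let y := extrapolate mu eta b x z in
  let x' := prox_step P xk mu eta y in
  majorizes P xk mu eta y x' ->
  potential u (next_weight eta mu b) x' (mirror_step mu eta b z y x')
    <= potential u b x z.
Proof.
move=> em b0 gx gu y x' maj; have eta0 : 0 < eta by exact: lt_trans em.
have I1 := prox_step_descent AP eta0 gx maj.
have I2 := prox_step_descent AP eta0 gu maj.
rewrite -/x' in I1 I2; rewrite /potential /mirror_step.
have bb' := next_weight_gt mu0 em b0.
have quad := next_weightE mu0 em b0.
have yE : y = x + step_weight mu eta b *: (z - x) by [].
have TE : step_weight mu eta b =
  (next_weight eta mu b - b) * (1 + mu * b) /
    (next_weight eta mu b * (1 + mu * b) + mu * b * (next_weight eta mu b - b)) by [].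
move: (step_weight mu eta b) TE yE => T TE yE.
move: (next_weight eta mu b) quad bb' TE => b' quad bb' TE.
move: x' I1 I2 {maj} => x' I1 I2; move: y yE x' I1 I2 => y yE x' I1 I2.
set phi := (b' - b) / (1 + mu * b').
have xy : x - y = - (T *: (z - x)) by rewrite yE opprD addrA subrr add0r.
have zy : z - y = (1 - T) *: (z - x).
  by rewrite yE opprD addrA scalerBl scale1r.
have zu : z - u = (1 - T) *: (z - x) - (u - y) by rewrite -zy opprB addrA subrK.
have z'u : (1 - mu * phi) *: z + (mu * phi) *: y + (eta * phi) *: (x' - y) - u =
   ((1 - mu * phi) * (1 - T)) *: (z - x) - (eta * phi) *: (y - x') - (u - y).
  rewrite -[in RHS]scalerA -zy.
  by move: (mu * phi) (eta * phi) => k l; apply/rowP => i; rewrite !mxE; ring.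
rewrite zu z'u; rewrite xy in I1.
move: (z - x) (y - x') (u - y) I1 I2 => v w q I1 I2.
rewrite enormN enormZ exprMn real_normK ?num_real // dotpNr dotpZr in I1.
rewrite !enorm_sqr (dotpC w v) in I1; rewrite !enorm_sqr (dotpC w q) in I2 *.
have I1' : F_ x' - eta * T * dotp v w + eta / 2 * dotp w w + mu / 2 * T ^+ 2 * dotp v v
    <= F_ x by move: I1; clear; lra.
have := @potential_scalar R eta mu b b' T _ _ _ _ (dotp v q) _ _ _ _ _ _
  mu0 eta0 b0 bb' (dotp_ge0 v) quad TE I1' I2 erefl erefl; rewrite -/phi.
set al := (1 - mu * phi) * (1 - T); set be := eta * phi; set c := 1 - T.
have -> : dotp (al *: v - be *: w - q) (al *: v - be *: w - q) =
   al ^+ 2 * dotp v v + be ^+ 2 * dotp w w + dotp q q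
     - 2 * al * be * dotp v w - 2 * al * dotp v q + 2 * be * dotp q w.
  by move: al be {I1'} => al be; rewrite !dotpE (dotpC w v) (dotpC q v) (dotpC w q); ring.
have -> // : dotp (c *: v - q) (c *: v - q) =
   c ^+ 2 * dotp v v - 2 * c * dotp v q + dotp q q.
by move: c => c; rewrite !dotpE (dotpC q v); ring.
Qed.

Section Minimizer.
Variable u : 'rV[R]_d.
Hypothesis gu : dom g u.
Hypothesis umin : forall w, dom g w -> F_ u <= F_ w.

Lemma potential_bounds b x z (D : R) : 0 <= b -> dom g x -> 0 <= D ->
  potential u b x z <= D ^+ 2 / 2 ->
  mu * b * enorm (x - u) ^+ 2 <= D ^+ 2 /\ mu * b * enorm (z - u) ^+ 2 <= D ^+ 2.
Proof.
move=> b0 gx D0; rewrite /potential => pot.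
have sm := model_strong_min AP gu umin gx.
have mb : 0 <= mu * b by rewrite mulr_ge0 // ltW.
have h1 := ler_wpM2l b0 sm.
have h2 := sqr_ge0 (enorm (z - u)).
have h3 := mulr_ge0 mb h2.
have h4 : 0 <= b * (mu / 2 * enorm (x - u) ^+ 2).
  rewrite mulrA mulr_ge0 ?sqr_ge0 // mulr_ge0 // divr_ge0 // ltW //.
have {gx} := h4.
move: h1 h2 h3 pot; move: (F_ x) (F_ u) (enorm _) (enorm _) => a c p q.
by clear; split; lra.
Qed.

Lemma potential_dist (Q D : R) b x z : 0 <= Q -> Q ^+ 2 <= mu * b -> 0 <= b -> dom g x ->
  0 <= D -> potential u b x z <= D ^+ 2 / 2 ->
  Q * enorm (x - u) <= D /\ Q * enorm (z - u) <= D.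
Proof.
move=> Q0 Qb b0 gx D0 /(potential_bounds b0 gx D0)[hx hz].
split; rewrite -(@ler_pXn2r _ 2) ?nnegrE ?mulr_ge0 ?enorm_ge0 // exprMn.
  by apply: le_trans hx; rewrite ler_wpM2r // sqr_ge0.
by apply: le_trans hz; rewrite ler_wpM2r // sqr_ge0.
Qed.

(** Once [mu b] is large, [x], [z] and [x'] are all within [D / Q] of the
    minimizer [u], while [x'] is at a distance about [D] from [xk].  The
    displacement [x' - y] is then relatively small and the stopping test
    succeeds. *)
Lemma stopping_test eta b x z (sigma theta M Q : R) :
  0 <= theta -> mu < eta -> 0 <= b -> dom g x -> eta <= M -> 0 < Q -> Q ^+ 2 <= mu * b ->
  opnorm ('J (pc P) xk) <= sigma ->
  2 * (Lh P * sigma ^+ 2 + mu + M) <= theta * mu * (Q - 1) ->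
  potential u b x z <= enorm (xk - u) ^+ 2 / 2 ->
  let y := extrapolate mu eta b x z in
  let x' := prox_step P xk mu eta y in
  majorizes P xk mu eta y x' ->
  enorm (GHb x' - GHb y - eta *: (x' - y)) <= theta * mu * enorm (x' - xk).
Proof.
move=> th0 em b0 gx eM Q0 Qb Js QM pot y x' maj.
have eta0 : 0 < eta by exact: lt_trans em.
have D0 := enorm_ge0 (xk - u); set D : R := enorm (xk - u) in pot D0.
have [hx hz] := potential_dist (ltW Q0) Qb b0 gx D0 pot.
have pot' := le_trans (potential_decrease em b0 gx gu maj) pot.
have bb' := next_weight_gt mu0 em b0.
have Qb' : Q ^+ 2 <= mu * next_weight eta mu b.
  by apply: (le_trans Qb); rewrite ler_wpM2l ?(ltW mu0) // ltW.
have gx' : dom g x' := prox_step_dom AP _ _ _ eta0.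
have [hx' _] := potential_dist (ltW Q0) Qb' (le_trans b0 (ltW bb')) gx' D0 pot'.
have /andP[T0 T1] := step_weight_itv mu0 em b0.
have hy : Q * enorm (y - u) <= D.
  rewrite /y /extrapolate; move: (step_weight mu eta b) T0 T1 => T T0 T1.
  have -> : x + T *: (z - x) - u = (1 - T) *: (x - u) + T *: (z - u).
    by apply/rowP => i; rewrite !mxE; ring.
  have T1' : 0 <= 1 - T by rewrite subr_ge0.
  apply: (le_trans (ler_wpM2l (ltW Q0) (ler_enormD _ _))).
  rewrite !enormZ !ger0_norm //.
  have h1 := ler_wpM2l T1' hx; have h2 := ler_wpM2l T0 hz.
  by move: h1 h2; lra.
have step_le : Q * enorm (x' - y) <= 2 * D.
  apply: (le_trans (ler_wpM2l (ltW Q0) (ler_distD_enorm u _ _))).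
  by rewrite (enormB u y) mulrDr; move: hx' hy; lra.
have far : (Q - 1) * D <= Q * enorm (x' - xk).
  have := ler_wpM2l (ltW Q0) (ler_distD_enorm x' xk u); rewrite (enormB xk x') -/D.
  by move: hx'; lra.
have L0 : 0 <= Lh P * sigma ^+ 2 + mu + M.
  rewrite !addr_ge0 ?(ltW mu0) ?(le_trans (ltW eta0) eM) //.
  by rewrite mulr_ge0 ?sqr_ge0 // (ltW (Lh_gt0 AP)).
rewrite -(ler_pM2l Q0).
have lip := grad_Hbar_lipschitz AP y x' Js (ltW mu0).
have tri : enorm (GHb x' - GHb y - eta *: (x' - y)) <=
    (Lh P * sigma ^+ 2 + mu + M) * enorm (x' - y).
  apply: (le_trans (ler_enormB _ _)); rewrite enormZ gtr0_norm // [leRHS]mulrDl.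
  by apply: lerD lip _; rewrite ler_wpM2r ?enorm_ge0.
apply: (le_trans (ler_wpM2l (ltW Q0) tri)).
have s1 := ler_wpM2l L0 step_le.
have s2 := ler_wpM2r D0 QM.
have s3 := ler_wpM2l (mulr_ge0 th0 (ltW mu0)) far.
by move: s1 s2 s3; lra.
Qed.

End Minimizer.

End AcceleratedConvergence.


(** * The cost of a subproblem as a function of its condition number *)

Section SubproblemCost.
Context {R : realType}.
Implicit Types (q x : R).

Definition subproblem_cost q : R := 1 + Num.sqrt (1 + q) * ln (1 + q).
Local Notation cost := subproblem_cost.

Lemma ln1Dx_ge x : 0 <= x -> x / (1 + x) <= ln (1 + x).
Proof.
move=> x0; have x1 : 0 < 1 + x by rewrite ltr_pwDl.
have xV : 0 < (1 + x)^-1 by rewrite invr_gt0.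
have := @le_ln1Dx R ((1 + x)^-1 - 1).
rewrite (_ : 1 + ((1 + x)^-1 - 1) = (1 + x)^-1); last by ring.
rewrite lnV ?posrE // lerNl => H.
have {}H := H _; apply: le_trans (H _); last by rewrite ltrBrDl addrN.
by rewrite opprB le_eqVlt; apply/orP; left; apply/eqP; field; rewrite gt_eqF.
Qed.

Lemma cost_ge1 q : 0 <= q -> 1 <= cost q.
Proof.
by move=> q0; rewrite lerDl mulr_ge0 ?sqrtr_ge0 // ln_ge0 // lerDl.
Qed.

Lemma cost_mono q q' : 0 <= q -> q <= q' -> cost q <= cost q'.
Proof.
move=> q0 qq'; rewrite lerD2l ler_pM ?sqrtr_ge0 ?ln_ge0 ?lerDl //.
  by rewrite ler_wsqrtr // lerD2l.
by rewrite ler_ln ?posrE ?ltr_pwDl ?(le_trans q0) // lerD2l.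
Qed.

Lemma sqrt_le_cost q : 0 <= q -> Num.sqrt (1 + q) <= 2 * cost q.
Proof.
move=> q0; have s0 := sqrtr_ge0 (1 + q); have l0 : 0 <= ln (1 + q).
  by rewrite ln_ge0 // lerDl.
have [q1|q1] := leP q 1.
  have : Num.sqrt (1 + q) <= 2.
    rewrite -(@ler_pXn2r _ 2) ?nnegrE // sqr_sqrtr ?addr_ge0 //; lra.
  by have := mulr_ge0 s0 l0; rewrite /cost; lra.
have half : 2^-1 <= ln (1 + q).
  apply: le_trans (ln1Dx_ge q0); rewrite ler_pdivlMr ?ltr_pwDl //; lra.
by have := ler_wpM2l s0 half; rewrite /cost; lra.
Qed.

(** The cost grows at most linearly, up to a constant: one square root of [l]
    comes from that of [1 + l * q], and another one bounds [ln l]. *)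
Lemma cost_scale (l : R) q : 1 <= l -> 0 <= q -> cost (l * q) <= 5 * l * cost q.
Proof.
move=> l1 q0; have l0 : 0 < l by exact: lt_le_trans l1.
have q1 : 0 < 1 + q by rewrite ltr_pwDl.
have lq : 1 + l * q <= l * (1 + q) by rewrite mulrDr mulr1 lerD2r.
have lq0 : 0 < 1 + l * q by rewrite ltr_pwDl // mulr_ge0 // ltW.
set r := Num.sqrt l; have r0 : 0 < r by rewrite sqrtr_gt0.
have rr : r * r = l by rewrite -expr2 sqr_sqrtr // ltW.
have r1 : 1 <= r by rewrite -sqrtr1 ler_wsqrtr.
have rl : r <= l by rewrite -rr ler_peMl // ltW.
have h1 : Num.sqrt (1 + l * q) <= r * Num.sqrt (1 + q).
  by rewrite -sqrtrM ?(ltW l0) // ler_wsqrtr.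
have h2 : ln (1 + l * q) <= 2 * r + ln (1 + q).
  apply: (@le_trans _ _ (ln (l * (1 + q)))).
    by rewrite ler_ln ?posrE ?mulr_gt0.
  rewrite lnM ?posrE // lerD2r -rr lnM ?posrE //.
  by have := ltW (ln_sublinear r0); lra.
have s0 := sqrtr_ge0 (1 + q); have c2 := sqrt_le_cost q0.
have ln0 : 0 <= ln (1 + q) by rewrite ln_ge0 // lerDl.
have h3 : cost (l * q) <= 1 + r * Num.sqrt (1 + q) * (2 * r + ln (1 + q)).
  rewrite lerD2l ler_pM ?sqrtr_ge0 ?ln_ge0 ?lerDl // mulr_ge0 //; exact: ltW.
apply: (le_trans h3).
have -> : r * Num.sqrt (1 + q) * (2 * r + ln (1 + q)) =
   2 * (r * r) * Num.sqrt (1 + q) + r * (Num.sqrt (1 + q) * ln (1 + q)) by ring.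
rewrite rr; have h4 := ler_wpM2r (mulr_ge0 s0 ln0) rl.
have h5 := ler_wpM2l (ltW l0) c2.
have cE : cost q = 1 + Num.sqrt (1 + q) * ln (1 + q) by [].
rewrite cE in h5 *; have := mulr_ge0 (ltW l0) (mulr_ge0 s0 ln0).
move: h4 h5 l1; move: (Num.sqrt (1 + q)) (ln (1 + q)) => s t; lra.
Qed.

(** With [w = (1 + q)^(1/4)] the logarithm is bounded by [4 w], which leaves a
    power of [1 + q] smaller than one. *)
Lemma cost_le_pow q w : 0 <= q -> 1 <= w -> 1 + q <= w ^+ 4 -> cost q <= 5 * w ^+ 3.
Proof.
move=> q0 w1 qw; have w0 : 0 < w by exact: lt_le_trans w1.
have h1 : Num.sqrt (1 + q) <= w ^+ 2.
  apply: (le_trans (ler_wsqrtr qw)).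
  have -> : w ^+ 4 = (w ^+ 2) ^+ 2 by rewrite -exprM.
  by rewrite sqrtr_sqr ger0_norm // exprn_ge0 // ltW.
have h2 : ln (1 + q) <= 4 * w.
  apply: (@le_trans _ _ (ln (w ^+ 4))).
    by rewrite ler_ln ?posrE ?exprn_gt0 // ltr_pwDl.
  by rewrite lnXn //; have := ltW (ln_sublinear w0); lra.
have h3 : Num.sqrt (1 + q) * ln (1 + q) <= w ^+ 2 * (4 * w).
  by rewrite ler_pM ?sqrtr_ge0 ?ln_ge0 ?lerDl.
have h4 : 1 <= w ^+ 3 by rewrite exprn_ege1.
by rewrite /cost; move: h3 h4; rewrite !exprS expr0; lra.
Qed.

End SubproblemCost.


(** * One pass with the accelerated method as subroutine *)

Section InnerPass.
Context {R : realType} {d n : nat} (P : problem R d n).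
Variables theta alpha abar bbar sigma : R.
Hypothesis AP : assumptions P.
Hypothesis theta01 : 0 < theta < 1.
Hypothesis abar1 : 1 < abar.
Hypothesis bbar01 : 0 < bbar < 1.
Hypothesis sigma0 : 0 < sigma.

Local Notation g := (pg P).
Local Notation step := (fun st => (step12 P theta alpha abar bbar st).1).

Let theta0 : 0 < theta. Proof. by case/andP: theta01. Qed.
Let abar0 : 0 < abar. Proof. exact: lt_trans abar1. Qed.
Let bbar0 : 0 < bbar. Proof. by case/andP: bbar01. Qed.
Let Lh0 : 0 < Lh P := Lh_gt0 AP.

(** The most expensive step ends a pass: the gradient at [y] takes 4 calls, the
    proximal operator 1, the values of the model at [x] and [y] 3 each, the
    stopping test 4 and the decrease test 4. *)
Lemma step12_calls st : ((step12 P theta alpha abar bbar st).2 <= 19)%N.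
Proof.
rewrite /step12; case: (sub st) => [[mu [e b xb z]]|]; last first.
  by [].
rewrite /inner /bind /=; case: ifP => // _ /=.
by case: ifP => // _; rewrite /finish /=; case: ifP.
Qed.

(** The program in terms of the mathematical notions of the previous part, with
    the computed gradient replaced by the true one. *)
Lemma innerE (s : state1 R d) mu e b (xb z : 'rV[R]_d) :
  let xk := iterate s in
  let y := extrapolate mu e b xb z in
  let x := prox_step P xk mu e y in
  let G := grad (Hbar P xk mu) in
  (inner P theta alpha abar bbar s mu (State2 e b xb z)).1 =
  if majorizes P xk mu e y x then
    if enorm (G x - G y - e *: (x - y)) <= theta * mu * enorm (x - xk) then
      if decrease P theta xk mu x then State12 (State1 x (rho s)) None x
      else State12 (State1 xk (alpha * rho s)) None x
    else State12 s (Some (mu, State2 (bbar * e) (next_weight e mu b) x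
                                (mirror_step mu e b z y x))) x
  else State12 s (Some (mu, State2 (abar * e) b xb z)) x.
Proof.
move=> xk y x G.
pose G' u := (eval_grad_Hbar P xk mu u).1.
have GE : G' = G.
  by apply/funext => u; rewrite /G' eval_grad_HbarE //; exact: (h_differentiable AP).
pose x' := prox e^-1 g (y - e^-1 *: G' y).
have xE : x' = x by rewrite /x' GE.
pose fin := if decrease P theta xk mu x' then State12 (State1 x' (rho s)) None x'
  else State12 (State1 xk (alpha * rho s)) None x'.
have finE : (finish P theta alpha s mu x').1 = fin by rewrite /finish /fin /=; case: ifP.
rewrite -GE -xE -/fin -finE.
pose acc := if enorm (G' x' - G' y - e *: (x' - y)) <= theta * mu * enorm (x' - xk)
  then finish P theta alpha s mu x'
  else ret (State12 s (Some (mu, State2 (bbar * e) (next_weight e mu b) x'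
             (mirror_step mu e b z y x'))) x').
pose rej := ret (State12 s (Some (mu, State2 (abar * e) b xb z)) x').
have accE : acc.1 = if enorm (G' x' - G' y - e *: (x' - y))
     <= theta * mu * enorm (x' - xk) then (finish P theta alpha s mu x').1
  else State12 s (Some (mu, State2 (bbar * e) (next_weight e mu b) x'
             (mirror_step mu e b z y x'))) x'.
  by rewrite /acc; case: ifP.
rewrite -accE.
transitivity ((if Hbar P xk mu x' <= Hbar P xk mu y + dotp (G' y) (x' - y)
    + e / 2 * enorm (x' - y) ^+ 2
  then bind (eval_grad_Hbar P xk mu x') (fun=> acc) else rej).1); first by [].
rewrite /majorizes -/G -GE; case: ifP => _ //.
Qed.

Section Pass.
Variables (s : state1 R d) (mu : R) (u : 'rV[R]_d).
Hypothesis mu0 : 0 < mu.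
Local Notation xk := (iterate s).
Hypothesis gxk : dom g xk.
Hypothesis Js : opnorm ('J (pc P) xk) <= sigma.
Hypothesis gu : dom g u.
Hypothesis umin : forall w, dom g w -> model P xk mu u <= model P xk mu w.

(* [M] bounds [eta], [1 + k] is the growth factor of [b], [Q^2] is the value of
   [mu b] from which [stopping_test] applies, and [T1] bounds the number of
   accepted steps. *)
Local Notation q := (Lh P * sigma ^+ 2 / mu).
Local Notation M := (abar * (Lh P * sigma ^+ 2 + mu)).
Local Notation k := (Num.sqrt (mu / M)).
Local Notation Q := (4 * (1 + abar) / theta * (1 + q)).
Local Notation T1 := (2 + 2 / k * ln (Q ^+ 2 * M / mu)).

Let A0 : 0 < Lh P * sigma ^+ 2. Proof. by rewrite mulr_gt0 ?exprn_gt0. Qed.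
Let L0 : 0 < Lh P * sigma ^+ 2 + mu. Proof. by rewrite addr_gt0. Qed.
Let M0 : 0 < M. Proof. by rewrite mulr_gt0. Qed.
Let q0 : 0 < q. Proof. by rewrite divr_gt0. Qed.
Let k0 : 0 < k. Proof. by rewrite sqrtr_gt0 divr_gt0. Qed.

Let muM : mu <= M.
Proof.
apply: (@le_trans _ _ (Lh P * sigma ^+ 2 + mu)); first by rewrite lerDr ltW.
by rewrite ler_peMl // ltW.
Qed.

Let k1 : k <= 1.
Proof. by rewrite -sqrtr1 ler_wsqrtr // ler_pdivrMr // mul1r. Qed.

Let Mq : M = abar * mu * (1 + q).
Proof. by field; rewrite gt_eqF. Qed.

Let Q8 : 8 <= Q.
Proof.
have th1 : theta < 1 by case/andP: theta01.
have h : 8 <= 4 * (1 + abar) / theta.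
  rewrite ler_pdivlMr //; have := abar1; have := theta0; nra.
by apply: (le_trans h); rewrite ler_peMr ?lerDl ?(ltW q0) // (le_trans _ h).
Qed.

Let lnQ : 0 <= ln (Q ^+ 2 * M / mu).
Proof.
apply: ln_ge0; rewrite -mulrA; apply: mulr_ege1.
  by rewrite exprn_ege1 // (le_trans _ Q8) //; lra.
by rewrite ler_pdivlMr // mul1r.
Qed.

(** The counters are [t] for accepted steps and [N] for all steps.  The last
    field is the balance of [ln eta], which grows by [ln abar] at a rejection and
    changes by [ln bbar] at an acceptance. *)
Record inner_invariant (t N : nat) (s2 : state2 R d) : Prop := InnerInvariant {
  inv_eta0 : 0 < eta s2;
  inv_etaM : eta s2 <= M;
  inv_b0 : 0 <= bb s2;
  inv_dom : dom g (xbar s2);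
  inv_potential : potential P xk mu u (bb s2) (xbar s2) (zz s2)
                    <= enorm (xk - u) ^+ 2 / 2;
  inv_first : t = 0%N -> bb s2 = 0;
  inv_growth : (0 < t)%N -> M^-1 * (1 + k) ^+ t.-1 <= bb s2;
  inv_accepted : t%:R <= T1;
  inv_steps : (N%:R - t%:R) * ln abar <= t%:R * - ln bbar + ln (eta s2 / (abar * mu)) }.

Lemma inner_invariant_init : inner_invariant 0 0 (State2 (abar * mu) 0 xk xk).
Proof.
split=> //=.
- by rewrite mulr_gt0.
- by rewrite ler_pM2l // lerDr ltW.
- by rewrite /potential mul0r mulr0 addr0 add0r mulrC mul1r.
- by rewrite addr_ge0 // mulr_ge0 // divr_ge0 // ltW.
- by rewrite subrr !mul0r add0r divff ?ln1 // gt_eqF // mulr_gt0.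
Qed.

Definition pass_end (st : state12 R d) : Prop :=
  [/\ sub st = None, dom g (last_xbar st), Sset P theta xk mu (last_xbar st) &
   (decrease P theta xk mu (last_xbar st) /\
      outer st = State1 (last_xbar st) (rho s)) \/
   (~~ decrease P theta xk mu (last_xbar st) /\
      outer st = State1 xk (alpha * rho s))].

Lemma majorizes_large_eta e y x : Lh P * sigma ^+ 2 + mu <= e ->
  majorizes P xk mu e y x.
Proof.
move=> eL; rewrite /majorizes.
have := Hbar_smooth AP mu y x Js.
have : (Lh P * sigma ^+ 2 + mu) / 2 * enorm (x - y) ^+ 2 <= e / 2 * enorm (x - y) ^+ 2.
  by rewrite ler_wpM2r ?sqr_ge0 // ler_pM2r ?invr_gt0.
lra.
Qed.

Lemma stopped_Sset e y : 0 < e ->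
  let x := prox_step P xk mu e y in
  enorm (grad (Hbar P xk mu) x - grad (Hbar P xk mu) y - e *: (x - y))
    <= theta * mu * enorm (x - xk) -> Sset P theta xk mu x.
Proof.
move=> e0 x le; split; first exact: (prox_step_dom AP _ _ _ e0).
apply: (residual_le (prox_step_subdiff AP xk mu y e0)).
apply: le_trans le; rewrite -/x.
have -> // : e *: (y - x) - grad (Hbar P xk mu) y + grad (Hbar P xk mu) x =
   grad (Hbar P xk mu) x - grad (Hbar P xk mu) y - e *: (x - y).
by rewrite -scalerN opprB; move: (grad _ x) (grad _ y) (e *: _) => a c v; 
   rewrite addrC [v - c]addrC addrA.
Qed.

(** A test of the stopping rule that fails bounds the number of accepted steps,
    because [b] grows geometrically while it must stay below [Q^2 / mu]. *)
Lemma accepted_bound t b : (0 < t)%N -> M^-1 * (1 + k) ^+ t.-1 <= b ->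
  mu * b < Q ^+ 2 -> t.+1%:R <= T1.
Proof.
case: t => // t _ /= gr lt.
have k10 : 0 < 1 + k by rewrite addr_gt0.
have h : (1 + k) ^+ t <= Q ^+ 2 * M / mu.
  rewrite ler_pdivlMr //; rewrite ler_pdivrMl // in gr.
  apply: (le_trans (ler_wpM2r (ltW mu0) gr)).
  have -> : M * b * mu = (mu * b) * M by ring.
  by rewrite ler_pM2r // ltW.
have {}h : t%:R * ln (1 + k) <= ln (Q ^+ 2 * M / mu).
  rewrite mulr_natl -lnXn // ler_ln ?posrE ?exprn_gt0 //.
  exact: lt_le_trans (exprn_gt0 _ k10) h.
have kl : k / 2 <= ln (1 + k).
  apply: le_trans (ln1Dx_ge (ltW k0)); rewrite ler_pM2l // lef_pV2 ?posrE //.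
  by have := k1; lra.
have {kl} := ler_wpM2l (ler0n R t) kl => /le_trans/(_ h).
move: (ln _) => l le; rewrite -[t.+2]addn2 natrD addrC lerD2l.
rewrite mulrAC ler_pdivlMr //; lra.
Qed.

Lemma inner_step t N s2 : inner_invariant t N s2 ->
  let st := (inner P theta alpha abar bbar s mu s2).1 in
  pass_end st \/ exists t' s2' x, st = State12 s (Some (mu, s2')) x /\
     inner_invariant t' N.+1 s2'.
Proof.
case: s2 => e b xb z inv st; rewrite {}/st innerE.
case: inv => /= e0 eM b0 gx pot first growth acc steps.
set y := extrapolate mu e b xb z; set x := prox_step P xk mu e y.
have gx' : dom g x := prox_step_dom AP _ _ _ e0.
have abar_mu : 0 < abar * mu by rewrite mulr_gt0.
case: ifPn => [maj|rej] /=; last first.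
  right; exists t, (State2 (abar * e) b xb z), x; split=> //.
  have eL : e < Lh P * sigma ^+ 2 + mu.
    by rewrite ltNge; apply: contra rej; exact: majorizes_large_eta.
  split=> //=; first by rewrite mulr_gt0.
    by rewrite ler_pM2l // ltW.
  rewrite -mulrA lnM ?posrE ?divr_gt0 //; rewrite -natr1.
  by move: steps; move: (ln (e / _)) => l; lra.
case: ifPn => [stop|nostop].
  left; have Sx := stopped_Sset e0 stop.
  by case: ifPn => dec; split=> //=; [left|right].
right; have em : mu < e.
  rewrite ltNge; apply: contra nostop => em.
  rewrite (majorizes_small_eta AP em maj) enorm0.
  by rewrite !mulr_ge0 ?enorm_ge0 // ltW.
exists t.+1, (State2 (bbar * e) (next_weight e mu b) x (mirror_step mu e b z y x)), x.
split=> //; have bb' := next_weight_gt mu0 em b0.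
split=> //=.
- by rewrite mulr_gt0.
- apply: le_trans eM; rewrite ler_piMl // ltW //; by case/andP: bbar01.
- exact: le_trans b0 (ltW bb').
- exact: le_trans (potential_decrease AP mu0 em b0 gx gu maj) pot.
- move=> _; case: t first growth {acc steps} => [b00 _|t _ gr].
    by rewrite expr0 mulr1 next_weight_init // b00.
  apply: le_trans (next_weight_growth mu0 em b0 eM).
  have -> : M^-1 * (1 + k) ^+ t.+1 = (1 + k) * (M^-1 * (1 + k) ^+ t).
    by rewrite [_ ^+ t.+1]exprS mulrCA.
  by apply: ler_wpM2l; [rewrite addr_ge0 // ltW | exact: gr].
- case: t first growth {acc steps} => [_ _|t _ gr].
    have := mulr_ge0 (_ : 0 <= 2 / k) lnQ; rewrite divr_ge0 ?(ltW k0) // => /(_ isT).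
    by move: (ln _) => l; lra.
  apply: (@accepted_bound _ b) => //; first exact: gr.
  rewrite ltNge; apply: contra nostop => Qb.
  apply: (stopping_test AP mu0 gu umin (ltW theta0) em b0 gx eM _ Qb Js _ pot) => //.
    by apply: lt_le_trans Q8.
  have -> : theta * mu * (Q - 1) = 4 * mu * (1 + abar) * (1 + q) - theta * mu.
    by field; rewrite !gt_eqF.
  have -> : Lh P * sigma ^+ 2 + mu + M = (1 + abar) * (mu * (1 + q)).
    by field; rewrite gt_eqF.
  have X0 : mu <= mu * (1 + q) by rewrite ler_peMr ?(ltW mu0) // lerDl ltW.
  have X1 : mu * (1 + q) <= (1 + abar) * (mu * (1 + q)).
    by rewrite ler_peMl ?lerDl ?(ltW abar0) // (le_trans (ltW mu0)).
  have th1 : theta * mu <= mu by rewrite ler_piMl ?(ltW mu0) // ltW //; case/andP: theta01.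
  have X2 : theta * mu <= 2 * ((1 + abar) * (mu * (1 + q))).
    apply: (le_trans th1); apply: (le_trans X0); apply: (le_trans X1).
    by rewrite ler_peMl ?ler1n // (le_trans _ X1) // (le_trans _ X0) // ltW.
  by move: X2; move: (q) (theta * mu) => r tm; lra.
- have -> : bbar * e / (abar * mu) = bbar * (e / (abar * mu)) by rewrite mulrA.
  rewrite lnM ?posrE ?divr_gt0 //; rewrite -natr1 -[t.+1%:R]natr1.
  by move: steps; move: (ln (e / _)) => l; lra.
Qed.

(** The first factor bounds the number of accepted steps per unit of cost; the
    rest adds the rejected ones through the balance of [ln eta]. *)
Definition pass_const : R :=
  let lb := - ln bbar in
  (2 + Num.sqrt abar * (4 * ln ((4 * (1 + abar) / theta) ^+ 2 * abar) + 6))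
    * (ln abar + lb) / ln abar + 1 / ln abar.

Let la0 : 0 < ln abar. Proof. exact: ln_gt0. Qed.
Let lb0 : 0 <= - ln bbar. Proof. by rewrite oppr_ge0 ln_le0 // ltW //; case/andP: bbar01. Qed.

Let c1E : Q ^+ 2 * M / mu = (4 * (1 + abar) / theta) ^+ 2 * abar * (1 + q) ^+ 3.
Proof. by rewrite Mq; field; rewrite !gt_eqF. Qed.

Let c1_ge1 : 1 <= (4 * (1 + abar) / theta) ^+ 2 * abar.
Proof.
apply: mulr_ege1; last exact: ltW.
rewrite exprn_ege1 // ler_pdivlMr // mul1r.
have := abar1; case/andP: theta01 => _; lra.
Qed.

Lemma inner_steps_le t N s2 : inner_invariant t N s2 ->
  N%:R <= pass_const * subproblem_cost q.
Proof.
case=> e0 eM _ _ _ _ _ acc steps.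
have cost1 := cost_ge1 (ltW q0).
have q1 : 0 < 1 + q by rewrite addr_gt0.
have q1' : 1 <= 1 + q by rewrite lerDl; exact: ltW.
have s0 := sqrtr_ge0 (1 + q); have l0 : 0 <= ln (1 + q) by exact: ln_ge0.
have csq := sqrt_le_cost (ltW q0).
have costE : subproblem_cost q = 1 + Num.sqrt (1 + q) * ln (1 + q) by [].
have s1 : 1 <= Num.sqrt (1 + q) by rewrite -[leLHS]sqrtr1 ler_wsqrtr.
have kE : 2 / k = 2 * (Num.sqrt abar * Num.sqrt (1 + q)).
  congr (2 * _); rewrite -sqrtrM ?(ltW abar0) // -sqrtrV; last first.
    by rewrite divr_ge0 // ltW.
  by congr Num.sqrt; rewrite invf_div Mq; field; rewrite gt_eqF.
have lnE : ln (Q ^+ 2 * M / mu) =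
    ln ((4 * (1 + abar) / theta) ^+ 2 * abar) + 3 * ln (1 + q).
  rewrite c1E lnM ?posrE ?exprn_gt0 //; last exact: lt_le_trans c1_ge1.
  by rewrite lnXn // -[_ *+ 3]mulr_natl.
have lne : ln (eta s2 / (abar * mu)) <= ln (1 + q).
  rewrite ler_ln ?posrE ?divr_gt0 ?mulr_gt0 // ler_pdivrMr ?mulr_gt0 //.
  by apply: (le_trans eM); rewrite Mq mulrC.
move: acc; rewrite kE lnE => acc; rewrite /pass_const.
have c10 : 0 <= ln ((4 * (1 + abar) / theta) ^+ 2 * abar) by rewrite ln_ge0.
have sa0 := sqrtr_ge0 abar.
move: cost1 csq costE s0 l0 s1 lne acc steps c10 sa0.
move: (subproblem_cost q) (Num.sqrt (1 + q)) (ln (1 + q)) (Num.sqrt abar) => G r l ra.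
move: (ln (eta s2 / _)) (ln (_ ^+ 2 * abar)) => le c1.
move: la0 lb0; move: (ln abar) (- ln bbar) => la lb la_gt0 lb_ge0.
move=> G1 rG GE r0 l_ge0 r1 lel tT NT c10 ra0.
have tG : t%:R <= (2 + ra * (4 * c1 + 6)) * G.
  have h1 := ler_wpM2l (mulr_ge0 ra0 c10) rG.
  have h2 : r * l <= G by lra.
  have h3 := ler_wpM2l ra0 h2.
  by lra.
have lG : l <= G by have := ler_wpM2r l_ge0 r1; lra.
have h4 := ler_wpM2r (addr_ge0 (ltW la_gt0) lb_ge0) tG.
have -> : ((2 + ra * (4 * c1 + 6)) * (la + lb) / la + 1 / la) * G =
   ((2 + ra * (4 * c1 + 6)) * G * (la + lb) + G) / la by ring.
by rewrite ler_pdivlMr //; lra.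
Qed.

Lemma pass_terminates st : sub st = None -> outer st = s -> Delta P xk != 0 ->
  mu = rho s * Num.sqrt (Delta P xk) ->
  exists2 m : nat, m%:R <= pass_const * subproblem_cost q + 2 & pass_end (iter m step st).
Proof.
move=> st0 sts D0 muE.
have run N : (exists2 m : nat, (m <= N.+1)%N & pass_end (iter m step st)) \/
    exists t s2 x, iter N.+1 step st = State12 s (Some (mu, s2)) x /\
      inner_invariant t N s2.
  elim: N => [|N [[m mN me]|[t [s2 [x [stE inv]]]]]].
  - right; exists 0%N, (State2 (abar * mu) 0 xk xk), xk; split; last first.
      exact: inner_invariant_init.
    rewrite /= /step12 st0 sts /start /=.
    by rewrite -/(F P xk) -/(Delta P xk) (negbTE D0) -muE.
  - by left; exists m => //; exact: leqW.
  - rewrite iterS stE; case: (inner_step inv) => [pe|[t' [s2' [x' [E inv']]]]].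
      by left; exists N.+2; rewrite // iterS stE.
    by right; exists t', s2', x'.
pose N0 := Num.truncn (pass_const * subproblem_cost q).
case: (run N0.+1) => [[m mN me]|[t [s2 [x [_ inv]]]]]; last first.
  have := inner_steps_le inv; rewrite leNgt => /negP[]; exact: truncnS_gt.
exists m => //; rewrite (le_trans (_ : _ <= N0.+2%:R)) ?ler_nat //.
rewrite -addn2 natrD lerD2r truncn_le.
exact: inner_steps_le inner_invariant_init.
Qed.



End Pass.

(** A subproblem with a tiny [mu] is too ill conditioned for the bound on its
    cost to be of use.  There the first trial points, which are proximal steps
    from [xk] with increasing [eta], already have a small residual: the distance
    to [xk] of an accepted one is controlled by [sqrt Delta / rho], and that of
    a rejected one decreases geometrically with the number of trials, at a rate
    that does not depend on [Delta]. *)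
Section SmallDelta.
Variables (s : state1 R d) (rmin : R).
Local Notation xk := (iterate s).
Local Notation v := (Num.sqrt (Delta P xk)).
Local Notation mu := (rho s * v).
Local Notation kappa := (sigma * Num.sqrt (2 * Lh P)).
Hypothesis gxk : dom g xk.
Hypothesis Js : opnorm ('J (pc P) xk) <= sigma.
Hypothesis Dpos : 0 < Delta P xk.
Hypothesis rmin0 : 0 < rmin.
Hypothesis rhomin : rmin <= rho s.

Let rho0 : 0 < rho s. Proof. exact: lt_le_trans rhomin. Qed.
Let v0 : 0 < v. Proof. by rewrite sqrtr_gt0. Qed.
Let mu0 : 0 < mu. Proof. exact: mulr_gt0. Qed.
Let vv : v ^+ 2 = Delta P xk. Proof. by rewrite sqr_sqrtr // ltW. Qed.

Lemma grad_H_le : enorm (grad (H P) xk) <= kappa * v.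
Proof.
rewrite (grad_H AP); apply: (le_trans (enorm_mulmx_tr_le _ _)).
rewrite -mulrA -sqrtrM ?mulr_ge0 ?(ltW Lh0) //.
apply: ler_pM => //; rewrite ?opnorm_ge0 ?enorm_ge0 //.
exact/(enorm_gradh_le AP)/(h_le_Delta AP).
Qed.

Lemma accepted_trial_near e : mu <= e ->
  majorizes P xk mu e xk (prox_step P xk mu e xk) ->
  enorm (prox_step P xk mu e xk - xk) ^+ 2 <= 2 * v / rho s.
Proof.
move=> mue maj; have e0 : 0 < e by exact: lt_le_trans mue.
have := prox_step_descent AP e0 gxk maj.
have gx := prox_step_dom AP xk mu xk e0.
rewrite subrr dotpC dotp0l enorm0 expr0n /= !mulr0 !addr0 enormB.
have lo : gstar P + hstar P <= model P xk mu (prox_step P xk mu e xk).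
  apply: lerD; first exact: (gstar_le_fine AP gx).
  rewrite /Hbar ler_wpDr ?(hstar_le_h AP) //.
  by rewrite mulr_ge0 ?sqr_ge0 // divr_ge0 // ltW.
rewrite {2}/model Hbar_center => desc.
have {lo desc} : e / 2 * enorm (prox_step P xk mu e xk - xk) ^+ 2 <= v ^+ 2.
  have -> : v ^+ 2 = fine (g xk) + H P xk - (gstar P + hstar P).
    by rewrite vv (DeltaE AP).
  rewrite lerBrDl.
  exact: le_trans (lerD lo (lexx _)) desc.
move: (sqr_ge0 (enorm (prox_step P xk mu e xk - xk))); move: (_ ^+ 2) => r r0 le.
rewrite ler_pdivlMr // -(ler_pM2r v0).
have := ler_wpM2r r0 mue; rewrite expr2 in le.
by move: le; move: (rho s) (v) => ? ?; lra.
Qed.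

(** Only the subgradient inequality at [xk] is available for a trial point that
    may fail the test on [eta]; it bounds [l rho |x - xk|^2] by
    [sqrt Delta + kappa |x - xk|]. *)
Lemma trial_near (l : R) : 1 <= l ->
  enorm (prox_step P xk mu (l * mu) xk - xk) ^+ 2
    <= 2 * v / rho s + (kappa / (l * rho s)) ^+ 2.
Proof.
move=> l1; have l0 : 0 < l by exact: lt_le_trans l1.
have e0 : 0 < l * mu by rewrite mulr_gt0.
have sub := prox_step_subdiff AP xk mu xk e0.
have gx := subdiff_dom (g_proper AP) sub.
have := subdiff_le (g_proper AP) sub gxk.
have lo := gstar_le_fine AP gx; have hi := g_le_Delta AP gxk.
rewrite -vv in hi; rewrite (grad_Hbar_center AP) dotpDl dotpZl dotpNl -enorm_sqr enormB.
set x := prox_step _ _ _ _ _ in lo *.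
have := le_trans (dotp_le (grad (H P) xk) (xk - x)) (ler_wpM2r (enorm_ge0 _) grad_H_le).
rewrite (enormB xk x); move: (dotp _ _) => dp.
have r0 := enorm_ge0 (x - xk); move: (enorm (x - xk)) r0 => r r0 h1 h2.
have k0 : 0 <= kappa by rewrite mulr_ge0 ?sqrtr_ge0 // ltW.
have {h1 h2 lo hi} : l * rho s * r ^+ 2 <= v + kappa * r.
  rewrite -(ler_pM2r v0); move: h1 h2 lo hi.
  move: (fine (g xk)) (fine (g x)) (rho s) (v) (kappa) => ? ? ? ? ?; lra.
have lr0 : 0 < l * rho s by rewrite mulr_gt0.
move: (kappa) k0 (v) v0 => k k0 w w0 h.
have sq := sqr_ge0 (l * rho s * r - k).
have wl : w / (l * rho s) <= w / rho s.
  by rewrite ler_pM2l // lef_pV2 ?posrE // ler_peMl // ltW.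
have h' : r ^+ 2 <= 2 * (w / (l * rho s)) + (k / (l * rho s)) ^+ 2.
  move: (l * rho s) lr0 h sq => c c0 h sq.
  rewrite -(ler_pM2l (exprn_gt0 2 c0)).
  have -> : c ^+ 2 * (2 * (w / c) + (k / c) ^+ 2) = 2 * (w * c) + k ^+ 2.
    by field; rewrite gt_eqF.
  have := ler_wpM2l (ltW c0) h; lra.
by apply: (le_trans h'); lra.
Qed.

Local Notation Lip := (Lc P * (Num.sqrt (2 * Lh P * Delta P xk)
      + Lh P * (sigma + Lc P / 2)) + sigma * Lh P * (sigma + Lc P / 2)).

Let Lip0 : 0 <= Lip.
Proof.
have Lc0 := ltW (Lc_gt0 AP).
have sL : 0 <= sigma + Lc P / 2 by rewrite addr_ge0 ?(ltW sigma0) // divr_ge0.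
apply: addr_ge0; last by rewrite !mulr_ge0 // ltW.
by rewrite mulr_ge0 // addr_ge0 ?sqrtr_ge0 // mulr_ge0 // ltW.
Qed.

Lemma trial_omega e : 0 < e ->
  enorm (prox_step P xk mu e xk - xk) <= 1 ->
  (omega P (prox_step P xk mu e xk)
     <= ((Lip + e) * enorm (prox_step P xk mu e xk - xk))%:E)%E.
Proof.
move=> e0 r1; have sub := prox_step_subdiff AP xk mu xk e0.
have gx := subdiff_dom (g_proper AP) sub.
apply: (residual_le sub); rewrite (grad_Hbar_center AP).
rewrite -addrA [- _ + _]addrC; apply: (le_trans (ler_enormD _ _)).
rewrite enormZ gtr0_norm // (enormB xk) [leRHS]mulrDl [leRHS]addrC.
by rewrite lerD2l; exact: (grad_H_near AP gxk gx Js r1).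
Qed.

Lemma small_Delta_pass (eps delta : R) st : sub st = None -> outer st = s ->
  0 < eps <= 1 -> 0 < delta <= 1 ->
  (Lip + abar * (Lh P * sigma ^+ 2 + mu)) * delta <= 1 ->
  v <= rmin * (delta * eps) ^+ 2 / 4 ->
  exists m : nat, [/\ m%:R <= 2 * kappa / (rmin * delta * (abar - 1) * eps) + 2,
     dom g (last_xbar (iter m step st)) &
     (omega P (last_xbar (iter m step st)) <= eps%:E)%E].
Proof.
move=> st0 sts /andP[e0 e1] /andP[d0 d1] LM vsmall.
set M : R := abar * (Lh P * sigma ^+ 2 + mu) in LM.
have de0 : 0 < delta * eps by rewrite mulr_gt0.
have de1 : delta * eps <= 1 by rewrite mulr_ile1 // ltW.
have good e : 0 < e -> e <= M ->
    enorm (prox_step P xk mu e xk - xk) ^+ 2 <= (delta * eps) ^+ 2 ->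
    (omega P (prox_step P xk mu e xk) <= eps%:E)%E.
  move=> ep eM; rewrite ler_pXn2r ?nnegrE ?enorm_ge0 ?(ltW de0) // => rle.
  have r1 := le_trans rle de1.
  apply: (le_trans (trial_omega ep r1)); rewrite lee_fin.
  have Le0 : 0 <= Lip + e by rewrite addr_ge0 // ltW.
  apply: (le_trans (ler_wpM2l Le0 rle)); rewrite mulrA ler_piMl ?(ltW e0) //.
  by apply: le_trans LM; rewrite ler_wpM2r ?(ltW d0) // lerD2l.
have vr : 2 * v / rho s <= (delta * eps) ^+ 2 / 2.
  rewrite ler_pdivrMr //; have := ler_wpM2r (sqr_ge0 (delta * eps)) rhomin.
  move: vsmall; move: (v) (_ ^+ 2) => w t; lra.
pose B : R := 2 * kappa / (rmin * delta * (abar - 1) * eps).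
have a10 : 0 < abar - 1 by rewrite subr_gt0.
have k0 : 0 <= kappa by rewrite mulr_ge0 ?sqrtr_ge0 // ltW.
have c0 : 0 < rmin * delta * (abar - 1) * eps by rewrite !mulr_gt0.
have B0 : 0 <= B by rewrite divr_ge0 ?(ltW c0) // mulr_ge0.
have run N : (exists m : nat, [/\ (m <= N.+1)%N,
      dom g (last_xbar (iter m step st)) &
      (omega P (last_xbar (iter m step st)) <= eps%:E)%E]) \/
   exists x, iter N.+1 step st =
       State12 s (Some (mu, State2 (abar ^+ N.+1 * mu) 0 xk xk)) x /\
     (abar ^+ N.+1 * mu <= M /\
      ((0 < N)%N -> x = prox_step P xk mu (abar ^+ N * mu) xk)).
  elim: N => [|N [[m [mN gm om]]|[x [stE [eM _]]]]].
  - right; exists xk; rewrite /= /step12 st0 sts /start /=.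
    rewrite -/(F P xk) -/(Delta P xk) gt_eqF // expr1; split=> //; split=> //.
    by rewrite /M ler_pM2l // lerDr mulr_ge0 ?sqr_ge0 // ltW.
  - by left; exists m; split=> //; exact: leqW.
  have ep : 0 < abar ^+ N.+1 * mu by rewrite mulr_gt0 ?exprn_gt0.
  have mue : mu <= abar ^+ N.+1 * mu.
    by rewrite ler_peMl ?(ltW mu0) // exprn_ege1 // ltW.
  have yE : extrapolate mu (abar ^+ N.+1 * mu) 0 xk xk = xk.
    by rewrite /extrapolate subrr scaler0 addr0.
  have := innerE s mu (abar ^+ N.+1 * mu) 0 xk xk; rewrite yE => iE.
  have stE' : iter N.+2 step st = (inner P theta alpha abar bbar s mu
      (State2 (abar ^+ N.+1 * mu) 0 xk xk)).1 by rewrite iterS stE.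
  case maj : (majorizes P xk mu (abar ^+ N.+1 * mu) xk
      (prox_step P xk mu (abar ^+ N.+1 * mu) xk)).
    have om : (omega P (prox_step P xk mu (abar ^+ N.+1 * mu) xk) <= eps%:E)%E.
      apply: good => //; apply: (le_trans (accepted_trial_near mue maj)).
      by have := sqr_ge0 (delta * eps); lra.
    have gx := prox_step_dom AP xk mu xk ep.
    have lE : last_xbar (iter N.+2 step st) = prox_step P xk mu (abar ^+ N.+1 * mu) xk.
      by rewrite stE' iE maj; case: ifP => _; [case: ifP|].
    left; exists N.+2; rewrite lE.
    exact: (And3 (leqnn _) gx om).
  right; exists (prox_step P xk mu (abar ^+ N.+1 * mu) xk).
  have eE : abar ^+ N.+2 * mu = abar * (abar ^+ N.+1 * mu) by rewrite exprS -mulrA.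
  rewrite stE' iE maj eE; split; first by []; split; last by [].
  rewrite /M ler_pM2l // leNgt; apply/negP => lt; move/negP: maj; apply.
  exact: (majorizes_large_eta Js _ _ (ltW lt)).
pose N0 := Num.truncn B.
have mB (m : nat) : (m <= N0.+2)%N -> m%:R <= B + 2.
  move=> mN; rewrite (le_trans (_ : _ <= N0.+2%:R)) ?ler_nat //.
  by rewrite -addn2 natrD lerD2r truncn_le.
case: (run N0.+1) => [[m [mN gm om]]|[x [stE [eM xE]]]].
  by exists m; split=> //; exact: mB.
have ep : 0 < abar ^+ N0.+1 * mu by rewrite mulr_gt0 ?exprn_gt0.
exists N0.+2; rewrite stE /= xE //; split; first exact: mB.
  exact: (prox_step_dom AP _ _ _ ep).
apply: good => //.
  apply: le_trans eM; rewrite [abar ^+ N0.+2]exprS -mulrA ler_peMl ?(ltW ep) //.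
  exact: ltW.
have l1 : 1 <= abar ^+ N0.+1 by rewrite exprn_ege1 // ltW.
apply: (le_trans (trial_near l1)).
have bern := bernoulli_inequality N0.+1 (ltW a10).
rewrite (_ : 1 + (abar - 1) = abar) in bern; last by ring.
have l0 : 0 < abar ^+ N0.+1 by rewrite exprn_gt0.
(* [N0] was chosen so that this geometric factor exceeds [2 kappa / (rmin delta eps)]. *)
have kl : kappa / (abar ^+ N0.+1 * rho s) <= delta * eps / 2.
  rewrite ler_pdivrMr ?mulr_gt0 //.
  have BN : B < N0.+1%:R := truncnS_gt B.
  rewrite ltr_pdivrMr // in BN.
  have h1 : N0.+1%:R * (abar - 1) <= abar ^+ N0.+1 by lra.
  have h2 := ler_wpM2r (ltW (mulr_gt0 rmin0 de0)) h1.
  have h3 := ler_wpM2l (ltW (mulr_gt0 l0 de0)) rhomin.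
  by move: BN h2 h3; move: (kappa) (abar ^+ _) => k l; lra.
have kl0 : 0 <= kappa / (abar ^+ N0.+1 * rho s).
  by rewrite divr_ge0 // mulr_ge0 // ltW.
have := ler_pM kl0 kl0 kl kl; rewrite -expr2.
have := sqr_ge0 (delta * eps); move: (_ / (_ * rho s)) vr => k vr; lra.
Qed.

End SmallDelta.

End InnerPass.


(** * Oracle complexity *)

(** The fourth root of [eps] turns all the powers of [eps] met below into
    integer ones. *)
Lemma near0_fourth_root (R : realType) (M b : R) : 0 < b ->
  \forall eps \near 0^'+, 0 < eps < 1 /\ M * Num.sqrt (Num.sqrt eps) < b.
Proof.
move=> b0; have M1 : 0 < `|M| + 1 by rewrite ltr_wpDl.
pose c := b / (`|M| + 1); have c0 : 0 < c by rewrite divr_gt0.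
near=> eps.
have e0 : 0 < eps by near: eps; exact: nbhs_right_gt.
split; first by rewrite e0; near: eps; exact: nbhs_right_lt.
apply: (@le_lt_trans _ _ ((`|M| + 1) * Num.sqrt (Num.sqrt eps))).
  by rewrite ler_wpM2r ?sqrtr_ge0 // (le_trans (ler_norm M)) // lerDl.
rewrite mulrC -ltr_pdivlMr // -/c.
have -> : c = Num.sqrt (Num.sqrt (c ^+ 4)).
  have -> : c ^+ 4 = (c ^+ 2) ^+ 2 by rewrite -exprM.
  rewrite sqrtr_sqr ger0_norm; last exact: sqr_ge0.
  by rewrite sqrtr_sqr ger0_norm // ltW.
rewrite !ltr_sqrt ?sqrtr_gt0 ?exprn_gt0 //.
by near: eps; apply: nbhs_right_lt; rewrite exprn_gt0.
Unshelve. all: by end_near. Qed.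

Section OracleRun.
Context {R : realType} {d n : nat} (P : problem R d n).
Variables (theta alpha abar bbar rho_min sigma : R) (x0 : 'rV[R]_d).
Hypothesis AP : assumptions P.
Hypothesis theta01 : 0 < theta < 1.
Hypothesis alpha1 : 1 < alpha.
Hypothesis abar1 : 1 < abar.
Hypothesis bbar01 : 0 < bbar < 1.
Hypothesis gx0 : dom (pg P) x0.
Hypothesis rho_min0 : 0 < rho_min.
Hypothesis sigma0 : 0 < sigma.
Local Notation run := (run12 P theta alpha abar bbar rho_min x0).
Hypothesis sJ : forall j, opnorm ('J (pc P) (iterate (outer (run j).1))) <= sigma.

Local Notation step := (fun st => (step12 P theta alpha abar bbar st).1).
Local Notation Cp := (pass_const theta abar bbar + 2).
Local Notation cost := subproblem_cost.
Local Notation rmax := (rho_max P theta alpha rho_min).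
Local Notation K := (rmax + Lc P ^+ 2 * Lh P / rho_min).
Local Notation kap := ((1 - theta) * rho_min / (4 * (sigma * Lh P * Lc P))).
Local Notation A := (Lh P * sigma ^+ 2).

Let Lh0 : 0 < Lh P := Lh_gt0 AP.
Let Lc0 : 0 < Lc P := Lc_gt0 AP.
Let A0 : 0 < A. Proof. by rewrite mulr_gt0 ?exprn_gt0. Qed.
Let theta1 : 0 < 1 - theta. Proof. by case/andP: theta01; rewrite subr_gt0. Qed.

Lemma run12_iter i m : (run (i + m)).1 = iter m step (run i).1.
Proof. by elim: m => [|m IH]; rewrite ?addn0 // addnS /= IH. Qed.

Lemma run12_calls j : ((run j).2 <= 19 * j)%N.
Proof.
elim: j => // j IH /=; rewrite mulnS addnC leq_add //.
exact: step12_calls.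
Qed.

Lemma pass_const_ge0 : 0 <= pass_const theta abar bbar.
Proof.
have la : 0 < ln abar by exact: ln_gt0.
have lb : 0 <= - ln bbar by rewrite oppr_ge0 ln_le0 // ltW //; case/andP: bbar01.
case/andP: theta01 => t0 t1.
have c1 : 0 <= ln ((4 * (1 + abar) / theta) ^+ 2 * abar).
  apply: ln_ge0; apply: mulr_ege1; last exact: ltW.
  by rewrite exprn_ege1 // ler_pdivlMr // mul1r; have := abar1; lra.
rewrite /pass_const addr_ge0 ?divr_ge0 ?(ltW la) //.
apply: mulr_ge0; last by rewrite addr_ge0 // ltW.
by rewrite addr_ge0 // mulr_ge0 ?sqrtr_ge0 // addr_ge0 // mulr_ge0.
Qed.

Let Cp0 : 0 < Cp. Proof. by rewrite ltr_wpDl // pass_const_ge0. Qed.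

Definition at_boundary (j : nat) : Prop :=
  [/\ sub (run j).1 = None, dom (pg P) (iterate (outer (run j).1)) &
      0 < rho (outer (run j).1)].

(** Two consecutive passes of the program.  The last clause ensures that an
    iterate with a small residual, when it first appears, is a value of [xbar]. *)
Definition next_boundary (j j' : nat) : Prop :=
  let s := outer (run j).1 in let s' := outer (run j').1 in
  [/\ at_boundary j', (j <= j')%N, pass P theta alpha s s',
      Delta P (iterate s) != 0 ->
        (j' - j)%:R <= Cp * cost (A / (rho s * Num.sqrt (Delta P (iterate s)))) &
      iterate s' = iterate s \/ last_xbar (run j').1 = iterate s'].

Lemma next_boundary_exists j : at_boundary j -> exists j', next_boundary j j'.
Proof.
move=> [sj gj rj]; set s := outer (run j).1 in gj rj *.
have [D0|D0] := eqVneq (Delta P (iterate s)) 0.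
  exists j.+1.
  have E : (run j.+1).1 = State12 s None (iterate s).
    rewrite /= /step12 sj /start /=.
    by rewrite -/(F P _) -/(Delta P _) D0 eqxx.
  rewrite /next_boundary /at_boundary E /= -/s; split=> //.
  - exact: pass_stopped.
  - by rewrite D0 eqxx.
  - by left.
have Dpos : 0 < Delta P (iterate s) by rewrite lt_def D0 (Delta_ge0 AP gj).
have mu0 : 0 < rho s * Num.sqrt (Delta P (iterate s)) by rewrite mulr_gt0 ?sqrtr_gt0.
have [u gu umin] := model_argmin_exists AP (iterate s) mu0.
have [m mle me] := pass_terminates alpha AP theta01 abar1 bbar01 sigma0 mu0 gj (sJ j)
  gu umin sj erefl D0 erefl.
exists (j + m)%N; rewrite /next_boundary /at_boundary run12_iter -/s.
have count : (j + m - j)%:R <= Cp * cost (A / (rho s * Num.sqrt (Delta P (iterate s)))).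
  rewrite addKn; apply: (le_trans mle); rewrite [leRHS]mulrDl lerD2l ler_peMr //.
  by apply: cost_ge1; rewrite divr_ge0 ?ltW.
case: me => s0 gx Sx [[dec E]|[dec E]]; rewrite E /=; split=> //.
- exact: leq_addr.
- exact: pass_accepted D0 erefl Sx dec.
- by right.
- by split=> //; rewrite mulr_gt0 // (lt_trans _ alpha1).
- exact: leq_addr.
- exact: pass_rejected D0 erefl Sx dec.
- by left.
Qed.

Lemma boundaries : exists b : nat -> nat, [/\ b 0%N = 0%N,
  forall p, at_boundary (b p) & forall p, next_boundary (b p) (b p.+1)].
Proof.
have /choice[nxt nxtP] : forall j, exists j', at_boundary j -> next_boundary j j'.
  move=> j; have [bj|] := pselect (at_boundary j); last by exists j.
  by have [j' Hj] := next_boundary_exists bj; exists j'.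
have b0 : at_boundary 0 by [].
have bP p : at_boundary (iter p nxt 0%N).
  by elim: p => [//|p IH]; case: (nxtP _ IH).
by exists (fun p => iter p nxt 0%N); split=> // p; exact: nxtP.
Qed.

(** The cost of a subproblem grows when [Delta] decreases, but not faster than
    [1 / sqrt Delta]; this is why the final bound involves [Delta x0] only. *)
Lemma pass_cost_balance v rho_ : 0 < v -> v <= Num.sqrt (Delta P x0) ->
  rho_min <= rho_ ->
  cost (A / (rho_ * v)) * v <= 5 * Num.sqrt (Delta P x0)
     * cost (A / (rho_min * Num.sqrt (Delta P x0))).
Proof.
move=> v0; set u := Num.sqrt _ => vu rr.
have u0 : 0 < u by exact: lt_le_trans vu.
have r0 : 0 < rho_ by exact: lt_le_trans rr.
have l1 : 1 <= u / v by rewrite ler_pdivlMr // mul1r.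
have q0 : 0 <= A / (rho_min * u) by rewrite divr_ge0 ?mulr_ge0 // ltW.
have le : A / (rho_ * v) <= u / v * (A / (rho_min * u)).
  have -> : u / v * (A / (rho_min * u)) = A / (rho_min * v).
    by field; rewrite !gt_eqF.
  by rewrite ler_pM2l // lef_pV2 ?posrE ?mulr_gt0 // ler_pM2r.
have c1 : cost (A / (rho_ * v)) <= 5 * (u / v) * cost (A / (rho_min * u)).
  apply: le_trans (cost_scale l1 q0); apply: cost_mono => //.
  by rewrite divr_ge0 ?mulr_ge0 // ltW.
apply: (le_trans (ler_wpM2r (ltW v0) c1)).
rewrite le_eqVlt; apply/orP; left; apply/eqP; move: (cost _) => c.
by field; rewrite gt_eqF.
Qed.

Lemma pass_cost_power v rho_ (m e : R) k : 0 < m -> 0 < e <= 1 ->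
  m * (e ^+ k) ^+ 4 <= v -> rho_min <= rho_ ->
  cost (A / (rho_ * v)) <= 5 * (1 + A / (rho_min * m)) ^+ 3 / (e ^+ k) ^+ 3.
Proof.
move=> m0 /andP[e0 e1] mv rr.
have ek0 : 0 < e ^+ k by rewrite exprn_gt0.
have ek1 : e ^+ k <= 1 by rewrite exprn_ile1 // ltW.
move: (e ^+ k) ek0 ek1 mv => f f0 f1 mv.
have f4 : 0 < f ^+ 4 by rewrite exprn_gt0.
have v0 : 0 < v by apply: lt_le_trans mv; rewrite mulr_gt0.
have r0 : 0 < rho_ by exact: lt_le_trans rr.
have q1 : A / (rho_ * v) <= A / (rho_min * m) / f ^+ 4.
  have -> : A / (rho_min * m) / f ^+ 4 = A / (rho_min * m * f ^+ 4).
    by move: (A) (rho_min * m) (f ^+ 4) => a b c; rewrite invfM mulrA.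
  rewrite ler_pM2l // lef_pV2 ?posrE ?mulr_gt0 // -mulrA.
  by apply: ler_pM => //; rewrite ?mulr_ge0 // ltW.
set B := 1 + A / (rho_min * m).
have Am0 : 0 <= A / (rho_min * m) by rewrite divr_ge0 ?mulr_ge0 // ltW.
have B1 : 1 <= B by rewrite lerDl.
have w1 : 1 <= B / f by rewrite ler_pdivlMr // mul1r (le_trans f1).
have qw : 1 + A / (rho_ * v) <= (B / f) ^+ 4.
  apply: (@le_trans _ _ (B / f ^+ 4)).
    rewrite mulrDl; apply: lerD => //.
    by rewrite div1r invf_ge1 // exprn_ile1 // ltW.
  rewrite expr_div_n ler_pM2r ?invr_gt0 //.
  by rewrite exprS ler_peMr ?exprn_ege1 // (le_trans _ B1).
have q0 : 0 <= A / (rho_ * v) := divr_ge0 (ltW A0) (ltW (mulr_gt0 r0 v0)).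
apply: (le_trans (cost_le_pow q0 w1 qw)).
by rewrite expr_div_n -[leRHS]mulrA.
Qed.

Section Counting.
Variable b : nat -> nat.
Hypothesis b0 : b 0%N = 0%N.
Hypothesis b_at : forall p, at_boundary (b p).
Hypothesis b_next : forall p, next_boundary (b p) (b p.+1).
Local Notation s := (fun p => outer (run (b p)).1).
Local Notation v p := (Num.sqrt (Delta P (iterate (s p)))).

Lemma boundaries_run1 : run1 P theta alpha rho_min x0 s.
Proof. by split=> [|p]; [rewrite b0 | have [] := b_next p]. Qed.

Lemma boundaries_J p : opnorm ('J (pc P) (iterate (s p))) <= sigma.
Proof. exact: sJ. Qed.

Lemma boundary_sum p : (b p)%:R = \sum_(i < p) ((b i.+1 - b i)%:R : R).
Proof.
elim: p => [|p IH]; first by rewrite b0 big_ord0.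
rewrite big_ord_recr /= -IH -natrD subnKC //.
by have [] := b_next p.
Qed.

Local Notation inv := (run1_invariant AP theta01 alpha1 gx0 rho_min0 boundaries_run1).

Lemma bad_Delta_gt0 eps p : 0 < eps -> ~ (omega P (iterate (s p)) <= eps%:E)%E ->
  0 < Delta P (iterate (s p)).
Proof.
move=> e0 bad; have [gp _ _ _] := inv p.
rewrite lt_def (Delta_ge0 AP gp) andbT; apply/eqP => D0; apply: bad.
by apply: le_trans (omega_Delta0 AP gp D0) _; rewrite lee_fin ltW.
Qed.

Lemma boundary_cost eps p : 0 < eps -> ~ (omega P (iterate (s p)) <= eps%:E)%E ->
  (b p.+1 - b p)%:R <= Cp * cost (A / (rho (s p) * v p)).
Proof.
move=> e0 bad; have Dp := bad_Delta_gt0 e0 bad.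
by have [_ _ _ H _] := b_next p; apply: H; rewrite gt_eqF.
Qed.

(** The budget of [run1_budget] with the number of steps as cost, for
    [e = eps^(1/4)].  While [sqrt Delta] is at least of order [eps^2 = e^8], a
    pass takes [O(e^(-6))] steps; when it is at least of order [eps = e^4], as in
    the second case of [accepted_dichotomy], [O(e^(-3))]. *)
Lemma steps_le (m e : R) p : 0 < m -> 0 < e <= 1 ->
  (forall i, (i <= p)%N -> ~ (omega P (iterate (s i)) <= (e ^+ 4)%:E)%E) ->
  (forall i, (i < p)%N -> m * (e ^+ 2) ^+ 4 <= v i) ->
  (b p)%:R <= rmax / (rho_min * (alpha - 1))
       * (Cp * (5 * (1 + A / (rho_min * m)) ^+ 3 / (e ^+ 2) ^+ 3))
     + 64 / (1 - theta) * K * (Cp * (5 * Num.sqrt (Delta P x0)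
        * cost (A / (rho_min * Num.sqrt (Delta P x0))))) * gap P x0 / (e ^+ 4) ^+ 2
     + Cp * (5 * (1 + A / (rho_min * kap)) ^+ 3 / e ^+ 3)
        * Num.sqrt (Delta P x0) / (kap * e ^+ 4).
Proof.
move=> m0 e01 bad large; have /andP[e0 e1] := e01; rewrite boundary_sum.
have eps0 : 0 < e ^+ 4 by rewrite exprn_gt0.
have kap0 : 0 < kap by rewrite divr_gt0 ?mulr_gt0.
have pow0 (c : R) k : 0 < c -> 0 <= 5 * (1 + A / (rho_min * c)) ^+ 3 / (e ^+ k) ^+ 3.
  move=> c0; rewrite divr_ge0 ?mulr_ge0 ?exprn_ge0 ?addr_ge0 ?divr_ge0 //;
    by rewrite ?mulr_ge0 // ltW.
have u0 := sqrtr_ge0 (Delta P x0); set u := Num.sqrt (Delta P x0) in u0 *.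
have cost0 : 0 <= cost (A / (rho_min * u)).
  apply: (le_trans ler01); apply: cost_ge1.
  by apply: divr_ge0; [exact: ltW | apply: mulr_ge0; rewrite // ltW].
apply: (run1_budget (N := fun i => (b i.+1 - b i)%:R) AP theta01 alpha1 gx0 rho_min0
  sigma0 boundaries_run1 boundaries_J eps0 _ _ _ bad).
- exact: mulr_ge0 (ltW Cp0) (pow0 _ 2%N m0).
- by apply: mulr_ge0; [exact: ltW | rewrite !mulr_ge0].
- by have := mulr_ge0 (ltW Cp0) (pow0 _ 1%N kap0); rewrite expr1.
move=> i ip; have badi := bad i (ltnW ip).
have Di := bad_Delta_gt0 eps0 badi.
have [gi Di0 /andP[ri1 ri2] _] := inv i.
have vi0 : 0 < v i by rewrite sqrtr_gt0.
have viu : v i <= u by rewrite ler_wsqrtr.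
have Ni := boundary_cost eps0 badi.
split.
- rewrite ler0n /=; apply: (le_trans Ni); rewrite ler_pM2l //.
  exact: pass_cost_power m0 e01 (large i ip) ri1.
- apply: (le_trans (ler_wpM2r (ltW vi0) Ni)); rewrite -[leLHS]mulrA ler_pM2l //.
  exact: pass_cost_balance.
move=> kv; apply: (le_trans Ni); rewrite ler_pM2l //.
have := @pass_cost_power (v i) (rho (s i)) kap e 1 kap0 e01.
by rewrite expr1; apply.
Qed.

End Counting.

(** Steps before the pass that finds the point are counted by [steps_le]; that
    last pass is bounded by the cost of a subproblem if [Delta] is not too small
    there, and by [small_Delta_pass] otherwise.  With [e = eps^(1/4)] the main
    term is of order [e^(-8)] and all others are [O(e^(-7))]. *)
Lemma oracle_complexity :
  \forall eps \near 0^'+,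
    (exists j : nat,
      [/\ (run j).2%:R <= 38 * (64 / (1 - theta) * (Cp * 5))
             * (iteration_bound P theta alpha rho_min x0 eps
                * cost (A / (rho_min * Num.sqrt (Delta P x0)))),
          dom (pg P) (last_xbar (run j).1) &
          (omega P (last_xbar (run j).1) <= eps%:E)%E])
    /\ (exists j : nat, dom (pg P) (current_xbar (run j).1)
          /\ (omega P (current_xbar (run j).1) <= eps%:E)%E).
Proof.
have [b [b0 b_at b_next]] := boundaries.
have srun := boundaries_run1 b0 b_next; have sJ' := boundaries_J b.
have inv := run1_invariant AP theta01 alpha1 gx0 rho_min0 srun.
have reach (eps : R) : 0 < eps -> _ :=
  @run1_reaches _ _ _ _ _ _ _ _ _ _ AP theta01 alpha1 gx0 rho_min0 sigma0 srun sJ' eps.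
have current (eps : R) : 0 < eps -> exists j : nat, dom (pg P) (current_xbar (run j).1)
          /\ (omega P (current_xbar (run j).1) <= eps%:E)%E.
  move=> e0; have [p gp _] := reach _ e0; exists (b p).
  by have [sp gx _] := b_at p; rewrite /current_xbar sp.
set u : R := Num.sqrt (Delta P x0); have u_ge0 : 0 <= u by exact: sqrtr_ge0.
set G := cost (A / (rho_min * u)).
have [gap0|gapn] := eqVneq (gap P x0) 0.
  near=> eps; have e0 : 0 < eps by near: eps; exact: nbhs_right_gt.
  split; last exact: current.
  exists 0%N; split=> //=.
    by rewrite /iteration_bound gap0 mulr0 !mul0r mulr0.
  by apply: le_trans (omega_gap0 AP gx0 gap0) _; rewrite lee_fin ltW.
have gap0 : 0 < gap P x0 by rewrite lt_def gapn (gap_ge0 AP).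
have D0 : 0 < Delta P x0 by exact: lt_le_trans gap0 (gap_le_Delta AP gx0).
have u0 : 0 < u by rewrite sqrtr_gt0.
have G0 : 0 < G.
  by apply: (lt_le_trans ltr01); apply: cost_ge1; rewrite divr_ge0 ?mulr_ge0 // ltW.
have rm0 : 0 < rmax := lt_le_trans rho_min0 (rho_min_le_max rho_min AP theta01 alpha1).
have K0 : 0 < K.
  rewrite ltr_wpDr // divr_ge0 ?(ltW rho_min0) //.
  by apply: mulr_ge0; [exact: sqr_ge0 | exact: ltW].
have kap0 : 0 < kap by rewrite divr_gt0 ?mulr_gt0.
have a10 : 0 < abar - 1 by rewrite subr_gt0.
have al10 : 0 < alpha - 1 by rewrite subr_gt0.
have abar0 : 0 < abar by exact: lt_trans abar1.
pose lip (D : R) := Lc P * (Num.sqrt (2 * Lh P * D) + Lh P * (sigma + Lc P / 2))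
   + sigma * Lh P * (sigma + Lc P / 2).
pose L0 : R := lip (Delta P x0) + abar * (A + rmax * u).
have L00 : 0 <= L0.
  have sL : 0 <= sigma + Lc P / 2 by rewrite addr_ge0 ?(ltW sigma0) // divr_ge0 // ltW.
  apply: addr_ge0; last first.
    by apply: mulr_ge0; [exact: ltW | rewrite addr_ge0 ?mulr_ge0 // ltW].
  apply: addr_ge0; last by apply: mulr_ge0 => //; apply: mulr_ge0; exact: ltW.
  apply: mulr_ge0; first exact: ltW.
  by apply: addr_ge0; [exact: sqrtr_ge0 | apply: mulr_ge0 => //; exact: ltW].
have L10 : 0 < 1 + L0 by rewrite ltr_pwDl.
pose delta : R := (1 + L0)^-1.
have d0 : 0 < delta by rewrite invr_gt0.
have d1 : delta <= 1 by rewrite invf_le1 // lerDl.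
pose m0 : R := rho_min * delta ^+ 2 / 4.
have m00 : 0 < m0 by rewrite divr_gt0 // mulr_gt0 // exprn_gt0.
pose c0 : R := 64 / (1 - theta) * K * (Cp * (5 * u * G)) * gap P x0.
have c00 : 0 < c0.
  have h1 : 0 < 64 / (1 - theta) * K by rewrite mulr_gt0 // divr_gt0.
  have h2 : 0 < Cp * (5 * u * G) by apply: mulr_gt0 => //; rewrite !mulr_gt0.
  by rewrite /c0; apply: mulr_gt0 => //; apply: mulr_gt0.
pose R0 : R := rmax / (rho_min * (alpha - 1)).
pose E1 : R := Cp * (5 * (1 + A / (rho_min * m0)) ^+ 3).
pose E2 : R := Cp * (5 * (1 + A / (rho_min * kap)) ^+ 3) * u / kap.
pose B3 : R := 2 * (sigma * Num.sqrt (2 * Lh P)) / (rho_min * delta * (abar - 1)).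
have R00 : 0 <= R0 by rewrite divr_ge0 ?(ltW rm0) // mulr_ge0 // ltW.
have pow0 (c : R) : 0 < c -> 0 <= Cp * (5 * (1 + A / (rho_min * c)) ^+ 3).
  move=> cp; apply: mulr_ge0; first exact: ltW.
  apply: mulr_ge0 => //; apply: exprn_ge0; apply: addr_ge0 => //.
  by apply: divr_ge0; [exact: ltW | apply: mulr_ge0; exact: ltW].
have E10 : 0 <= E1 := pow0 _ m00.
have E20 : 0 <= E2.
  by apply: divr_ge0; [apply: mulr_ge0 => //; exact: pow0 | exact: ltW].
have B30 : 0 <= B3.
  apply: divr_ge0; last by apply: mulr_ge0; [apply: mulr_ge0|]; exact: ltW.
  by apply: mulr_ge0 => //; apply: mulr_ge0; [exact: ltW | exact: sqrtr_ge0].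
pose Mtot : R := R0 * E1 + E1 + E2 + B3 + 2.
near=> eps.
have [/andP[eps0 eps1] small] : 0 < eps < 1 /\ Mtot * Num.sqrt (Num.sqrt eps) < c0.
  by near: eps; exact: near0_fourth_root.
split; last exact: current.
set e : R := Num.sqrt (Num.sqrt eps) in small.
have e0 : 0 < e by rewrite !sqrtr_gt0.
have e1 : e <= 1.
  rewrite -[leRHS]sqrtr1 ler_wsqrtr // -[leRHS]sqrtr1 ler_wsqrtr //; exact: ltW.
have e4 : e ^+ 4 = eps.
  by rewrite (exprM e 2 2) !sqr_sqrtr ?sqrtr_ge0 // ltW.
have e01 : 0 < e <= 1 by rewrite e0.
have main : 38 * (64 / (1 - theta) * (Cp * 5))
    * (iteration_bound P theta alpha rho_min x0 eps * G) = 19 * (2 * c0 / e ^+ 8).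
  rewrite /iteration_bound -/u /c0 -e4 -exprM; move: (K) (Cp) (G) (u) => k c g w.
  move: (64 / _) (gap P x0) => t ga; ring.
have enough (j : nat) (X : R) : j%:R <= R0 * (E1 / (e ^+ 2) ^+ 3) + c0 / (e ^+ 4) ^+ 2
     + E2 / e ^+ 7 + X -> X <= (E1 + B3 + 2) / e ^+ 7 ->
   (run j).2%:R <= 38 * (64 / (1 - theta) * (Cp * 5))
      * (iteration_bound P theta alpha rho_min x0 eps * G).
  move=> jle Xle; rewrite main.
  apply: (@le_trans _ _ (19 * j)%:R); first by rewrite ler_nat run12_calls.
  rewrite natrM ler_pM2l //; apply: (le_trans jle).
  have -> : (e ^+ 2) ^+ 3 = e ^+ 6 by rewrite -exprM.
  have -> : (e ^+ 4) ^+ 2 = e ^+ 8 by rewrite -exprM.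
  have e7 : 0 < e ^+ 7 by rewrite exprn_gt0.
  have e67 : e ^+ 7 <= e ^+ 6.
    by rewrite [e ^+ 7]exprS ler_piMl // exprn_ge0 // ltW.
  have h6 : R0 * (E1 / e ^+ 6) <= R0 * E1 / e ^+ 7.
    rewrite -[leRHS]mulrA; apply: ler_wpM2l => //; apply: ler_wpM2l => //.
    by rewrite lef_pV2 // posrE exprn_gt0.
  have h7 : Mtot / e ^+ 7 <= c0 / e ^+ 8.
    rewrite ler_pdivrMr // mulrAC ler_pdivlMr ?exprn_gt0 //.
    by rewrite [e ^+ 8]exprS mulrA ler_pM2r // ltW.
  have -> : 2 * c0 / e ^+ 8 = c0 / e ^+ 8 + c0 / e ^+ 8 by ring.
  have MtotE : Mtot / e ^+ 7 = R0 * E1 / e ^+ 7 + E2 / e ^+ 7 + (E1 + B3 + 2) / e ^+ 7.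
    by rewrite /Mtot; ring.
  by move: h6 h7 Xle; rewrite MtotE; lra.
have stepsE p : (forall i, (i <= p)%N ->
     ~ (omega P (iterate (outer (run (b i)).1)) <= eps%:E)%E) ->
  (forall i, (i < p)%N -> m0 * (e ^+ 2) ^+ 4
      <= Num.sqrt (Delta P (iterate (outer (run (b i)).1)))) ->
  (b p)%:R <= R0 * (E1 / (e ^+ 2) ^+ 3) + c0 / (e ^+ 4) ^+ 2 + E2 / e ^+ 7.
  move=> bad large; rewrite -e4 in bad.
  apply: (le_trans (steps_le b0 b_next m00 e01 bad large)); rewrite -/u -/G -/R0.
  have t1 (r c x y : R) : r * (c * (x / y)) = r * (c * x / y).
    by rewrite [c * (x / y)]mulrA.
  have t3 (c x w k y z : R) : c * (x / y) * w / (k * z) = c * x * w / k / (y * z).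
    by rewrite !invfM; ring.
  have -> : e ^+ 7 = e ^+ 3 * e ^+ 4 by rewrite -exprD.
  by rewrite (t1 R0 Cp _ ((e ^+ 2) ^+ 3)) (t3 Cp _ u kap (e ^+ 3) (e ^+ 4)).
have [p gp bad] := reach _ eps0.
case: p gp bad => [g0 _|p gp bad].
  exists 0%N; split; [|exact: gx0|by move: g0; rewrite b0].
  rewrite main; apply: mulr_ge0 => //; apply: divr_ge0; last exact: exprn_ge0 (ltW e0).
  by apply: mulr_ge0 => //; exact: ltW.
have badp i : (i <= p)%N -> ~ (omega P (iterate (outer (run (b i)).1)) <= eps%:E)%E.
  by move=> ip; apply: bad.
have [smallD|largeD] := pselect (exists i, (i <= p)%N &&
  (Num.sqrt (Delta P (iterate (outer (run (b i)).1))) < m0 * (e ^+ 2) ^+ 4)).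
  case: (ex_minnP smallD) => i /andP[ip vi] imin.
  have large i' : (i' < i)%N -> m0 * (e ^+ 2) ^+ 4
      <= Num.sqrt (Delta P (iterate (outer (run (b i')).1))).
    move=> i'i; rewrite leNgt; apply/negP => lt.
    have := imin i'; rewrite lt (leq_trans (ltnW i'i) ip) => /(_ isT).
    by rewrite leqNgt i'i.
  have bi : (b i)%:R <= R0 * (E1 / (e ^+ 2) ^+ 3) + c0 / (e ^+ 4) ^+ 2 + E2 / e ^+ 7.
    by apply: stepsE large => i' i'i; apply: badp; exact: leq_trans ip.
  have [gi Di0 /andP[ri1 ri2] _] := inv i.
  have Di := bad_Delta_gt0 b0 b_next eps0 (badp i ip).
  have [si _ _] := b_at i.
  have eps_le1 : 0 < eps <= 1 by rewrite eps0 ltW.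
  have delta01 : 0 < delta <= 1 by rewrite d0 d1.
  have LipD : (lip (Delta P (iterate (outer (run (b i)).1)))
     + abar * (A + rho (outer (run (b i)).1)
                   * Num.sqrt (Delta P (iterate (outer (run (b i)).1))))) * delta <= 1.
    apply: (@le_trans _ _ (L0 * delta)); last first.
      by rewrite ler_pdivrMr // mul1r lerDr.
    apply: (ler_wpM2r (ltW d0)); apply: lerD.
      rewrite /lip lerD2r; apply: (ler_wpM2l (ltW Lc0)); rewrite lerD2r.
      by rewrite ler_wsqrtr // ler_wpM2l // mulr_ge0 // ltW.
    apply: (ler_wpM2l (ltW abar0)); rewrite lerD2l; apply: ler_pM => //.
    - exact: le_trans (ltW rho_min0) ri1.
    - by rewrite ler_wsqrtr.
  have vsmall : Num.sqrt (Delta P (iterate (outer (run (b i)).1)))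
      <= rho_min * (delta * eps) ^+ 2 / 4.
    have -> : rho_min * (delta * eps) ^+ 2 / 4 = m0 * (e ^+ 2) ^+ 4.
      by rewrite -e4 /m0; move: (e) => e'; ring.
    exact: ltW vi.
  have [m [mle gm om]] := small_Delta_pass theta alpha bbar AP abar1 sigma0 gi (sJ' i)
    Di rho_min0 ri1 si erefl eps_le1 delta01 LipD vsmall.
  exists (b i + m)%N; rewrite run12_iter; split => //.
  apply: enough; first by rewrite natrD; apply: lerD bi mle.
  have -> : 2 * (sigma * Num.sqrt (2 * Lh P)) / (rho_min * delta * (abar - 1) * eps) =
      B3 / e ^+ 4.
    have assoc (x y w : R) : x / (y * w) = x / y / w by rewrite invfM mulrA.
    by rewrite e4 assoc.
  have h3 : B3 / e ^+ 4 <= B3 / e ^+ 7.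
    by apply: ler_wpM2l => //; rewrite lef_pV2 ?posrE ?exprn_gt0 // ler_wiXn2l // ltW.
  have h2 : 2 <= 2 / e ^+ 7.
    by rewrite ler_pdivlMr ?exprn_gt0 // ler_piMr // exprn_ile1 // ltW.
  have h1 : 0 <= E1 / e ^+ 7 by rewrite divr_ge0 // exprn_ge0 // ltW.
  have -> : (E1 + B3 + 2) / e ^+ 7 = E1 / e ^+ 7 + (B3 / e ^+ 7 + 2 / e ^+ 7) by ring.
  by apply: ler_wpDl => //; apply: lerD.
have large i : (i <= p)%N -> m0 * (e ^+ 2) ^+ 4
      <= Num.sqrt (Delta P (iterate (outer (run (b i)).1))).
  by move=> ip; rewrite leNgt; apply/negP => lt; apply: largeD; exists i; rewrite ip.
exists (b p.+1).
have [_ le _ _ same] := b_next p.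
have lastE : last_xbar (run (b p.+1)).1 = iterate (outer (run (b p.+1)).1).
  case: same => // eq_it; case: (badp p (leqnn p)).
  by rewrite -eq_it.
have [gp' _ _ _] := inv p.+1.
rewrite lastE; split=> //.
have bp : (b p)%:R <= R0 * (E1 / (e ^+ 2) ^+ 3) + c0 / (e ^+ 4) ^+ 2 + E2 / e ^+ 7.
  by apply: stepsE => // i ip; apply: large; exact: ltnW.
have Np : (b p.+1 - b p)%:R <= E1 / (e ^+ 2) ^+ 3.
  apply: (le_trans (boundary_cost b0 b_next eps0 (badp p (leqnn p)))).
  have [_ _ /andP[rp1 _] _] := inv p.
  rewrite /E1 -[leRHS]mulrA ler_pM2l //.
  exact: pass_cost_power m00 e01 (large p (leqnn p)) rp1.
apply: (enough (b p.+1) (E1 / (e ^+ 2) ^+ 3)).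
  by rewrite -(subnKC le) natrD; apply: lerD.
have -> : (e ^+ 2) ^+ 3 = e ^+ 6 by rewrite -exprM.
apply: (@le_trans _ _ (E1 / e ^+ 7)).
  apply: ler_wpM2l => //; rewrite lef_pV2 ?posrE ?exprn_gt0 //.
  by rewrite [e ^+ 7]exprS ler_piMl // exprn_ge0 // ltW.
by rewrite ler_pM2r ?invr_gt0 ?exprn_gt0 // -addrA lerDl addr_ge0.
Unshelve. all: by end_near. Qed.

End OracleRun.


(** * The bounds of the theorem *)

Section Bounds.
Context {R : realType} {d n : nat} (P : problem R d n).
Variables (theta alpha rho_min sigma : R) (x0 : 'rV[R]_d).
Hypothesis AP : assumptions P.
Hypothesis theta01 : 0 < theta < 1.
Hypothesis alpha1 : 1 < alpha.
Hypothesis gx0 : dom (pg P) x0.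
Hypothesis rho_min0 : 0 < rho_min.

Let Lh0 : 0 < Lh P := Lh_gt0 AP.
Let Lc0 : 0 < Lc P := Lc_gt0 AP.
Let theta1 : 0 < 1 - theta. Proof. by case/andP: theta01; rewrite subr_gt0. Qed.
Let X0 : 0 < Lc P * Num.sqrt (Lh P). Proof. by rewrite mulr_gt0 ?sqrtr_gt0. Qed.

Lemma iteration_bound_ge0 eps : 0 <= iteration_bound P theta alpha rho_min x0 eps.
Proof.
apply: mulr_ge0; first apply: mulr_ge0.
- by apply: divr_ge0; [exact: sqrtr_ge0 | exact: sqr_ge0].
- exact: (gap_ge0 AP).
apply: addr_ge0.
  exact: le_trans (ltW rho_min0) (rho_min_le_max rho_min AP theta01 alpha1).
by apply: divr_ge0; [apply: mulr_ge0; [exact: sqr_ge0|]|]; exact: ltW.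
Qed.

Lemma core_oracle_bound_le eps :
  iteration_bound P theta alpha rho_min x0 eps
    * subproblem_cost (Lh P * sigma ^+ 2 / (rho_min * Num.sqrt (Delta P x0)))
  <= oracle_bound P theta alpha rho_min sigma x0 eps.
Proof.
rewrite /oracle_bound -/(subproblem_cost _); apply: ler_wpM2r.
  apply: (le_trans ler01); apply: cost_ge1.
  apply: divr_ge0; apply: mulr_ge0; rewrite ?sqr_ge0 ?sqrtr_ge0 //; exact: ltW.
by rewrite ler_peMr ?iteration_bound_ge0 // lerDl /logp le_max lexx orbT.
Qed.

Section Theta.
Variables c1 c2 : R.
Hypothesis c10 : 0 < c1.
Hypothesis c20 : 0 < c2.
Hypothesis rho_minP :
  c1 * (Lc P * Num.sqrt (Lh P)) <= rho_min <= c2 * (Lc P * Num.sqrt (Lh P)).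

Lemma iteration_bound_le_simple eps :
  iteration_bound P theta alpha rho_min x0 eps <=
  (2 * alpha / (1 - theta) + c2 + c1^-1) * simple_iteration_bound P x0 eps.
Proof.
have /andP[lo hi] := rho_minP; set X := Lc P * Num.sqrt (Lh P) in lo hi.
have al0 : 0 < alpha by exact: lt_trans alpha1.
have rmaxX : rho_max P theta alpha rho_min <= (2 * alpha / (1 - theta) + c2) * X.
  have p1 : 0 <= 2 * alpha / (1 - theta) * X.
    by rewrite mulr_ge0 ?(ltW X0) // divr_ge0 ?(ltW theta1) // mulr_ge0 // ltW.
  have p2 : 0 <= c2 * X by rewrite mulr_ge0 // ltW.
  rewrite /rho_max [leRHS]mulrDl; case: ifP => _; last by apply: (le_trans hi); lra.
  have s2 : Num.sqrt (2 * Lh P) <= 2 * Num.sqrt (Lh P).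
    rewrite sqrtrM // ler_wpM2r ?sqrtr_ge0 //.
    by rewrite -(@ler_pXn2r _ 2) ?nnegrE // sqr_sqrtr //; lra.
  apply: (@le_trans _ _ (2 * alpha / (1 - theta) * X)); last by lra.
  have -> : 2 * alpha / (1 - theta) * X =
     alpha * (Lc P * (2 * Num.sqrt (Lh P)) / (1 - theta)) by rewrite /X; ring.
  by rewrite ler_pM2l // ler_pM2r ?invr_gt0 // ler_pM2l.
have quo : Lc P ^+ 2 * Lh P / rho_min <= c1^-1 * X.
  have -> : Lc P ^+ 2 * Lh P = X ^+ 2 by rewrite exprMn sqr_sqrtr // ltW.
  have XR : X <= c1^-1 * rho_min by rewrite ler_pdivlMl.
  rewrite ler_pdivrMr // expr2 (_ : c1^-1 * X * rho_min = X * (c1^-1 * rho_min)).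
    exact: (ler_wpM2l (ltW X0) XR).
  by ring.
have -> : simple_iteration_bound P x0 eps =
   X * (Num.sqrt (Delta P x0) / eps ^+ 2 * gap P x0).
  rewrite /simple_iteration_bound /X sqrtrM ?(ltW Lh0) //.
  move: (Num.sqrt _) (Num.sqrt _) (gap _ _) => a e w; ring.
rewrite /iteration_bound mulrC mulrA; apply: ler_wpM2r.
  apply: mulr_ge0; last exact: (gap_ge0 AP).
  by apply: divr_ge0; [exact: sqrtr_ge0 | exact: sqr_ge0].
by rewrite [leRHS]mulrDl; apply: lerD.
Qed.

Lemma oracle_bound_le_simple eps : 0 < Delta P x0 -> 0 < sigma ->
  iteration_bound P theta alpha rho_min x0 eps
    * subproblem_cost (Lh P * sigma ^+ 2 / (rho_min * Num.sqrt (Delta P x0)))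
  <= (2 * alpha / (1 - theta) + c2 + c1^-1) * (5 * (1 + c1^-1))
     * simple_oracle_bound P sigma x0 eps.
Proof.
move=> D0 s0; have /andP[lo _] := rho_minP.
have u0 : 0 < Num.sqrt (Delta P x0) by rewrite sqrtr_gt0.
have l0 : 0 < Num.sqrt (Lh P) by rewrite sqrtr_gt0.
pose k0 := Num.sqrt (Lh P) * sigma ^+ 2 / (Lc P * Num.sqrt (Delta P x0)).
have k00 : 0 <= k0.
  by apply: divr_ge0; apply: mulr_ge0; rewrite ?sqr_ge0 // ltW.
have ci : 0 < c1^-1 by rewrite invr_gt0.
have -> : (2 * alpha / (1 - theta) + c2 + c1^-1) * (5 * (1 + c1^-1))
     * simple_oracle_bound P sigma x0 eps =
  (2 * alpha / (1 - theta) + c2 + c1^-1) * simple_iteration_bound P x0 eps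
   * (5 * (1 + c1^-1) * subproblem_cost k0).
  rewrite /simple_oracle_bound -/k0 -/(subproblem_cost k0).
  move: (simple_iteration_bound _ _ _) (subproblem_cost _) (_ + c2) => a e w; ring.
have q0 : 0 <= Lh P * sigma ^+ 2 / (rho_min * Num.sqrt (Delta P x0)).
  by apply: divr_ge0; apply: mulr_ge0; rewrite ?sqr_ge0 // ltW.
apply: ler_pM.
- exact: iteration_bound_ge0.
- exact: le_trans ler01 (cost_ge1 q0).
- exact: iteration_bound_le_simple.
have c1i : 1 <= 1 + c1^-1 by rewrite lerDl ltW.
apply: le_trans (cost_scale c1i k00); apply: cost_mono => //.
apply: (@le_trans _ _ (c1^-1 * k0)); last first.
  by rewrite ler_wpM2r // lerDr.
have -> : c1^-1 * k0 = Lh P * sigma ^+ 2 /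
    (c1 * (Lc P * Num.sqrt (Lh P)) * Num.sqrt (Delta P x0)).
  rewrite /k0 -{2}(sqr_sqrtr (ltW Lh0)).
  move: (Num.sqrt (Lh P)) (Num.sqrt _) l0 u0 => l w l00 w0.
  by field; rewrite !gt_eqF.
apply: ler_wpM2l; first by apply: mulr_ge0; [exact: ltW | exact: sqr_ge0].
by rewrite lef_pV2 ?posrE ?mulr_gt0 // ler_pM2r.
Qed.

End Theta.

End Bounds.

Theorem theorem1 (R : realType) (theta alpha : R)
    (theta01 : 0 < theta < 1) (alpha1 : 1 < alpha) :
  (* (a), general rho_min *)
  (exists2 C : R, 0 < C &
    forall (d n : nat) (P : problem R d n) (x0 : 'rV[R]_d) (rho_min sigma : R)
      (s : nat -> state1 R d),
    assumptions P -> dom (pg P) x0 -> 0 < rho_min -> 0 < sigma ->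
    run1 P theta alpha rho_min x0 s ->
    (forall j, opnorm ('J (pc P) (iterate (s j))) <= sigma) ->
    \forall eps \near 0^'+, exists j : nat,
      [/\ j%:R <= C * iteration_bound P theta alpha rho_min x0 eps,
          dom (pg P) (iterate (s j)) &
          (omega P (iterate (s j)) <= eps%:E)%E])
  /\
  (* (a), rho_min = Theta(Lc sqrt(Lh)) *)
  (forall c1 c2 : R, 0 < c1 -> 0 < c2 -> exists2 C : R, 0 < C &
    forall (d n : nat) (P : problem R d n) (x0 : 'rV[R]_d) (rho_min sigma : R)
      (s : nat -> state1 R d),
    assumptions P -> dom (pg P) x0 -> 0 < rho_min -> 0 < sigma ->
    c1 * (Lc P * Num.sqrt (Lh P)) <= rho_min
      <= c2 * (Lc P * Num.sqrt (Lh P)) ->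
    run1 P theta alpha rho_min x0 s ->
    (forall j, opnorm ('J (pc P) (iterate (s j))) <= sigma) ->
    \forall eps \near 0^'+, exists j : nat,
      [/\ j%:R <= C * simple_iteration_bound P x0 eps,
          dom (pg P) (iterate (s j)) &
          (omega P (iterate (s j)) <= eps%:E)%E])
  /\
  (forall abar bbar : R, 1 < abar -> 0 < bbar < 1 ->
  (* (b), general rho_min *)
  (exists2 C : R, 0 < C &
    forall (d n : nat) (P : problem R d n) (x0 : 'rV[R]_d) (rho_min sigma : R),
    let s := run12 P theta alpha abar bbar rho_min x0 in
    assumptions P -> dom (pg P) x0 -> 0 < Delta P x0 ->
    0 < rho_min -> 0 < sigma ->
    (forall j, opnorm ('J (pc P) (iterate (outer (s j).1))) <= sigma) ->
    \forall eps \near 0^'+,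
      (exists j : nat,
        [/\ (s j).2%:R <= C * oracle_bound P theta alpha rho_min sigma x0 eps,
            dom (pg P) (last_xbar (s j).1) &
            (omega P (last_xbar (s j).1) <= eps%:E)%E])
      /\ (exists j : nat, dom (pg P) (current_xbar (s j).1)
            /\ (omega P (current_xbar (s j).1) <= eps%:E)%E))
  /\
  (* (b), rho_min = Theta(Lc sqrt(Lh)) *)
  (forall c1 c2 : R, 0 < c1 -> 0 < c2 -> exists2 C : R, 0 < C &
    forall (d n : nat) (P : problem R d n) (x0 : 'rV[R]_d) (rho_min sigma : R),
    let s := run12 P theta alpha abar bbar rho_min x0 in
    assumptions P -> dom (pg P) x0 -> 0 < Delta P x0 ->
    0 < rho_min -> 0 < sigma ->
    c1 * (Lc P * Num.sqrt (Lh P)) <= rho_min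
      <= c2 * (Lc P * Num.sqrt (Lh P)) ->
    (forall j, opnorm ('J (pc P) (iterate (outer (s j).1))) <= sigma) ->
    \forall eps \near 0^'+,
      (exists j : nat,
        [/\ (s j).2%:R <= C * simple_oracle_bound P sigma x0 eps,
            dom (pg P) (last_xbar (s j).1) &
            (omega P (last_xbar (s j).1) <= eps%:E)%E])
      /\ (exists j : nat, dom (pg P) (current_xbar (s j).1)
            /\ (omega P (current_xbar (s j).1) <= eps%:E)%E))).
Proof.
have theta1 : 0 < 1 - theta by case/andP: theta01; rewrite subr_gt0.
have al0 : 0 < alpha by exact: lt_trans alpha1.
have Ca : 0 < 128 / (1 - theta) by rewrite divr_gt0.
have Kc (c1 c2 : R) : 0 < c1 -> 0 < c2 -> 0 < 2 * alpha / (1 - theta) + c2 + c1^-1.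
  by move=> c10 c20; rewrite !addr_gt0 ?invr_gt0 // divr_gt0 // mulr_gt0.
have Cb (abar bbar : R) : 1 < abar -> 0 < bbar < 1 ->
    0 < 38 * (64 / (1 - theta) * ((pass_const theta abar bbar + 2) * 5)).
  move=> abar1 bbar01; have pc0 := pass_const_ge0 theta01 abar1 bbar01.
  have Cp0 : 0 < pass_const theta abar bbar + 2 by rewrite ltr_wpDl.
  have C64 : 0 < 64 / (1 - theta) by rewrite divr_gt0.
  by rewrite mulr_gt0 // mulr_gt0 // mulr_gt0.
split; [|split; [|move=> abar bbar abar1 bbar01; split]].
- exists (128 / (1 - theta)) => // d n P x0 rho_min sigma s AP gx0 rm0 s0 run sJ.
  exact: (outer_complexity AP theta01 alpha1 gx0 rm0 s0 run sJ).
- move=> c1 c2 c10 c20.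
  exists (128 / (1 - theta) * (2 * alpha / (1 - theta) + c2 + c1^-1)).
    by rewrite mulr_gt0 ?Kc.
  move=> d n P x0 rho_min sigma s AP gx0 rm0 s0 rP run sJ.
  have := outer_complexity AP theta01 alpha1 gx0 rm0 s0 run sJ.
  apply: filterS => eps [j [jle gj oj]]; exists j; split=> //.
  apply: (le_trans jle); rewrite -[leRHS]mulrA; apply: ler_wpM2l; first exact: ltW.
  exact: iteration_bound_le_simple.
- exists (38 * (64 / (1 - theta) * ((pass_const theta abar bbar + 2) * 5))).
    exact: Cb.
  move=> d n P x0 rho_min sigma s AP gx0 D0 rm0 s0 sJ.
  have := oracle_complexity AP theta01 alpha1 abar1 bbar01 gx0 rm0 s0 sJ.
  apply: filterS => eps [[j [jle gj oj]] cur]; split=> //; exists j; split=> //.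
  apply: (le_trans jle); apply: ler_wpM2l; first exact: ltW (Cb _ _ abar1 bbar01).
  exact: core_oracle_bound_le.
- move=> c1 c2 c10 c20.
  exists (38 * (64 / (1 - theta) * ((pass_const theta abar bbar + 2) * 5))
    * ((2 * alpha / (1 - theta) + c2 + c1^-1) * (5 * (1 + c1^-1)))).
    apply: mulr_gt0; first exact: Cb.
    by apply: mulr_gt0; [exact: Kc | rewrite mulr_gt0 // ltr_pwDl // invr_ge0 ltW].
  move=> d n P x0 rho_min sigma s AP gx0 D0 rm0 s0 rP sJ.
  have := oracle_complexity AP theta01 alpha1 abar1 bbar01 gx0 rm0 s0 sJ.
  apply: filterS => eps [[j [jle gj oj]] cur]; split=> //; exists j; split=> //.
  apply: (le_trans jle); rewrite -[leRHS]mulrA.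
  apply: ler_wpM2l; first exact: ltW (Cb _ _ abar1 bbar01).
  exact: oracle_bound_le_simple.
Qed.
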